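(* Let $n\ge2$ and let ${\bf m}$ be a multisegment over ${\bf Z}/n{\bf Z}$ and $i\in{\bf Z}/n{\bf Z}$. For $k\in{\bf N}^*$ put $S_{k,i}=\sum_{\ell\ge k}(m_{(\ell;i-1]}-m_{(\ell;i]})$, and let $k_0\in{\bf N}^*$ be minimal such that $S_{k_0,i}=\min_{k\in{\bf N}^*}S_{k,i}$. Then $\tilde f_i\langle{\bf m}\rangle\equiv\langle{\bf m}^+_{k_0,i}\rangle \bmod v{\cal L}$, i.e. there is an arrow ${\bf m}\xrightarrow{i}{\bf m}^+_{k_0,i}$ in the crystal graph $\widehat B(\infty)$ of ${\cal H}$.
   Context: Segments over $I={\bf Z}/n{\bf Z}$: $(\ell;i]=[i-\ell+1,\dots,i]$; multisegments ${\bf m}=\sum m_{(\ell;i]}(\ell;i]$. ${\bf k}[\ell;i]$: indecomposable nilpotent representation of length $\ell$ with head at vertex $i$ of the cyclic quiver (vertices $I$, arrows $i\to i-1$); ${\bf k}[{\bf m}]=\bigoplus{\bf k}[\ell;i]^{\oplus m_{(\ell;i]}}$ with graded dimension ${\bf dim}\,{\bf m}$. $F^{\bf c}_{{\bf a},{\bf b}}(q)$ = number of subrepresentations of ${\bf F}_q[{\bf c}]$ isomorphic to ${\bf F}_q[{\bf b}]$ with quotient $\cong{\bf F}_q[{\bf a}]$ (polynomial in $q$). The twisted Hall algebra ${\cal H}$ is the ${\bf C}(v)$-algebra with basis $u_{\bf m}$ and product $u_{\bf a}\circ u_{\bf b}=v^{m({\bf dim}\,{\bf a},{\bf dim}\,{\bf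 b})}\sum_{\bf c}F^{\bf c}_{{\bf a},{\bf b}}(v^{-2})u_{\bf c}$, $m({\bf a},{\bf b})=\sum_ia_ib_{i-1}+\sum_ia_ib_i$. PBW basis $\langle{\bf m}\rangle=v^{\sum_id_i^2-\varepsilon({\bf m})}u_{\bf m}$ (${\bf d}={\bf dim}\,{\bf m}$, $\varepsilon({\bf m})=\dim{\rm End}\,{\bf k}[{\bf m}]$); ${\cal L}$ is the ${\bf Z}[v]$-span of the PBW basis. $f_i$ acts by left multiplication by $\langle(1;i]\rangle$; $e'_i$ is its adjoint for the symmetric form with the PBW basis orthogonal and $(\langle{\bf m}\rangle,\langle{\bf m}\rangle)=\prod_{i,\ell}v^{-\binom{m_{(\ell;i]}}{2}}(1-v^2)^{(\ell-1)m_{(\ell;i]}}/[m_{(\ell;i]}]!$, where $[a]=(v^a-v^{-a})/(v-v^{-1})$. Kashiwara operator: every $x\in{\cal H}$ is uniquely written $x=\sum_{k\ge0}f_i^{(k)}x_k$ with $e'_ix_k=0$, $f_i^{(k)}=f_i^k/[k]!$, and $\tilde f_ix:=\sum_kf_i^{(k+1)}x_k$. The crystal graph $\widehat B(\infty)$ has vertices the multisegments and an arrow ${\bf m}\xrightarrow{i}{\bf m}'$ iff $\tilde f_i\langle{\bf m}\rangle\equiv\langle{\bf m}'\rangle\bmod v{\cal L}$. Notation: ${\bf m}^+_{1,i}={\bf m}+(1;i]$; for $\ell>1$, ${\bf m}^+_{\ell,i}={\bf m}+(\ell;i]-(\ell-1;i-1]$ (here $m_{(k_0-1;i-1]}>0$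 automatically when $k_0>1$). *)

(* Defs.v *)
From HB Require Import structures.
From mathcomp Require Import all_boot all_algebra.
From mathcomp Require Import reals complex fraction.
From mathcomp Require Import monalg.
From mathcomp Require Import finmap multiset.
From Stdlib Require Import ClassicalEpsilon.

Set Implicit Arguments.
Unset Strict Implicit.
Unset Printing Implicit Defensive.

Import GRing.Theory Num.Theory.
Local Open Scope ring_scope.

(* Multisegments over Z/nZ.  The vertex set I = Z/nZ is 'I_n and       *)
(* i-1 is [ord_pred n i].  A segment is encoded by a pair (k, i) :     *)
(* seg n, standing for the segment (k+1; i] = [i-k, ..., i]; this way  *)
(* every encoded segment has length >= 1.  A multisegment is a finite  *)
(* multiset of segments; m_{(l;i]} = m (l-1, i).                       *)
Section Multisegments.
Variable n : nat.

Definition seg := (nat * 'I_n)%type.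
Definition mseg := multiset seg.

Definition mcount (m : mseg) (l : nat) (i : 'I_n) : nat := m (l.-1, i).

Definition mseg1 (l : nat) (i : 'I_n) : mseg := msetn 1 (l.-1, i).

(* the vertices of the basis vectors e_0, ..., e_{l-1} of k[l;i],
   e_t sitting at vertex i - t (e_0 is the head, at vertex i) *)
Definition segverts (s : seg) : seq nat :=
  [seq val (iter t (@ord_pred n) s.2) | t <- iota 0 s.1.+1].

(* k[m] = direct sum of the k[l;i] (with multiplicity); its basis is the
   concatenation of the bases of the summands *)
Definition bvert (m : mseg) : seq nat := flatten [seq segverts s | s <- enum_mset m].
(* is the basis vector the last (socle) one of its summand? *)
Definition blast (m : mseg) : seq bool :=
  flatten [seq rcons (nseq s.1 false) true | s <- enum_mset m].
Definition totdim (m : mseg) : nat := size (bvert m).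

Definition dimv (m : mseg) : {ffun 'I_n -> nat} :=
  [ffun j => count (pred1 (val j)) (bvert m)].

(* the arrows i -> i-1 of the cyclic quiver, acting on row vectors:
   e_t |-> e_{t+1} inside each summand, socle vectors |-> 0 *)
Definition Xmat (F : pzRingType) (m : mseg) : 'M[F]_(totdim m) :=
  \matrix_(r, r') (((val r' == (val r).+1) && ~~ nth true (blast m) r)%:R : F).

(* a matrix M : k[m1] -> k[m2] (row-vector convention) is graded *)
Definition graded (F : pzRingType) (m1 m2 : mseg) (M : 'M[F]_(totdim m1, totdim m2)) :=
  [forall r : 'I_(totdim m1), forall r' : 'I_(totdim m2), (nth 0%N (bvert m1) r != nth 0%N (bvert m2) r') ==> (M r r' == 0)].
Definition intertw (F : pzRingType) (m1 m2 : mseg) (M : 'M[F]_(totdim m1, totdim m2)) :=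
  Xmat F m1 *m M == M *m Xmat F m2.

(* number of subrepresentations U of F[c] with U ~= F[b] and F[c]/U ~= F[a] *)
Definition hall_count (F : finFieldType) (a b c : mseg) : nat :=
  #|[set U : {set 'rV[F]_(totdim c)} |
      [exists iota : 'M[F]_(totdim b, totdim c),
         [&& row_free iota, graded iota, intertw iota &
             U == [set w *m iota | w in [set: 'rV[F]_(totdim b)]]]] &&
      [exists pi : 'M[F]_(totdim c, totdim a),
         [&& row_full pi, graded pi, intertw pi &
             U == [set w | w *m pi == 0]]]]|.

Definition hall_poly (a b c : mseg) : {poly int} :=
  epsilon (inhabits 0) (fun P : {poly int} =>
    forall F : finFieldType, (hall_count F a b c)%:Z = P.[(#|F|)%:Z]).

(* eps(m) = dim End k[m] (computed over the field Q) *)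
Definition endo_eqs (m : mseg) (A : 'M[rat]_(totdim m)) : 'M[rat]_(totdim m + totdim m, totdim m) :=
  col_mx (Xmat rat m *m A - A *m Xmat rat m)
         (\matrix_(r, r') (if nth 0%N (bvert m) r == nth 0%N (bvert m) r' then 0 else A r r')).
Definition epsE (m : mseg) : nat := \dim (lker (linfun (endo_eqs (m := m)))).

Definition mform (a b : {ffun 'I_n -> nat}) : nat :=
  (\sum_j a j * b (ord_pred j) + \sum_j a j * b j)%N.

(* enumeration of all multisegments of graded dimension d (all lengths and
   the number of segments are bounded by D = sum_i d_i) *)
Definition ms_of_dim (d : {ffun 'I_n -> nat}) : seq mseg :=
  let D := (\sum_j d j)%N in
  [seq c <- undup (flatten [seq [seq seq_mset [seq (val p.1, p.2) | p <- tval t]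
                                 | t <- enum {: k.-tuple ('I_D * 'I_n)}]
                           | k <- iota 0 D.+1])
       | dimv c == d].

Definition Ssum (m : mseg) (k : nat) (i : 'I_n) : int :=
  \sum_(s <- enum_mset m | (k <= s.1.+1)%N)
     ((s.2 == ord_pred i)%:Z - (s.2 == i)%:Z).

Definition mplus (m : mseg) (l : nat) (i : 'I_n) : mseg :=
  if l == 1%N then msetD m (mseg1 1 i)
  else msetB (msetD m (mseg1 l i)) (mseg1 l.-1 (ord_pred i)).

End Multisegments.

(* The twisted Hall algebra over C(v).  C is modelled as R[i] for a    *)
(* real-number structure R : realType; C(v) = {fraction {poly R[i]}}.  *)
(* H is the free C(v)-module with basis u_m (m a multisegment).         *)
Section Hall.
Variable R : realType.
Variable n : nat.

Definition Cv := {fraction {poly R[i]}}.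
Definition vv : Cv := tofrac 'X.
Definition H := {malg Cv[mseg n]}.

Definition intpoly_at (p : {poly int}) (x : Cv) : Cv := (map_poly (fun z : int => z%:~R) p).[x].

Definition qint (a : nat) : Cv := (vv ^+ a - vv ^- a) / (vv - vv^-1).
Definition qfact (a : nat) : Cv := \prod_(1 <= j < a.+1) qint j.

Definition umul (a b : mseg n) : H :=
  vv ^+ (mform (dimv a) (dimv b)) *:
  \sum_(c <- ms_of_dim [ffun j => (dimv a j + dimv b j)%N])
     intpoly_at (hall_poly a b c) (vv ^- 2) *: << c >>.

Definition hmul (x y : H) : H :=
  \sum_(a <- msupp x) \sum_(b <- msupp y) (x@_a * y@_b) *: umul a b.

Definition pbw_exp (m : mseg n) : int :=
  (\sum_j (dimv m j) ^ 2)%N%:Z - (epsE m)%:Z.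
Definition pbw (m : mseg n) : H := (vv ^ pbw_exp m) *: << m >>.
Definition pbwc (x : H) (m : mseg n) : Cv := x@_m * vv ^ (- pbw_exp m).

Definition pbw_norm (m : mseg n) : Cv :=
  \prod_(s <- finsupp m)
     (vv ^- 'C(m s, 2) * (1 - vv ^+ 2) ^+ (s.1 * m s) / qfact (m s)).

Definition hform (x y : H) : Cv :=
  \sum_(m <- msupp x) pbwc x m * pbwc y m * pbw_norm m.

Definition fop (i : 'I_n) (x : H) : H := hmul (pbw (mseg1 1 i)) x.
Definition fdiv (i : 'I_n) (k : nat) (x : H) : H := (qfact k)^-1 *: iter k (fop i) x.
Definition eprime (i : 'I_n) (y : H) : H :=
  epsilon (inhabits 0) (fun z : H => forall x : H, hform (fop i x) y = hform x z).

Definition kdecomp (i : 'I_n) (x : H) (xs : seq H) : Prop :=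
  x = \sum_(k < size xs) fdiv i k (nth 0 xs k) /\
  forall k, eprime i (nth 0 xs k) = 0.
Definition ftilde (i : 'I_n) (x : H) : H :=
  let xs := epsilon (inhabits [::]) (kdecomp i x) in
  \sum_(k < size xs) fdiv i k.+1 (nth 0 xs k).

Definition in_vL (x : H) : Prop :=
  exists (s : seq (mseg n)) (c : mseg n -> {poly int}),
    x = \sum_(m <- s) (vv * intpoly_at (c m) vv) *: pbw m.

End Hall.

(* Main.v *)
(* Computing Hall numbers with a simple top gives
     f_i <b> = sum_l v^{S_{l,i}(b)} (1 + v^2 + ... + v^{2 b_{(l;i]}}) <b^+_{l,i}>,
   the sum over the l for which b^+_{l,i} exists.  Indeed, the subrepresentations of k[c] with simple
   quotient at vertex i are the kernels of the nonzero functionals on the heads of c at vertex i, and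
   the isomorphism type of such a kernel depends only on the shortest summand on which the functional
   is nonzero.  The exponent of v comes from eps(m) = sum of dim Hom over all pairs of segments.
   Taking adjoints yields e'_i, the relation e'_i f_i = v^{-2} f_i e'_i + 1, and hence orthogonality of
   the pieces f_i^{(k)} x_k of x = sum_k f_i^{(k)} x_k.  Divided powers preserve the Z[v, v^{-1}]-form
   of H, since f_i is a sum of operators that commute up to v^2.  As the form is positive at v = 0,
   the components of an element of L lie in L.  By induction on the dimension, using e'_i and the last
   l where S_{l,i} is minimal, <m> is congruent to f_i^{(d)} x_d with d = - min S_{.,i}; comparing the
   components of index d + 1 in v^d f_i <m> then leaves only the first l where S_{l,i} is minimal. *)
Require Import Defs.
From HB Require Import structures.
From mathcomp Require Import all_boot all_order all_algebra.
From mathcomp Require Import reals complex fraction.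
From mathcomp Require Import monalg.
From mathcomp Require Import finmap multiset.
From mathcomp Require Import zify ring.
From Stdlib Require Import ClassicalEpsilon Classical FunctionalExtensionality.

Set Implicit Arguments.
Unset Strict Implicit.
Unset Printing Implicit Defensive.

Import Order.TTheory GRing.Theory Num.Theory.
Local Open Scope ring_scope.

(** * Bases of nilpotent representations *)

(** The only property of v that enters is that no nonzero integer polynomial vanishes at it. So Z[v]
    and Z[v, v^-1] become predicates on field elements ([polyv], [lau]), reduction modulo v becomes
    evaluation at 0 ([ev]), and the crystal argument runs over any field and any index set with the
    combinatorics of the moves. At v = 0 the form is a sum of integer squares. Hence a vector over
    Z[v, v^-1] whose norm is regular at 0 lies in L; and if norms add up to 1 at v = 0 while one of
    them is already 1, the other vectors lie in vL. The asymmetry between last and first minimum: a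
    move at length l changes S by 2 below l, by 1 at l and not above. Undoing a move at a minimum
    other than the last keeps the minimum, making a move at a minimum other than the first lowers it
    by 2. Either way the result is concentrated in an index other than the one compared, and
    contributes 0 modulo v. Hall polynomials, e'_i and the decomposition in [ftilde] are chosen by
    epsilon. Prime fields pin down the first, nondegeneracy the second; the congruence is proved for
    every decomposition. *)

Section Positions.
Local Open Scope nat_scope.
Variable n : nat.
Implicit Types (L : seq (seg n)) (s : seg n).

(* Locked: otherwise unification unfolds it when rewriting with [nth_cat]. *)
Fact sdat_key : unit. Proof. exact: tt. Qed.
Definition sdat L : seq (seg n * nat) :=
  locked_with sdat_key flatten [seq [seq (s, t) | t <- iota 0 s.1.+1] | s <- L].
Definition dvert (x : seg n * nat) : nat := val (iter x.2 (@ord_pred n) x.1.2).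
Definition dlast (x : seg n * nat) : bool := x.2 == x.1.1.

Lemma sdat_nil : sdat [::] = [::]. Proof. by rewrite /sdat unlock. Qed.

Lemma sdat_cons s L : sdat (s :: L) = [seq (s, t) | t <- iota 0 s.1.+1] ++ sdat L.
Proof. by rewrite /sdat unlock. Qed.

Lemma sdat_cat L L' : sdat (L ++ L') = sdat L ++ sdat L'.
Proof. by rewrite /sdat unlock map_cat flatten_cat. Qed.

Lemma bvertE m : bvert m = [seq dvert x | x <- sdat (enum_mset m)].
Proof.
rewrite /bvert; elim: (enum_mset m) => [|s L IH]; first by rewrite sdat_nil.
by rewrite sdat_cons map_cat -IH -map_comp.
Qed.

Lemma blastE (m : mseg n) : blast m = [seq dlast x | x <- sdat (enum_mset m)].
Proof.
rewrite /blast; elim: (enum_mset m) => [|s L IH]; first by rewrite sdat_nil.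
rewrite sdat_cons map_cat -IH [LHS]/=; congr cat.
rewrite -map_comp -addn1 iotaD map_cat /= add0n /dlast /= eqxx cats1; congr rcons.
apply: (@eq_from_nth _ false); rewrite ?size_nseq ?size_map ?size_iota //.
move=> k lt_ks; rewrite nth_nseq lt_ks (nth_map 0) ?size_iota // nth_iota //=.
by rewrite add0n ltn_eqF.
Qed.

Lemma totdimE (m : mseg n) : totdim m = size (sdat (enum_mset m)).
Proof. by rewrite /totdim bvertE size_map. Qed.

Lemma size_sdat L : size (sdat L) = \sum_(s <- L) s.1.+1.
Proof.
elim: L => [|s L IH]; first by rewrite sdat_nil big_nil.
by rewrite sdat_cons size_cat size_map size_iota big_cons IH.
Qed.

Lemma nth_sdat_block x0 L1 s L2 t : t <= s.1 ->
  nth x0 (sdat (L1 ++ s :: L2)) (size (sdat L1) + t) = (s, t).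
Proof.
move=> le_ts; rewrite sdat_cat nth_cat ltnNge leq_addr /= addKn.
rewrite sdat_cons nth_cat size_map size_iota ltnS le_ts.
by rewrite (nth_map 0) ?size_iota // nth_iota.
Qed.

Lemma nth_sdat_block0 x0 s L t : t <= s.1 -> nth x0 (sdat (s :: L)) t = (s, t).
Proof. by move=> /(@nth_sdat_block x0 [::] s L); rewrite sdat_nil. Qed.

Lemma sdat_split x0 L p : p < size (sdat L) ->
  exists L1 s L2 t, [/\ L = L1 ++ s :: L2, t <= s.1,
    p = size (sdat L1) + t & nth x0 (sdat L) p = (s, t)].
Proof.
elim: L p => [|s L IH] p; first by rewrite sdat_nil.
rewrite sdat_cons size_cat size_map size_iota => lt_p.
have [lt_ps|le_sp] := ltnP p s.1.+1.
  by exists [::], s, L, p; rewrite sdat_nil -sdat_cons nth_sdat_block0.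
have [|L1 [s' [L2 [t [-> le_t Dp _]]]]] := IH (p - s.1.+1); first lia.
exists (s :: L1), s', L2, t; have Dp' : p = size (sdat (s :: L1)) + t.
  by rewrite sdat_cons size_cat size_map size_iota; lia.
by split=> //; rewrite -sdat_cons Dp'; apply: (@nth_sdat_block x0 (s :: L1)).
Qed.

Lemma size_sdat_block L1 s L2 t : t <= s.1 ->
  size (sdat L1) + t < size (sdat (L1 ++ s :: L2)).
Proof.
move=> le_ts; rewrite sdat_cat size_cat ltn_add2l sdat_cons size_cat.
by rewrite size_map size_iota; lia.
Qed.

Section Nth.
Variables (x0 : seg n * nat) (L : seq (seg n)) (p : nat).
Hypothesis ltp : p < size (sdat L).
Local Notation dat := (nth x0 (sdat L)).

Lemma sdat_le : (dat p).2 <= (dat p).1.1.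
Proof. by have [L1 [s [L2 [t [_ ? _ ->]]]]] := sdat_split x0 ltp. Qed.

Lemma sdat_offs k : (dat p).2 + k <= (dat p).1.1 ->
  p + k < size (sdat L) /\ dat (p + k) = ((dat p).1, (dat p).2 + k).
Proof.
have [L1 [s [L2 [t [EL le_t -> ->]]]]] := sdat_split x0 ltp => /= le_tk.
by rewrite -addnA EL size_sdat_block ?nth_sdat_block.
Qed.

Lemma sdat_head : (dat p).2 <= p /\ dat (p - (dat p).2) = ((dat p).1, 0).
Proof.
have [L1 [s [L2 [t [EL le_t -> ->]]]]] := sdat_split x0 ltp => /=.
by rewrite addnK EL -[size _]addn0 nth_sdat_block // addn0 leq_addl.
Qed.

End Nth.

(* [f] moves each block [segverts s] of the basis rigidly. *)
Lemma perm_sdat x0 L L' : perm_eq L L' ->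
  exists f : nat -> nat,
    [/\ forall p, p < size (sdat L) -> f p < size (sdat L'),
        forall p q, p < size (sdat L) -> q < size (sdat L) -> f p = f q -> p = q,
        forall p, p < size (sdat L) -> nth x0 (sdat L') (f p) = nth x0 (sdat L) p
      & forall p, p < size (sdat L) -> ~~ dlast (nth x0 (sdat L) p) ->
          f p.+1 = (f p).+1].
Proof.
elim: L L' => [|s L IH] L' pLL'; first by exists id; split; rewrite sdat_nil.
have /path.splitPr EL' : s \in L' by rewrite -(perm_mem pLL') mem_head.
case: L' / EL' pLL' => A B; rewrite perm_sym perm_catC /= perm_cons perm_catC perm_sym.
case/IH=> f [f_lt f_inj f_nth f_S].
set a := size (sdat A); set k := s.1.+1.
have szL' : size (sdat (A ++ s :: B)) = a + k + size (sdat B).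
  by rewrite sdat_cat sdat_cons !size_cat size_map size_iota addnA.
have szAB : size (sdat (A ++ B)) = a + size (sdat B) by rewrite sdat_cat size_cat.
have szL : size (sdat (s :: L)) = k + size (sdat L).
  by rewrite sdat_cons size_cat size_map size_iota.
have nthA q : q < a -> nth x0 (sdat (A ++ s :: B)) q = nth x0 (sdat (A ++ B)) q.
  by move=> ltqa; rewrite !sdat_cat !nth_cat -/a ltqa.
have nthB q : a <= q -> nth x0 (sdat (A ++ s :: B)) (q + k) = nth x0 (sdat (A ++ B)) q.
  move=> leaq; have leaqk : a <= q + k by lia.
  rewrite !sdat_cat !nth_cat -/a !ltnNge leaq leaqk.
  rewrite sdat_cons nth_cat size_map size_iota -/k ltnNge.
  have -> : k <= q + k - a by lia.
  by rewrite /=; congr nth; lia.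
have nthL q : k <= q -> nth x0 (sdat (s :: L)) q = nth x0 (sdat L) (q - k).
  by move=> lekq; rewrite sdat_cons nth_cat size_map size_iota -/k ltnNge lekq.
have nths q : q < k -> nth x0 (sdat (s :: L)) q = (s, q).
  by move=> ltqk; rewrite nth_sdat_block0.
(* The block of [s] goes behind the [a] positions of [A]; positions that [f] sends into [B] are
   pushed back by its length [k]. *)
pose g p := if p < k then a + p
            else if f (p - k) < a then f (p - k) else f (p - k) + k.
exists g; rewrite szL szL'; split.
- move=> p ltp; rewrite /g; case: (ltnP p k) => [|lekp]; first lia.
  have := f_lt (p - k); rewrite szAB; case: ifP; lia.
- move=> p q ltp ltq; rewrite /g.
  case: (ltnP p k) => lekp; case: (ltnP q k) => lekq; try (case: ifP => *; lia); try lia.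
  have [ltp' ltq'] : p - k < size (sdat L) /\ q - k < size (sdat L) by lia.
  have := f_inj _ _ ltp' ltq'.
  do 2!case: ifP => ?; lia.
- move=> p ltp; rewrite /g; case: (ltnP p k) => [ltpk|lekp].
    by rewrite nth_sdat_block ?nths.
  rewrite nthL // -f_nth; last lia.
  by case: ifP => [/nthA|/negbT]; rewrite // -leqNgt => /nthB.
move=> p ltp; rewrite /g; case: (ltnP p k) => [ltpk|lekp].
  by rewrite nths // /dlast /= => ?; case: ltnP; lia.
rewrite nthL // (ltnNge p.+1) leqW //= => nl.
have ltp' : p - k < size (sdat L) by lia.
have Sf : f (p.+1 - k) = (f (p - k)).+1 by rewrite subSn // f_S.
rewrite Sf; case: (ltnP (f (p - k)) a) => [lta|lea]; last by rewrite ltnNge leqW.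
(* The remaining case would put [f (p - k)] at the end of [A], hence at the end of a block, against
   [nl]. *)
case: (ltnP (f (p - k)).+1 a) => // Sa; have Ea : (f (p - k)).+1 = a by lia.
have ltAB := f_lt _ ltp'.
have := @sdat_offs x0 A (f (p - k)) lta 1.
have -> : nth x0 (sdat A) (f (p - k)) = nth x0 (sdat L) (p - k).
  by rewrite -f_nth // sdat_cat nth_cat lta.
rewrite addn1; have := @sdat_le x0 _ _ ltp'; move: nl; rewrite /dlast; lia.
Qed.

End Positions.

Lemma perm_mset_count (K : choiceType) (A : multiset K) (s : seq K) :
  (forall x, A x = count_mem x s) -> perm_eq (enum_mset A) s.
Proof. by move=> AE; apply/allP=> x _ /=; rewrite -AE count_mem_mset. Qed.

(** * Removing the head of one summand *)

Section Dat.
Variables (n : nat) (i : 'I_n).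
Local Open Scope nat_scope.

Definition bdat (m : mseg n) (p : nat) : seg n * nat :=
  nth ((0, i), 0) (sdat (enum_mset m)) p.

(** Replaces a segment (k+1; i] by (k; i-1], or deletes it if [k = 0]: this is the type of the
    kernel of a functional on the heads at [i] whose shortest summand has length k+1. *)
Definition mminus (c : mseg n) (k : nat) : mseg n :=
  msetB (msetD c (if k is k'.+1 then [mset (k', ord_pred i)]%mset else mset0))
        [mset (k, i)]%mset.

Lemma mminusE c k x : mminus c k x =
  c x + (if k is k'.+1 then x == (k', ord_pred i) else false) - (x == (k, i)).
Proof. by rewrite /mminus !msetE2 msetnE; case: k => [|k]; rewrite ?mset0E ?msetnE; do 2?case: eqP. Qed.

Lemma nth_bvert m p : p < totdim m -> nth 0 (bvert m) p = dvert (bdat m p).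
Proof. by rewrite totdimE bvertE => ltp; rewrite (nth_map ((0, i), 0)). Qed.

Lemma nth_blast m p : p < totdim m -> nth true (blast m) p = dlast (bdat m p).
Proof. by rewrite totdimE blastE => ltp; rewrite (nth_map ((0, i), 0)). Qed.

Lemma dat_le m p : p < totdim m -> (bdat m p).2 <= (bdat m p).1.1.
Proof. by rewrite totdimE; exact: (@sdat_le _ ((0, i), 0)). Qed.

Lemma dat_offs m p k : p < totdim m -> (bdat m p).2 + k <= (bdat m p).1.1 ->
  p + k < totdim m /\ bdat m (p + k) = ((bdat m p).1, (bdat m p).2 + k).
Proof. by rewrite totdimE => ltp; apply: (@sdat_offs _ ((0, i), 0)). Qed.

Lemma dat_head m p : p < totdim m ->
  (bdat m p).2 <= p /\ bdat m (p - (bdat m p).2) = ((bdat m p).1, 0).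
Proof. by rewrite totdimE; exact: (@sdat_head _ ((0, i), 0)). Qed.

Lemma dat_succ m p : p < totdim m -> ~~ dlast (bdat m p) ->
  p.+1 < totdim m /\ bdat m p.+1 = ((bdat m p).1, (bdat m p).2.+1).
Proof.
move=> ltp; have := dat_le ltp; rewrite /dlast -(addn1 p) -(addn1 (bdat m p).2).
by move=> le ne; apply: dat_offs => //; lia.
Qed.

Lemma dat_pred m p : p < totdim m -> 0 < (bdat m p).2 ->
  [/\ 0 < p, ~~ dlast (bdat m p.-1) & bdat m p.-1 = ((bdat m p).1, (bdat m p).2.-1)].
Proof.
move=> ltp t0; have [le Dh] := dat_head ltp.
have lth : p - (bdat m p).2 < totdim m by apply: leq_ltn_trans ltp; apply: leq_subr.
have := dat_offs (k := (bdat m p).2.-1) lth; rewrite Dh /= add0n.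
have -> : p - (bdat m p).2 + (bdat m p).2.-1 = p.-1 by lia.
have := dat_le ltp => le2 []; first lia.
by move=> _ E; split; rewrite ?E /dlast //=; lia.
Qed.

(** Deleting the head of the block of [(k, i)] shifts the later positions by one, so [bump h] is the
    inclusion. Vector [t] of the shortened block is vector [t.+1] of the old one, at the same
    vertex. *)
Lemma bump_dat L1 k L2 p x0 :
  let D := sdat (L1 ++ (k, i) :: L2) in
  let D' := sdat (L1 ++ (if k is k'.+1 then [:: (k', ord_pred i)] else [::]) ++ L2) in
  let h := size (sdat L1) in
  p < size D' ->
  [/\ bump h p < size D, dvert (nth x0 D (bump h p)) = dvert (nth x0 D' p),
      dlast (nth x0 D (bump h p)) = dlast (nth x0 D' p)
    & ~~ dlast (nth x0 D' p) -> bump h p.+1 = (bump h p).+1].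
Proof.
move=> D D' h.
have ED : D = sdat L1 ++ [seq ((k, i), t) | t <- iota 0 k.+1] ++ sdat L2.
  by rewrite /D sdat_cat sdat_cons.
pose Q := if k is k'.+1 then [seq (k', ord_pred i, t) | t <- iota 0 k'.+1] else [::].
have ED' : D' = sdat L1 ++ Q ++ sdat L2.
  by rewrite /D' /Q !sdat_cat; case: (k) => [|k']; rewrite /= ?sdat_cons ?sdat_nil ?cats0.
have sQ : size Q = k by rewrite /Q; case: (k) => // k'; rewrite size_map size_iota.
have nQ t : t < k -> nth x0 Q t = (k.-1, ord_pred i, t).
  by rewrite /Q; case: (k) => // k' ltt; rewrite (nth_map 0) ?size_iota // nth_iota.
rewrite ED' size_cat size_cat sQ -/h => ltp.
(* [bump h] breaks adjacency only at position h - 1, which is the last of a block. *)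
have lastL1 q : q < h -> q.+1 = h -> dlast (nth x0 (sdat L1) q).
  move=> ltq Eq; have := @sdat_offs _ x0 L1 q ltq 1; have := @sdat_le _ x0 L1 q ltq.
  rewrite /dlast addn1 -/h; lia.
rewrite ED !nth_cat size_cat size_cat sQ -/h size_map size_iota /bump.
have [ltph|leph] := ltnP p h.
  rewrite add0n ltph; split=> //; first lia.
  move=> nl; case: (ltnP p.+1 h) => [//|leh].
  have Eh : p.+1 = h by lia.
  by case/negP: nl; apply: lastL1.
have leph' : h <= p.+1 by exact: leqW.
rewrite leph' !(_ : forall q, nat_of_bool true + q = q.+1) //; have -> : (p.+1 < h) = false by lia.
have [ltk|lek] := ltnP (p - h) k.
  have -> : (p.+1 - h < k.+1) by lia.
  rewrite nQ // (nth_map 0) ?size_iota; last lia.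
  rewrite nth_iota; last lia.
  rewrite /dvert /dlast /= -iterSr add0n subSn //.
  by split=> //; lia.
have -> : (p.+1 - h < k.+1) = false by lia.
have -> : p.+1 - h - k.+1 = p - h - k by lia.
by split=> //; lia.
Qed.

(** The map [f] enumerates the basis vectors other than the head at [h]; they span a
    subrepresentation because no arrow ends at a head. *)
Lemma mminus_embed c k h : h < totdim c -> bdat c h = ((k, i), 0) ->
  exists f : nat -> nat,
  [/\ totdim c = (totdim (mminus c k)).+1,
      forall p, p < totdim (mminus c k) -> f p < totdim c /\ f p <> h,
      forall p q, p < totdim (mminus c k) -> q < totdim (mminus c k) -> f p = f q -> p = q,
      forall p, p < totdim (mminus c k) ->
        dvert (bdat c (f p)) = dvert (bdat (mminus c k) p) /\
        dlast (bdat c (f p)) = dlast (bdat (mminus c k) p)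
    & forall p, p < totdim (mminus c k) -> ~~ dlast (bdat (mminus c k) p) ->
        f p.+1 = (f p).+1].
Proof.
rewrite [totdim c]totdimE {1 2}/bdat => lth.
have [L1 [s [L2 [t [EL le_t Eh ->]]]]] := sdat_split ((0, i), 0) lth.
case=> Es Et; subst s t; rewrite addn0 in Eh.
pose L' := L1 ++ (if k is k'.+1 then [:: (k', ord_pred i)] else [::]) ++ L2.
have pL' : perm_eq (enum_mset (mminus c k)) L'.
  apply: perm_mset_count => x; rewrite mminusE -count_mem_mset EL /L' !count_cat /=.
  rewrite [(k, i) == x]eq_sym; case: (k) => [|k'] /=; first by rewrite addn0 addnCA addKn.
  by rewrite [(k', _) == x]eq_sym addn0 -!addnA addnCA addKn; congr addn; apply: addnC.
have [f [f_lt f_inj f_nth f_S]] := perm_sdat ((0, i), 0) pL'.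
have szL' : size (sdat (enum_mset c)) = (size (sdat L')).+1.
  rewrite EL /L' !size_sdat !big_cat big_cons /=.
  by case: (k) => [|k']; rewrite ?big_cons big_nil /=; lia.
have szE : size (sdat (enum_mset (mminus c k))) = size (sdat L').
  by rewrite !size_sdat; apply: perm_big.
have B p := @bump_dat L1 k L2 p ((0, i), 0).
exists (fun p => bump h (f p)); rewrite totdimE szE; split=> // [p ltp|p q ltp ltq|p ltp|p ltp nl].
- rewrite {1}EL Eh; have [] := B (f p); first by rewrite -/L' f_lt ?szE.
  by split=> //; rewrite /bump; case: leqP; lia.
- by move/(can_inj (@bumpK h)); apply: f_inj; rewrite szE.
- rewrite /bdat {1 2}EL Eh -!f_nth ?szE //.
  by have [] := B (f p); rewrite -/L' ?f_lt ?szE.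
- rewrite f_S ?szE // Eh; have [] := B (f p); rewrite -/L' ?f_lt ?szE // => _ _ _; apply.
  by rewrite f_nth ?szE.
Qed.

End Dat.

(** * Ranks of the powers of the arrows *)

Lemma sum_pick (V : pzRingType) (I : finType) (a : I) (g : I -> V) (P : pred I) :
  (forall j, P j = (j == a)) -> \sum_j (P j)%:R * g j = g a.
Proof.
move=> PE; rewrite (bigD1 a) //= PE eqxx mul1r big1 ?addr0 // => j /negbTE ja.
by rewrite PE ja mul0r.
Qed.

Lemma sum_pickr (V : pzRingType) (I : finType) (a : I) (g : I -> V) (P : pred I) :
  (forall j, P j = (j == a)) -> \sum_j g j * (P j)%:R = g a.
Proof.
move=> PE; rewrite (bigD1 a) //= PE eqxx mulr1 big1 ?addr0 // => j /negbTE ja.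
by rewrite PE ja mulr0.
Qed.

Lemma card_ord_nth (T : Type) (x0 : T) (s : seq T) N (P : pred T) : N = size s ->
  #|[pred r : 'I_N | P (nth x0 s r)]| = count P s.
Proof. by move=> ->; rewrite -sum1_card -sum1_count (big_nth x0) big_mkord. Qed.

(** [A] is the matrix of a partial injection with domain [D]: it factors through the coordinate
    space on [D], by a surjection followed by an injection. *)
Lemma rank_partial_perm (F : fieldType) (p q : nat) (A : 'M[F]_(p, q)) (D : pred 'I_p)
    (f : 'I_p -> 'I_q) :
  {in D &, injective f} -> (forall x y, A x y = (D x && (y == f x))%:R) ->
  \rank A = #|D|.
Proof.
move=> f_inj AE.
pose E := \matrix_(a < #|D|, x < p) (x == enum_val a)%:R : 'M[F]_(#|D|, p).
pose B := \matrix_(a < #|D|, y < q) (y == f (enum_val a))%:R : 'M[F]_(#|D|, q).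
have freeE : row_free E.
  apply/row_freeP; exists E^T; apply/matrixP=> a b; rewrite !mxE.
  under eq_bigr => j _ do rewrite !mxE.
  by rewrite (sum_pick (a := enum_val a)) // (inj_eq enum_val_inj).
have freeB : row_free B.
  apply/row_freeP; exists B^T; apply/matrixP=> a b; rewrite !mxE.
  under eq_bigr => j _ do rewrite !mxE.
  rewrite (sum_pick (a := f (enum_val a))) //; congr (_%:R); congr nat_of_bool.
  by apply/eqP/eqP => [e|-> //]; apply: enum_val_inj; apply: f_inj e; apply: enum_valP.
have -> : A = E^T *m B.
  apply/matrixP=> x y; rewrite AE !mxE.
  under eq_bigr => j _ do rewrite !mxE.
  case Dx: (D x); last first.
    rewrite big1 // => a _; case: eqP => [xa|]; last by rewrite mul0r.
    by have := enum_valP a; rewrite -xa unfold_in Dx.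
  rewrite (sum_pick (a := enum_rank_in Dx x)) ?enum_rankK_in //.
  move=> a; apply/eqP/eqP => [xa|->]; last by rewrite enum_rankK_in.
  by apply: enum_val_inj; rewrite enum_rankK_in.
by rewrite mxrankMfree // mxrank_tr (eqP freeE).
Qed.

Section Rep.
Variables (n : nat) (i : 'I_n) (F : fieldType).
Implicit Types (m : mseg n).
Local Notation dat := (bdat i).

(** Beyond the last index the default is [r] itself; the value matters only where [r] is not the end
    of its block. *)
Definition osucc N (r : 'I_N) : 'I_N := insubd r r.+1.
Definition opred N (r : 'I_N) : 'I_N := insubd r r.-1.

Lemma val_osucc m (r : 'I_(totdim m)) : ~~ dlast (dat m r) -> osucc r = r.+1 :> nat.
Proof. by case/(dat_succ (ltn_ord r)) => lt _; rewrite val_insubd lt. Qed.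

Lemma val_opred N (r : 'I_N) : opred r = r.-1 :> nat.
Proof. by rewrite val_insubd (leq_ltn_trans (leq_pred _) (ltn_ord r)). Qed.

Lemma XmatE m r r' : Xmat F m r r' = ((val r' == r.+1) && ~~ dlast (dat m r))%:R.
Proof. by rewrite mxE (nth_blast i) // ltn_ord. Qed.

Lemma XmatL m p (M : 'M[F]_(totdim m, p)) r q :
  (Xmat F m *m M) r q = if dlast (dat m r) then 0 else M (osucc r) q.
Proof.
rewrite mxE; under eq_bigr => j _ do rewrite XmatE.
case: ifPn => [Lr|nLr]; first by rewrite big1 // => j _; rewrite andbF mul0r.
by rewrite (sum_pick (a := osucc r)) // => j; rewrite andbT -val_eqE /= val_osucc.
Qed.

Lemma XmatR m p (M : 'M[F]_(p, totdim m)) r q :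
  (M *m Xmat F m) r q = if (dat m q).2 == 0%N then 0 else M r (opred q).
Proof.
rewrite mxE; under eq_bigr => j _ do rewrite XmatE.
case: ifPn => [q0|q0].
  rewrite big1 // => j _; case: eqP => [Eq|]; last by rewrite mulr0.
  have [_|nl] := boolP (dlast (dat m j)); first by rewrite mulr0.
  have [_ E] := dat_succ (ltn_ord j) nl.
  by move: q0; rewrite Eq E.
have [|q1 nl E] := dat_pred (ltn_ord q) (m := m) (i := i); first by rewrite lt0n.
rewrite (sum_pickr (a := opred q)) // => j; rewrite -val_eqE /= val_opred.
apply/andP/eqP => [[/eqP->] //|->]; first by rewrite nl prednK.
Qed.

Lemma gradedP m1 m2 (M : 'M[F]_(totdim m1, totdim m2)) :
  reflect (forall (r : 'I_(totdim m1)) (r' : 'I_(totdim m2)),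
    dvert (dat m1 r) <> dvert (dat m2 r') -> M r r' = 0) (graded M).
Proof.
apply: (iffP forallP) => [H r r' /eqP ne|H r].
  by have /forallP/(_ r')/implyP := H r; rewrite !(nth_bvert i) ?ltn_ord // => /(_ ne)/eqP.
by apply/forallP=> r'; apply/implyP; rewrite !(nth_bvert i) ?ltn_ord // => /eqP/H->.
Qed.

Lemma graded_mul m1 m2 m3 (M : 'M[F]_(totdim m1, totdim m2)) (M' : 'M[F]_(totdim m2, totdim m3)) :
  graded M -> graded M' -> graded (M *m M').
Proof.
move=> /gradedP gM /gradedP gM'; apply/gradedP=> r r' ne; rewrite mxE big1 // => j _.
have [e|/eqP ne'] := eqVneq (dvert (dat m1 r)) (dvert (dat m2 j)).
  by rewrite gM' ?mulr0 // -e.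
by rewrite gM ?mul0r.
Qed.

Lemma intertw_mul m1 m2 m3 (M : 'M[F]_(totdim m1, totdim m2)) (M' : 'M[F]_(totdim m2, totdim m3)) :
  intertw M -> intertw M' -> intertw (M *m M').
Proof. by move=> /eqP iM /eqP iM'; rewrite /intertw mulmxA iM -mulmxA iM' mulmxA. Qed.

Fixpoint Xpow m k : 'M[F]_(totdim m) := if k is k'.+1 then Xmat F m *m Xpow m k' else 1%:M.

Definition vproj m (j : nat) : 'M[F]_(totdim m) := \matrix_(r, r') ((r == r') && (dvert (dat m r) == j))%:R.

Lemma XpowE m k r r' : Xpow m k r r' =
  (((dat m r).2 + k <= (dat m r).1.1)%N && (val r' == r + k)%N)%:R.
Proof.
elim: k r => [|k IH] r /=.
  by rewrite mxE !addn0 dat_le //= eq_sym -val_eqE.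
rewrite XmatL; case: ifPn => [|nl].
  rewrite /dlast => /eqP->; rewrite (_ : (_ + k.+1 <= _)%N = false) //; lia.
rewrite IH val_osucc //; have [_ ->] := dat_succ (ltn_ord r) nl.
by rewrite /= !addSnnS.
Qed.

(** In the standard basis this is a partial injection, moving each vector at [j] forward by [k] as
    long as it stays in its block. *)
Lemma rank_vXpow m k j :
  \rank (vproj m j *m Xpow m k) =
  count (fun x => (dvert x == j) && (x.2 + k <= x.1.1)%N) (sdat (enum_mset m)).
Proof.
pose D := [pred r : 'I_(totdim m) | (dvert (dat m r) == j) &&
             ((dat m r).2 + k <= (dat m r).1.1)%N].
pose f (r : 'I_(totdim m)) : 'I_(totdim m) := insubd r (r + k)%N.
have fE r : D r -> val (f r) = (r + k)%N.
  by case/andP=> _ le; rewrite val_insubd; have [-> _] := dat_offs (ltn_ord r) le.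
rewrite (@rank_partial_perm _ _ _ _ D f).
- exact: (card_ord_nth _ (fun x => (dvert x == j) && (x.2 + k <= x.1.1)%N)) (totdimE m).
- by move=> x y Dx Dy /(congr1 val); rewrite !fE // => /addIn/val_inj.
move=> x y; rewrite mxE; under eq_bigr => a _ do rewrite mxE XpowE.
case vx: (dvert (dat m x) == j); last first.
  by rewrite big1 => [|a _]; rewrite /= ?vx ?andbF ?mul0r.
rewrite (sum_pick (a := x)) => [|a]; last by rewrite andbT eq_sym.
rewrite /= vx; case le: (_ <= _)%N => //=; rewrite -val_eqE fE //.
by rewrite /= vx le.
Qed.
End Rep.

(** * The isomorphism type is determined by ranks *)

Section Iso.
Variables (n : nat) (i : 'I_n).
Implicit Types (m : mseg n).

(** The rank of the k-fold arrow on the vectors at vertex [j], by [rank_vXpow]. *)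
Definition vcount L j k := count (fun x => (dvert x == j) && (x.2 + k <= x.1.1)%N) (@sdat n L).

(** A vector [t.+1] of a block at [ord_pred j] follows the vector [t] at [j]; only the heads at
    [ord_pred j] follow nothing. *)
Lemma vcount_ord_pred L (j : 'I_n) k : vcount L (ord_pred j) k =
  (vcount L j k.+1 + count (fun s : seg n => (s.2 == ord_pred j) && (k <= s.1)%N) L)%N.
Proof.
rewrite /vcount; elim: L => [|s L IH]; first by rewrite sdat_nil.
rewrite sdat_cons !count_cat IH [count _ (s :: L)]/= [RHS]addnACA; congr addn.
have E0 : iota 0 s.1.+1 = 0%N :: [seq t.+1 | t <- iota 0 s.1].
  by rewrite /= -[1%N]addn0 iotaDl.
have E1 : iota 0 s.1.+1 = iota 0 s.1 ++ [:: s.1] by rewrite -addn1 iotaD.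
rewrite !count_map [in LHS]E0 [in RHS]E1 count_cat /= count_map /=.
rewrite add0n addnS ltnNge leq_addr andbF !addn0 addnC; congr addn.
apply: eq_count => t.
rewrite -[LHS]/((val (ord_pred (iter t (@ord_pred n) s.2)) == val (ord_pred j)) &&
  (t.+1 + k <= s.1)%N) addSnnS; congr (_ && _).
by rewrite val_eqE (inj_eq (@ord_pred_inj n)).
Qed.

(** By [vcount_ord_pred] the ranks give the number of segments with a given head and length above a
    given bound; consecutive differences of these numbers are the multiplicities. *)
Lemma mseg_rank_inj m m' :
  (forall j k, vcount (enum_mset m) j k = vcount (enum_mset m') j k) ->
  m = m'.
Proof.
pose hd L (j : 'I_n) k := count (fun s : seg n => (s.2 == j) && (k <= s.1)%N) L.
have hdE L (j : 'I_n) k : hd L j k = (hd L j k.+1 + count_mem (k, j) L)%N.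
  rewrite /hd; elim: L => //= s L ->; rewrite addnACA; congr addn.
  case: s => l s2 /=; rewrite xpair_eqE; case: (s2 == j) => /=; rewrite ?andbF //.
  by rewrite andbT; case: ltngtP.
move=> E; apply/msetP=> -[k j]; rewrite -!count_mem_mset.
have Ehd k' : hd (enum_mset m) j k' = hd (enum_mset m') j k'.
  have := vcount_ord_pred (enum_mset m) (ordS j) k'; have := vcount_ord_pred (enum_mset m') (ordS j) k'.
  rewrite !ordSK !E => -> /addnI; exact: esym.
have := hdE (enum_mset m) j k; rewrite Ehd hdE Ehd => /addnI; exact: esym.
Qed.

(** The ranks of [b] can be computed inside [c] after multiplication by the embedding, and there
    they depend only on the image, which is the same for [b']. *)
Lemma rep_embed_inj (F : finFieldType) (b b' c : mseg n) (M : 'M[F]_(totdim b, totdim c))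
    (M' : 'M[F]_(totdim b', totdim c)) :
  row_free M -> graded M -> intertw M ->
  row_free M' -> graded M' -> intertw M' ->
  [set w *m M | w in [set: 'rV[F]_(totdim b)]] =
  [set w *m M' | w in [set: 'rV[F]_(totdim b')]] -> b = b'.
Proof.
move=> fM gM tM fM' gM' tM' EU; apply: mseg_rank_inj => j k.
rewrite /vcount -!(rank_vXpow i F).
have sub p p' q (A : 'M[F]_(p, q)) (A' : 'M[F]_(p', q)) :
    [set w *m A | w in [set: 'rV[F]_p]] = [set w *m A' | w in [set: 'rV[F]_p']] ->
    (A <= A')%MS.
  move=> E; apply/row_subP=> r.
  have: row r A \in [set w *m A | w in [set: 'rV[F]_p]].
    by apply/imsetP; exists (delta_mx 0 r); rewrite ?inE // rowE.
  by rewrite E => /imsetP[w _ ->]; apply: submxMl.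
have rk (d : mseg n) (N : 'M[F]_(totdim d, totdim c)) : row_free N -> graded N -> intertw N ->
    \rank (vproj i F d j *m Xpow F d k) = \rank (N *m (vproj i F c j *m Xpow F c k)).
  move=> fN gN /eqP tN; rewrite -(mxrankMfree _ fN) -mulmxA.
  have -> : Xpow F d k *m N = N *m Xpow F c k.
    elim: k => [|k' IH] /=; first by rewrite mulmx1 mul1mx.
    by rewrite -mulmxA IH !mulmxA tN.
  rewrite !mulmxA; congr (\rank (_ *m _)); apply/matrixP=> x y; rewrite !mxE.
  under eq_bigr => a _ do rewrite mxE; under [RHS]eq_bigr => a _ do rewrite mxE.
  case vx: (dvert (bdat i d x) == j).
    rewrite (sum_pick (a := x)) => [|a]; last first.
      by rewrite eq_sym; case: eqP => // ->; rewrite vx.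
    case vy: (dvert (bdat i c y) == j).
      rewrite (sum_pickr (a := y)) // => a.
      by case: eqP => // ->; rewrite vy.
    rewrite big1; last by move=> a _; case: eqP => [->|]; rewrite ?vy /= mulr0.
    by move/(@gradedP _ i): gN; apply; rewrite (eqP vx) => /esym/eqP; rewrite vy.
  rewrite big1; last by move=> a _; case: eqP => [<-|]; rewrite ?vx /= mul0r.
  case vy: (dvert (bdat i c y) == j).
    rewrite (sum_pickr (a := y)).
      by symmetry; move/(@gradedP _ i): gN; apply; rewrite (eqP vy) => /eqP; rewrite vx.
    by move=> a; case: eqP => // ->; rewrite vy.
  by rewrite big1 // => a _; case: eqP => [->|]; rewrite ?vy /= mulr0.
rewrite (rk _ _ fM gM tM) (rk _ _ fM' gM' tM').
by apply: eqmx_rank; rewrite !submxMr ?sub.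
Qed.

End Iso.

(** * Kernels of functionals on the heads *)

Section Hyperplane.
Variables (n : nat) (i : 'I_n) (F : fieldType) (c : mseg n) (k : nat).
Variables (h : 'I_(totdim c)) (pi : 'cV[F]_(totdim c)).
Local Notation dat := (bdat i).
Local Notation N := (totdim c).
Hypothesis dat_h : dat c h = ((k, i), 0%N).
Hypothesis pi_h : pi h 0 != 0.
Hypothesis pi_supp : forall p : 'I_N, pi p 0 != 0 ->
  [/\ (dat c p).2 = 0%N, (dat c p).1.2 = i & (k <= (dat c p).1.1)%N].

Definition hdpos (p : 'I_N) : 'I_N := insubd p (p - (dat c p).2)%N.

Lemma hdpos_val p : val (hdpos p) = (p - (dat c p).2)%N.
Proof. by rewrite val_insubd (leq_ltn_trans (leq_subr _ _) (ltn_ord p)). Qed.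

Lemma dat_hdpos p : dat c (hdpos p) = ((dat c p).1, 0%N).
Proof. by rewrite /= hdpos_val; case: (dat_head i (ltn_ord p)). Qed.

(** [Nmx] is the endomorphism that sends each head [p] other than [h] to pi(p) / pi(h) times the
    head [h], extended along the arrows. It exists because [h] heads a shortest summand on which
    [pi] is nonzero; offsets beyond [k] are cut off. *)
Definition nu (p : 'I_N) : F :=
  if (hdpos p != h) && ((dat c p).2 <= k)%N then pi (hdpos p) 0 / pi h 0 else 0.
Definition Nmx : 'M[F]_N := \matrix_(p, q) (nu p *+ (val q == h + (dat c p).2)%N).

Lemma dat_ht t : (t <= k)%N -> (h + t < N)%N /\ dat c (h + t)%N = ((k, i), t).
Proof.
by move=> le; have := @dat_offs n i c h t (ltn_ord h); rewrite dat_h /=; apply.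
Qed.

Lemma nu_neq0 p : nu p != 0 ->
  [/\ hdpos p != h, ((dat c p).2 <= k)%N, (dat c p).1.2 = i & (k <= (dat c p).1.1)%N].
Proof.
rewrite /nu; case: ifP => [/andP[ne le]|]; last by rewrite eqxx.
rewrite mulf_eq0 negb_or => /andP[/pi_supp]; rewrite dat_hdpos /=.
by case.
Qed.

Lemma Nmx_neq0 p q : Nmx p q != 0 -> nu p != 0 /\ val q = (h + (dat c p).2)%N.
Proof. by rewrite mxE; case: (val q =P _) => [->|]; rewrite ?eqxx // mulr1n. Qed.

Lemma Nmx_dat p q : Nmx p q != 0 -> dat c q = ((k, i), (dat c p).2).
Proof.
case/Nmx_neq0 => /nu_neq0[_ le _ _] Eq.
by rewrite Eq; case: (dat_ht le).
Qed.

(** The image of [Nmx] lies in the block of [h], on which [nu] vanishes. *)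
Lemma Nmx_sq : Nmx *m Nmx = 0.
Proof.
apply/matrixP=> p q; rewrite !mxE big1 // => a _.
have [->|nz] := eqVneq (Nmx p a) 0; first by rewrite mul0r.
suff -> : Nmx a q = 0 by rewrite mulr0.
apply/eqP; apply: contraT => /Nmx_neq0[/nu_neq0[/eqP ne _ _ _] _].
case: ne; apply: val_inj; rewrite hdpos_val (Nmx_dat nz) /=.
by have [_ ->] := Nmx_neq0 nz; rewrite addnK.
Qed.

Lemma Nmx_graded : graded Nmx.
Proof.
apply/(@gradedP _ i) => p q ne; apply/eqP; apply: contraT => nz; case: ne.
have [/nu_neq0[_ _ Ei _] _] := Nmx_neq0 nz.
by rewrite /dvert (Nmx_dat nz) Ei.
Qed.

Lemma Nmx_intertw : intertw Nmx.
Proof.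
apply/eqP/matrixP=> p q; rewrite (XmatL i) (XmatR i).
(* The only possible defect is a component landing beyond the end of the block of [h]. *)
have RHS0 : (k <= (dat c p).2)%N -> (if (dat c q).2 == 0%N then 0 else Nmx p (opred q)) = 0.
  move=> le; case: ifP => // /negbT q0; apply/eqP; apply: contraT => nz.
  have := Nmx_dat nz; rewrite val_opred; have [|_ nl E] := dat_pred (i := i) (ltn_ord q); first by rewrite lt0n.
  by move=> E'; case/negP: nl; rewrite E' /dlast /=; case/Nmx_neq0: nz => /nu_neq0[_ ? _ _] _; rewrite eqn_leq le; apply/andP.
case: ifPn => [l|nl].
  have [lek|ltk] := leqP k (dat c p).2; first by rewrite RHS0.
  case: ifP => // _; apply/esym/eqP; apply: contraT => /Nmx_neq0[/nu_neq0[_ _ _]].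
  by move: l; rewrite /dlast => /eqP <-; rewrite leqNgt ltk.
have [_ ES] := dat_succ (ltn_ord p) nl.
have vS := val_osucc nl.
have Eh : hdpos (osucc p) = hdpos p.
  apply: val_inj; rewrite !hdpos_val /= vS ES /= subSS //.
have Enu : nu (osucc p) = if (k <= (dat c p).2)%N then 0 else nu p.
  rewrite /nu Eh vS ES /=; case: (ltnP (dat c p).2 k) => [lt|le]; last by rewrite andbF.
  by rewrite (ltnW lt).
rewrite mxE Enu; case: leqP => [le|lt]; first by rewrite RHS0 // mul0rn.
rewrite vS ES /= addnS; have [lth Ed] := dat_ht lt; rewrite addnS in lth Ed.
case: (val q =P _) => [Eq|ne].
  by rewrite Eq Ed /= mxE /= val_opred -[nat_of_ord q]/(val q) Eq /= eqxx.
case: ifP => // /negbT q0; apply/esym/eqP; apply: contraT => /Nmx_neq0[_].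
rewrite /= val_opred => Eq; case: ne; rewrite -Eq prednK //.
have [|//] := dat_pred (i := i) (ltn_ord q); by rewrite lt0n.
Qed.

Lemma Nmx_pi : (1%:M - Nmx) *m pi = pi h 0 *: delta_mx h 0.
Proof.
apply/matrixP=> p z; rewrite [z]ord1 mulmxBl mul1mx !mxE eqxx andbT.
have [p0|pN] := eqVneq (dat c p).2 0%N.
  have Eh : hdpos p = p by apply: val_inj; rewrite hdpos_val p0 subn0.
  under eq_bigr => a _ do rewrite mxE p0 addn0 mulrnAl mulrC -mulrnAl -mulr_natl -mulrA.
  rewrite (sum_pick (a := h)) //.
  rewrite /nu Eh p0 leq0n andbT; case: eqP => [->|_] /=; first by rewrite mulr0 subr0 mulr1.
  by rewrite mulrCA mulfV // mulr1 subrr mulr0.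
have -> : pi p 0 = 0.
  by apply/eqP; apply: contraT => /pi_supp[E]; rewrite E eqxx in pN.
rewrite big1 ?subr0 => [|a _].
  by case: eqP => [E|]; [rewrite E dat_h in pN|rewrite mulr0].
have [->|nz] := eqVneq (Nmx p a) 0; first by rewrite mul0r.
have [->|/pi_supp[]] := eqVneq (pi a 0) 0; first by rewrite mulr0.
by rewrite (Nmx_dat nz) /= => E; rewrite E in pN.
Qed.

(** The automorphism [1 - Nmx], with inverse [1 + Nmx], turns [pi] into a multiple of the coordinate
    at [h], by [Nmx_pi]. So the kernel is the image of the span of all basis vectors but [h]. *)
Lemma hyperplane_embed : exists M : 'M[F]_(totdim (mminus i c k), N),
  [/\ row_free M, graded M, intertw M & forall w : 'rV_N, (w <= M)%MS = (w *m pi == 0)].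
Proof.
have [f [EN f_lt f_inj f_dat f_S]] := mminus_embed (ltn_ord h) dat_h.
pose fo (p : 'I_(totdim (mminus i c k))) : 'I_N := insubd h (f p).
have foE p : val (fo p) = f p.
  by rewrite val_insubd; have [-> _] := f_lt p (ltn_ord p).
pose Psi : 'M[F]_(totdim (mminus i c k), N) := \matrix_(p, q) (q == fo p)%:R.
have Psi_free : Psi *m Psi^T = 1%:M.
  apply/matrixP=> p q; rewrite !mxE.
  under eq_bigr => a _ do rewrite !mxE.
  rewrite (sum_pick (a := fo p)) //; congr (_%:R); congr nat_of_bool.
  apply/eqP/eqP => [/(congr1 val)|-> //].
  by rewrite !foE => /f_inj E; apply: val_inj; apply: E.
have PsiL q (A : 'M[F]_(N, q)) p z : (Psi *m A) p z = A (fo p) z.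
  by rewrite mxE; under eq_bigr => a _ do rewrite mxE; rewrite (sum_pick (a := fo p)).
have Psi_graded : graded Psi.
  apply/(@gradedP _ i) => p q ne; rewrite mxE; case: eqP => // E; case: ne.
  by rewrite E foE; have [-> _] := f_dat p (ltn_ord p).
have Psi_intertw : intertw Psi.
  apply/eqP/matrixP=> p q; rewrite (XmatL i) PsiL (XmatE i) foE.
  have [_ ->] := f_dat p (ltn_ord p); case: ifPn => [_|nl]; first by rewrite andbF.
  by rewrite andbT mxE -val_eqE foE (val_osucc nl) f_S.
pose G : 'M[F]_N := 1%:M - Nmx.
have G_graded : graded G.
  apply/(@gradedP _ i) => p q ne; have /(@gradedP _ i)/(_ p q ne) E := Nmx_graded.
  rewrite mxE [X in _ + X]mxE E subr0 mxE; case: eqP => // Epq.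
  by rewrite Epq in ne.
have G_intertw : intertw G.
  by rewrite /intertw mulmxBr mulmxBl mulmx1 mul1mx (eqP Nmx_intertw).
have G_inv : G *m (1%:M + Nmx) = 1%:M.
  by rewrite mulmxDr mulmx1 mulmxBl mul1mx Nmx_sq subr0 subrK.
have M_free : row_free (Psi *m G).
  apply/row_freeP; exists ((1%:M + Nmx) *m Psi^T).
  by rewrite mulmxA -(mulmxA Psi) G_inv mulmx1.
exists (Psi *m G); split=> //; [exact: graded_mul|exact: intertw_mul|].
have sub : (Psi *m G <= kermx pi)%MS.
  apply/sub_kermxP; rewrite -mulmxA Nmx_pi; apply/matrixP=> p z.
  rewrite PsiL !mxE -val_eqE foE; case: eqP => [E|]; last by rewrite mulr0.
  by have [_ []] := f_lt p (ltn_ord p).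
have rk1 : \rank pi = 1%N.
  apply/eqP; rewrite eqn_leq rank_leq_col lt0n mxrank_eq0.
  by apply: contra pi_h => /eqP->; rewrite mxE.
(* Equality follows from equal dimensions, [totdim c] minus one on both sides. *)
have /eqmxP EM : (Psi *m G == kermx pi)%MS.
  by rewrite -(mxrank_leqif_eq sub) mxrank_ker rk1 (eqP M_free) EN subn1.
by move=> w; rewrite EM; apply/sub_kermxP/eqP.
Qed.

End Hyperplane.

(** * Hall numbers with a simple top *)

Section HallCount.
Variables (n : nat) (i : 'I_n) (F : finFieldType) (c : mseg n).
Local Notation dat := (bdat i).
Local Notation N := (totdim c).
Local Notation S := (mseg1 1 i).

Implicit Types (pi : 'cV[F]_N).

(** Commuting with the arrows, a map to the simple representation at [i] kills the radical, so it is
    a functional supported on the heads at [i]. The index [k] restricts it to summands of length at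
    least k+1. *)
Definition headfun (k : nat) (pi : 'cV[F]_N) := [forall p : 'I_N, (pi p 0 != 0) ==>
  [&& (dat c p).2 == 0%N, (dat c p).1.2 == i & (k <= (dat c p).1.1)%N]].
Definition kerset (pi : 'cV[F]_N) := [set w : 'rV[F]_N | w *m pi == 0].

Lemma headfunP k pi : reflect (forall p : 'I_N, pi p 0 != 0 ->
  [/\ (dat c p).2 = 0%N, (dat c p).1.2 = i & (k <= (dat c p).1.1)%N]) (headfun k pi).
Proof.
apply: (iffP forallP) => [H p nz|H p]; last first.
  by apply/implyP => /H[-> -> ->]; rewrite !eqxx.
by have /implyP/(_ nz)/and3P[/eqP-> /eqP-> ->] := H p.
Qed.

Lemma enum_mseg1 : enum_mset S = [:: (0%N, i)].
Proof. by rewrite enum_msetn. Qed.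

Lemma sdat_mseg1 : sdat (enum_mset S) = [:: ((0%N, i), 0%N)].
Proof. by rewrite enum_mseg1 sdat_cons sdat_nil. Qed.

Lemma totdim_mseg1 : totdim S = 1%N.
Proof. by rewrite totdimE sdat_mseg1. Qed.

Lemma dat_mseg1 (z : 'I_(totdim S)) : dat S z = ((0%N, i), 0%N).
Proof.
have z0 : nat_of_ord z = 0%N by have := ltn_ord z; rewrite [X in (_ < X)%N]totdim_mseg1; case: (nat_of_ord z).
by rewrite /bdat sdat_mseg1 z0.
Qed.

Lemma quot_simpleP (U : {set 'rV[F]_N}) :
  reflect (exists pi : 'cV[F]_N, [/\ pi != 0, headfun 0 pi & U = kerset pi])
    [exists pi : 'M[F]_(N, totdim S), [&& row_full pi, graded pi, intertw pi &
             U == [set w | w *m pi == 0]]].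
Proof.
have z : 'I_(totdim S) by rewrite totdim_mseg1; exact: ord0.
have z1 (y : 'I_(totdim S)) : y = z.
  have y0 (x : 'I_(totdim S)) : nat_of_ord x = 0%N.
    by have := ltn_ord x; rewrite [X in (_ < X)%N]totdim_mseg1; case: (nat_of_ord x).
  by apply: val_inj; rewrite /= !y0.
have kerE (M : 'M[F]_(N, totdim S)) (pi : 'cV[F]_N) : (forall p : 'I_N, pi p 0 = M p z) ->
    [set w : 'rV_N | w *m M == 0] = kerset pi.
  move=> E; apply/setP=> w; rewrite !inE.
  have EE a y : (w *m M) a y = (w *m pi) a 0.
    by rewrite !mxE; apply: eq_bigr => p _; rewrite E (z1 y).
  apply/eqP/eqP => E0; apply/matrixP=> a y.
    by rewrite [y]ord1 -(EE a z) E0 !mxE.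
  by rewrite EE E0 !mxE.
have fullE (M : 'M[F]_(N, totdim S)) : row_full M = (M != 0).
  rewrite -mxrank_eq0 -lt0n /row_full; have := rank_leq_col M.
  by rewrite [X in (_ <= X)%N]totdim_mseg1 [X in _ == X]totdim_mseg1; case: (\rank M) => [|[]].
have twE (M : 'M[F]_(N, totdim S)) : reflect (forall p : 'I_N, M p z != 0 -> (dat c p).2 = 0%N) (intertw M).
  apply: (iffP eqP) => [E p nz|H].
    apply/eqP; apply: contraT; rewrite -lt0n => /(dat_pred (ltn_ord p))[p0 nl _].
    move/matrixP/(_ (opred p) z): E; rewrite (XmatL i) (XmatR i) dat_mseg1 eqxx.
    rewrite val_opred (negbTE nl) => E; case/eqP: nz; rewrite -E; congr (M _ _).
    by apply: val_inj; rewrite /= (@val_osucc _ i) val_opred // prednK.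
  apply/matrixP=> p y; rewrite (XmatL i) (XmatR i) dat_mseg1 eqxx.
  case: ifPn => // nl; apply/eqP; apply: contraT; rewrite (z1 y) => /H.
  by rewrite (val_osucc nl); case: (dat_succ (ltn_ord p) nl) => _ ->.
apply: (iffP existsP) => [[M /and4P[full /gradedP gM /twE tM /eqP->]]|[pi [nz /headfunP hd ->]]].
  exists (\col_p M p z); split.
  - apply: contraTneq full => E; rewrite fullE negbK; apply/eqP/matrixP=> p y.
    by move/matrixP/(_ p 0): E; rewrite !mxE (z1 y).
  - apply/headfunP=> p; rewrite mxE => nzp; split=> //; first exact: tM.
    have t0 := tM p nzp.
    apply/eqP; apply: contraT => ne; case/eqP: nzp; apply: (gM i).
    rewrite dat_mseg1 /dvert t0 /= => E; case/eqP: ne; exact: val_inj.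
  - by apply: kerE => p; rewrite mxE.
pose M : 'M[F]_(N, totdim S) := \matrix_(p, y) pi p 0.
exists M; apply/and4P; split.
- rewrite fullE; apply: contraNneq nz => E; apply/eqP/matrixP=> p y.
  by move/matrixP/(_ p z): E; rewrite !mxE [y]ord1.
- apply/(@gradedP _ i) => p y; rewrite mxE dat_mseg1 => ne; apply/eqP; apply: contraT => /hd[t0 vi _].
  by case: ne; rewrite /dvert t0 vi.
- by apply/twE => p; rewrite mxE => /hd[].
- by rewrite (kerE M pi) // => p; rewrite mxE.
Qed.

Lemma headfun_min pi : pi != 0 -> headfun 0 pi ->
  exists h : 'I_N, pi h 0 != 0 /\ headfun (dat c h).1.1 pi.
Proof.
move=> nz /headfunP hd.
have [h0 nzh0] : exists h0, pi h0 0 != 0.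
  apply/existsP; apply: contraNT nz; rewrite negb_exists => /forallP H.
  by apply/eqP/matrixP=> p y; rewrite [y]ord1 mxE; apply/eqP; rewrite -[_ == _]negbK H.
case: (arg_minnP (P := fun h => pi h 0 != 0) (fun h => (dat c h).1.1) nzh0) => h nzh hmin.
exists h; split=> //; apply/headfunP=> p nzp; have [-> -> _] := hd p nzp.
by split=> //; apply: hmin.
Qed.

(** The multiplicity of [(k, i)] drops in [mminus i c k], and not in [mminus i c k'] for another
    [k']. *)
Lemma mminus_inj k k' : (0 < c (k, i))%N -> (0 < c (k', i))%N ->
  mminus i c k = mminus i c k' -> k = k'.
Proof.
move=> ck ck' /msetP/(_ (k, i)); rewrite !mminusE eqxx.
have [//|ne] := eqVneq k k'.
have -> : (if k is k1.+1 then nat_of_bool ((k, i) == (k1, ord_pred i)) else nat_of_bool false) = 0%N.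
  by case: (k) => // k1; rewrite xpair_eqE gtn_eqF.
have -> : ((k, i) == (k', i)) = false by rewrite xpair_eqE (negbTE ne).
by move: ck; case: (c (k, i)) => // N _; rewrite addn0 subn0 /= => E; exfalso; lia.
Qed.

Lemma headfun_dat k pi (h : 'I_N) : pi h 0 != 0 -> headfun k pi ->
  dat c h = (((dat c h).1.1, i), 0%N) /\ (0 < c ((dat c h).1.1, i))%N.
Proof.
move=> nzh /headfunP/(_ h nzh)[t0 vi _].
have E : dat c h = (((dat c h).1.1, i), 0%N) by case: (dat c h) t0 vi => [[l v] t] /= -> ->.
split=> //; rewrite -count_mem_mset -has_count has_pred1.
have := ltn_ord h; rewrite [X in (_ < X)%N]totdimE => /(sdat_split ((0%N, i), 0%N))[L1 [s [L2 [t [EL _ _]]]]].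
rewrite -/(dat c h) E => -[Es _]; rewrite EL -Es.
by rewrite mem_cat mem_head orbT.
Qed.

(** The shortest summand on which such a functional is nonzero has length exactly k+1, see
    [minfunP]. *)
Definition minfun k := [set pi : 'cV[F]_N | headfun k pi && ~~ headfun k.+1 pi].

Lemma minfunP k pi : reflect (exists h : 'I_N, [/\ pi h 0 != 0, (dat c h).1.1 = k & headfun k pi])
  (pi \in minfun k).
Proof.
rewrite inE; apply: (iffP andP) => [[hd]|[h [nz <- hd]]].
  rewrite negb_forall => /existsP[h]; rewrite negb_imply => /andP[nz].
  have /headfunP/(_ h nz)[-> -> le] := hd; rewrite !eqxx /= -leqNgt => le'.
  by exists h; split=> //; apply/eqP; rewrite eqn_leq le le'.
split=> //; apply/negP => /headfunP/(_ h nz)[_ _]; by rewrite ltnn.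
Qed.

(** Every subrepresentation with quotient the simple one at [i] is the kernel of some [pi]. By
    [hyperplane_embed] its type is [mminus] for the shortest length in the support of [pi], and by
    [mminus_inj] this length must belong to [k]. *)
Lemma hall_count_mminus k : (0 < c (k, i))%N ->
  hall_count F S (mminus i c k) c = #|kerset @: minfun k|.
Proof.
move=> ck; apply: eq_card => U; rewrite inE.
apply/andP/imsetP.
  case=> /existsP[M /and4P[fM gM tM /eqP EU]] /quot_simpleP[pi [nz hd0 EU']].
  have [h [nzh hdk]] := headfun_min nz hd0.
  have [Dh ch] := headfun_dat nzh hdk.
  have hdk' := headfunP _ _ hdk.
  have [M' [fM' gM' tM' EM']] := hyperplane_embed Dh nzh hdk'.
  exists pi => //; apply/minfunP; exists h.
  suff Ek : (dat c h).1.1 = k by split=> //; rewrite -Ek.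
  apply: mminus_inj => //; symmetry.
  apply: (rep_embed_inj i fM gM tM fM' gM' tM'); rewrite -EU EU'.
  apply/setP=> w; rewrite inE -EM'; apply/submxP/imsetP => [[D ->]|[D _ ->]]; by exists D.
case=> pi /minfunP[h [nzh <- hd]] EU.
have [Dh ch] := headfun_dat nzh hd.
have [M' [fM' gM' tM' EM']] := hyperplane_embed Dh nzh (headfunP _ _ hd).
split.
  apply/existsP; exists M'; apply/and4P; split=> //; apply/eqP; rewrite EU.
  apply/setP=> w; rewrite inE -EM'; apply/submxP/imsetP => [[D ->]|[D _ ->]]; by exists D.
apply/quot_simpleP; exists pi; split=> //.
  by apply: contraNneq nzh => ->; rewrite mxE.
by apply/headfunP => p /(headfunP _ _ hd)[].
Qed.

Lemma hall_count_eq0 b : (forall k, (0 < c (k, i))%N -> b <> mminus i c k) ->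
  hall_count F S b c = 0%N.
Proof.
move=> nb; apply: eq_card0 => U; rewrite inE.
apply/negP => /andP[/existsP[M /and4P[fM gM tM /eqP EU]] /quot_simpleP[pi [nz hd0 EU']]].
have [h [nzh hdk]] := headfun_min nz hd0.
have [Dh ch] := headfun_dat nzh hdk.
have [M' [fM' gM' tM' EM']] := hyperplane_embed Dh nzh (headfunP _ _ hdk).
apply: (nb _ ch); apply: (rep_embed_inj i fM gM tM fM' gM' tM'); rewrite -EU EU'.
apply/setP=> w; rewrite inE -EM'; apply/submxP/imsetP => [[D ->]|[D _ ->]]; by exists D.
Qed.

Definition nheads k := count (fun s : seg n => (s.2 == i) && (k <= s.1)%N) (enum_mset c).

Lemma card_headfun k : #|[set pi | headfun k pi]| = (#|F| ^ nheads k)%N.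
Proof.
pose P := [pred p : 'I_N | [&& (dat c p).2 == 0%N, (dat c p).1.2 == i & (k <= (dat c p).1.1)%N]].
have -> : nheads k = #|P|.
  rewrite (card_ord_nth _ (fun x => [&& x.2 == 0%N, x.1.2 == i & (k <= x.1.1)%N]) (totdimE c)).
  rewrite /nheads; elim: (enum_mset c) => [|s L IH]; first by rewrite sdat_nil.
  rewrite sdat_cons count_cat -IH /= -[LHS]addn0 addnAC; congr addn.
  rewrite count_map; congr addn; symmetry; apply/eqP; rewrite -leqn0 leqNgt -has_count.
  by apply/hasP=> -[t]; rewrite mem_iota /=; case: t.
rewrite -(card_pffun_on 0 P (predT : {pred F})) -(card_imset _ (f := fun f : {ffun 'I_N -> F} => \col_p f p)).
  apply: eq_card => pi; rewrite inE; apply/headfunP/imsetP => [H|[f /pffun_onP[sf _] ->]].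
    exists [ffun p => pi p 0]; last by apply/matrixP=> p y; rewrite mxE ffunE [y]ord1.
    apply/pffun_onP; split=> //; apply/subsetP=> p; rewrite inE ffunE => /H[E1 E2 E3].
    by rewrite inE E1 E2 E3 !eqxx.
  move=> p; rewrite mxE => nz; have /(subsetP sf) : p \in 0.-support f by [].
  by rewrite inE => /and3P[/eqP-> /eqP-> ->].
move=> f g /matrixP E; apply/ffunP=> p; by have := E p 0; rewrite !mxE.
Qed.

Lemma nheadsS k : nheads k = (nheads k.+1 + c (k, i))%N.
Proof.
rewrite /nheads -count_mem_mset; elim: (enum_mset c) => //= s L ->; rewrite addnACA; congr addn.
case: s => l s2 /=; rewrite xpair_eqE; case: (s2 == i) => /=; rewrite ?andbF //.
by rewrite andbT; case: ltngtP.
Qed.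

Lemma kerset_scale pi pi' (h : 'I_N) : pi h 0 != 0 -> kerset pi = kerset pi' ->
  pi' = (pi' h 0 / pi h 0) *: pi.
Proof.
move=> nz E; apply/matrixP=> p y; rewrite [y]ord1 mxE.
(* This vector lies in the kernel of [pi], hence in that of [pi'], which gives the proportionality
   at [p]. *)
pose w : 'rV[F]_N := delta_mx 0 p - (pi p 0 / pi h 0) *: delta_mx 0 h.
have wE (r : 'cV[F]_N) : w *m r = (r p 0 - pi p 0 / pi h 0 * r h 0)%:M.
  rewrite mulmxBl -scalemxAl -!rowE; apply/matrixP=> a b.
  by rewrite !ord1 !mxE.
have : w \in kerset pi by rewrite inE wE divfK // subrr raddf0.
rewrite E inE wE => /eqP/matrixP/(_ 0 0); rewrite !mxE eqxx mulr1n => /eqP.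
by rewrite subr_eq0 => /eqP->; rewrite mulrC mulrCA mulrC.
Qed.

(** Functionals with the same kernel are proportional, so the fibres of [kerset] are orbits of the
    nonzero scalars. *)
Lemma card_minfun k : #|minfun k| = ((#|F| - 1) * #|kerset @: minfun k|)%N.
Proof.
rewrite -[LHS]sum1_card (partition_big_imset kerset) /= mulnC -sum_nat_const.
apply: eq_bigr => U /imsetP[pi Dpi ->].
have /minfunP[h [nz _ /headfunP hd]] := Dpi.
have inj : injective (fun a : F => a *: pi).
  by move=> a b /matrixP/(_ h 0); rewrite !mxE => /(mulIf nz).
rewrite sum1_card subn1 -(cardsC1 (0 : F)) -(card_imset _ inj).
apply: eq_card => pi'; rewrite unfold_in /=; apply/andP/imsetP => [[Dpi' /eqP EK]|[a]].
  have E := kerset_scale nz (esym EK); exists (pi' h 0 / pi h 0) => //.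
  rewrite !inE; apply: contraL Dpi' => /eqP a0; rewrite a0 scale0r in E.
  by rewrite E; apply/minfunP => -[h' []]; rewrite mxE eqxx.
rewrite !inE => a0 ->; split.
  have nzE (p : 'I_N) : ((a *: pi) p 0 != 0) = (pi p 0 != 0) by rewrite mxE mulf_eq0 (negbTE a0).
  have hfE k' : headfun k' (a *: pi) = headfun k' pi by apply: eq_forallb => p; rewrite nzE.
  by rewrite !hfE; rewrite inE in Dpi.
by apply/eqP/setP => w; rewrite !inE -scalemxAr scaler_eq0 (negbTE a0).
Qed.

(** There are q^(nheads k) - q^(nheads (k+1)) functionals in [minfun k]; division by q - 1 gives a
    geometric sum. *)
Lemma hall_count_mseg1 k : (0 < c (k, i))%N ->
  hall_count F S (mminus i c k) c = (\sum_(r < c (k, i)) #|F| ^ (nheads k.+1 + r))%N.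
Proof.
move=> ck; rewrite hall_count_mminus //.
have q1 : (1 < #|F|)%N by rewrite (cardD1 0) (cardD1 1) !inE oner_neq0.
apply/eqP; rewrite -(eqn_pmul2l (_ : 0 < #|F| - 1)%N) ?subn_gt0 // -card_minfun.
have -> : minfun k = [set pi | headfun k pi] :\: [set pi | headfun k.+1 pi].
  by apply/setP=> pi; rewrite !inE andbC.
rewrite cardsD (setIidPr _); last first.
  apply/subsetP=> pi; rewrite !inE => /headfunP H; apply/headfunP => p /H[-> -> /ltnW].
  by [].
rewrite !card_headfun [nheads k]nheadsS.
under eq_bigr => r _ do rewrite expnD.
rewrite -big_distrr /= mulnCA subn1 -predn_exp expnD -{2}[(_ ^ nheads _)%N]muln1 -mulnBr subn1.
by [].
Qed.

End HallCount.

(** * Hall polynomials with a simple top *)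

Section HallPoly.
Variables (n : nat).

(** A nonzero polynomial has finitely many roots. Consequently the counts over prime fields alone
    determine the polynomial that [hall_poly] chooses. *)
Lemma poly_eq0_primes (P : {poly int}) : (forall p, prime p -> P.[p%:Z] = 0) -> P = 0.
Proof.
move=> H; apply/eqP; apply: contraT => nzP.
have [s [us sz ps]] : exists s : seq int, [/\ uniq s, size s = size P & all (root P) s].
  suff [s [us sz ps]] : exists s : seq nat, [/\ uniq s, size s = size P & all prime s].
    exists [seq x%:Z | x <- s]; split; rewrite ?size_map ?map_inj_uniq //; first by move=> x y [].
    by apply/allP => _ /mapP[x xs ->]; apply/rootP; apply: H; apply: (allP ps).
  elim: (size P) => [|N [s [us sz ps]]]; first by exists [::].
  have [p ltp pp] := prime_above (\max_(x <- s) x); exists (p :: s); split=> /=; rewrite ?us ?sz ?pp //.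
  rewrite andbT; apply/negP => ps'; move: ltp; rewrite ltnNge => /negP; apply.
  by rewrite (big_rem p) //= leq_maxl.
by have := max_poly_roots nzP ps us; rewrite sz ltnn.
Qed.

Lemma hall_polyE (a b c : mseg n) (P : {poly int}) :
  (forall F : finFieldType, (hall_count F a b c)%:Z = P.[(#|F|)%:Z]) -> hall_poly a b c = P.
Proof.
move=> HP; have H : exists P, forall F : finFieldType, (hall_count F a b c)%:Z = P.[(#|F|)%:Z].
  by exists P.
have := epsilon_spec (inhabits 0) _ H; rewrite -/(hall_poly a b c) => HQ.
apply/eqP; rewrite -subr_eq0; apply/eqP; apply: poly_eq0_primes => p pp.
by rewrite hornerD hornerN -{1}(card_Fp pp) -HQ HP card_Fp // subrr.
Qed.

Variable i : 'I_n.

Lemma hall_poly_mseg1 (c : mseg n) k : (0 < c (k, i))%N ->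
  hall_poly (mseg1 1 i) (mminus i c k) c = \sum_(r < c (k, i)) 'X^(nheads i c k.+1 + r).
Proof.
move=> ck; apply: hall_polyE => F; rewrite hall_count_mseg1 // horner_sum -natz natr_sum.
by apply: eq_bigr => r _; rewrite hornerXn natrX natz.
Qed.

Lemma hall_poly_mseg1_eq0 (b c : mseg n) :
  (forall k, (0 < c (k, i))%N -> b <> mminus i c k) -> hall_poly (mseg1 1 i) b c = 0.
Proof. by move=> H; apply: hall_polyE => F; rewrite hall_count_eq0 // horner0. Qed.

End HallPoly.

(** * Dimensions of endomorphism rings *)

Section Eps.
Variables (n : nat).

(** A homomorphism from k[s] sends the head to a combination of vectors [t] of k[s'] at the vertex
    of that head, each killed by s.1 + 1 arrows, that is with s'.1 <= s.1 + t. *)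
Definition homdim (s s' : seg n) : nat :=
  count (fun t => (dvert (s', t) == val s.2) && (s'.1 <= s.1 + t)%N) (iota 0 s'.1.+1).

Lemma big_sdat (L : seq (seg n)) (G : seg n * nat -> nat) :
  (\sum_(x <- sdat L) G x = \sum_(s <- L) \sum_(t <- iota 0 s.1.+1) G (s, t))%N.
Proof.
elim: L => [|s L IH]; first by rewrite sdat_nil !big_nil.
by rewrite sdat_cons big_cat IH big_cons big_map.
Qed.

Variables (i : 'I_n) (m : mseg n).
Local Notation N := (totdim m).
Local Notation dat := (bdat i m).
Local Notation hdpos := (@hdpos n i m).

Fact endo_eqs_is_linear : linear (@endo_eqs n m).
Proof.
move=> a A B; rewrite /endo_eqs scale_col_mx add_col_mx; congr col_mx.
  by rewrite mulmxDr mulmxDl -scalemxAr -scalemxAl scalerBr opprD addrACA.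
by apply/matrixP=> p q; rewrite !mxE; case: ifP; rewrite ?mulr0 ?addr0.
Qed.
HB.instance Definition _ :=
  GRing.isLinear.Build rat 'M[rat]_N 'M[rat]_(N + N, N) _ (@endo_eqs n m) endo_eqs_is_linear.

Lemma endo_eqsP (A : 'M[rat]_N) :
  A \in lker (linfun (@endo_eqs n m)) = graded A && intertw A.
Proof.
rewrite memv_ker lfunE /= /endo_eqs col_mx_eq0 subr_eq0 andbC; congr andb.
apply/eqP/(@gradedP _ i) => [/matrixP E p q /eqP ne|H].
  by have := E p q; rewrite !mxE !(nth_bvert i) ?ltn_ord // (negbTE ne).
apply/matrixP=> p q; rewrite !mxE !(nth_bvert i) ?ltn_ord //.
by case: eqP => // /H.
Qed.

Definition hompair (x : 'I_N * 'I_N) :=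
  [&& (dat x.1).2 == 0%N, dvert (dat x.1) == dvert (dat x.2) &
      ((dat x.2).1.1 <= (dat x.1).1.1 + (dat x.2).2)%N].

(** The endomorphism sending the head [x.1] to [x.2], extended along the arrows and zero on the
    other blocks; the last condition stops it at the end of the block of [x.2]. *)
Definition Emx (x : 'I_N * 'I_N) : 'M[rat]_N := \matrix_(p < N, q < N)
  [&& hdpos p == x.1, val q == x.2 + (dat p).2 & (dat q).2 == (dat x.2).2 + (dat p).2]%N%:R.

Lemma Emx_graded x : hompair x -> graded (Emx x).
Proof.
case/and3P=> _ /eqP vx _; apply/(@gradedP _ i) => p q ne; rewrite mxE.
case: and3P => // -[/eqP hp /eqP qE /eqP oq]; case: ne.
have := dat_hdpos i p; rewrite hp => hE.
have [D2 D2'] : (dat q).1 = (dat x.2).1 /\ True.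
  have [le1 E1] := dat_head i (ltn_ord q); have [le2 E2] := dat_head i (ltn_ord x.2).
  have e : (q - (dat q).2 = x.2 - (dat x.2).2)%N.
    by have qE' : nat_of_ord q = (x.2 + (dat p).2)%N := qE; lia.
  by rewrite e E2 in E1; case: E1 => ->.
have -> : dvert (dat p) = val (iter (dat p).2 (@ord_pred n) (dat p).1.2) by [].
rewrite /dvert oq D2 addnC iterD; congr (val (iter _ _ _)); apply: val_inj.
by rewrite -[RHS]vx hE.
Qed.

Lemma Emx_intertw x : hompair x -> intertw (Emx x).
Proof.
case/and3P=> _ _ le; apply/eqP/matrixP=> p q; rewrite (XmatL i) (XmatR i).
case: ifPn => [l|nl].
  case: ifPn => // q0; rewrite mxE; case: and3P => // -[/eqP hp /eqP qE /eqP oq]; exfalso.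
  have [|q1 _ E] := dat_pred (i := i) (ltn_ord q); first by rewrite lt0n.
  have Ev : nat_of_ord (opred q) = q.-1 := val_opred q.
  rewrite Ev E /= in oq; rewrite /= Ev in qE.
  have := dat_hdpos i p; rewrite hp => hE; rewrite hE /= in le.
  move: l; rewrite /dlast => /eqP l.
  have leq := dat_le i (ltn_ord q).
  suff D2 : (dat q).1 = (dat x.2).1 by rewrite D2 in leq; lia.
  have [le1 E1] := dat_head i (ltn_ord q); have [le2 E2] := dat_head i (ltn_ord x.2).
  have e : (q - (dat q).2 = x.2 - (dat x.2).2)%N by lia.
  by rewrite e E2 in E1; case: E1 => ->.
have [_ ES] := dat_succ (ltn_ord p) nl.
have vS := val_osucc nl.
have Eh : hdpos (osucc p) = hdpos p.
  by apply: val_inj; rewrite !hdpos_val /= vS ES /= subSS.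
rewrite mxE Eh vS ES /=; case: ifPn => [/eqP q0|q0].
  by rewrite q0 !addnS /= !andbF.
have [|q1 _ E] := dat_pred (i := i) (ltn_ord q); first by rewrite lt0n.
rewrite mxE /= val_opred E /=; congr (_%:R); congr nat_of_bool; congr andb.
by rewrite !addnS -[q.-1 == _]eqSS -[(dat q).2.-1 == _]eqSS !prednK // lt0n.
Qed.

(** Commuting with the arrows moves an entry back one step along both blocks; it becomes 0 when the
    column reaches a head before the row does. *)
Lemma endo_entry (A : 'M[rat]_N) (p q : 'I_N) : intertw A ->
  A p q = if ((dat p).2 <= (dat q).2)%N then A (hdpos p) (insubd q (q - (dat p).2)%N) else 0.
Proof.
move=> /eqP tA; move E: (dat p).2 => t; elim: t p q E => [|t IH] p q E.
  rewrite /= subn0; congr (A _ _); apply: val_inj; first by rewrite hdpos_val E subn0.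
  by rewrite val_insubd ltn_ord.
have [|p1 nl Ep] := dat_pred (i := i) (ltn_ord p); first by rewrite E.
have vp : nat_of_ord (opred p) = p.-1 := val_opred p.
rewrite -vp in nl Ep.
have Sp : osucc (opred p) = p.
  by apply: val_inj; rewrite /= (val_osucc nl) vp prednK.
have Eh : hdpos (opred p) = hdpos p.
  by apply: val_inj; rewrite !hdpos_val Ep vp E /=; lia.
move/matrixP/(_ (opred p) q): tA; rewrite (XmatL i) (XmatR i) (negbTE nl) Sp => ->.
case: ifPn => [/eqP -> //|q0].
have [|q1 _ Eq] := dat_pred (i := i) (ltn_ord q); first by rewrite lt0n.
have vq : nat_of_ord (opred q) = q.-1 := val_opred q.
rewrite (IH (opred p)) ?Ep ?E // vq Eq Eh /= -[X in (X <= _)%N]/t.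
have -> : (t <= (dat q).2.-1)%N = (t < (dat q).2)%N by rewrite -ltnS prednK // lt0n.
case: ifP => // lt; congr (A _ _); apply: val_inj.
have := ltn_ord q; rewrite !val_insubd => ltq; do 2 (rewrite ifT; last lia); lia.
Qed.

(** If the target block continued beyond the source, the arrows would kill the vector after the end
    of the source but not its image. *)
Lemma endo_hompair (A : 'M[rat]_N) (h q : 'I_N) : graded A -> intertw A ->
  (dat h).2 = 0%N -> A h q != 0 -> hompair (h, q).
Proof.
move=> gA tA h0 nz; rewrite /hompair /= h0 eqxx /=; apply/andP; split.
  by apply: contraNT nz => /eqP/(gradedP _ _ gA)->.
rewrite leqNgt; apply/negP => lt; case/eqP: nz.
pose l := (dat h).1.1; have lth := @dat_offs n i m h l (ltn_ord h).
rewrite h0 add0n leqnn in lth; have [ltp Ep] := lth isT.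
have ltq := @dat_offs n i m q l.+1 (ltn_ord q).
have [|ltq' Eq] := ltq; first by rewrite /l; lia.
(* [p'] is the end of the block of [h], and [q'] lies one step further from [q] than [p'] from
   [h]. *)
pose p' := Ordinal ltp; pose q' := Ordinal ltq'.
move/eqP/matrixP/(_ p' q'): (tA); rewrite (XmatL i) (XmatR i) /= Ep Eq /dlast /= eqxx addnS /=.
move/esym; rewrite endo_entry // Ep /= val_opred /=.
have -> : (q + l.+1).-1 = (q + l)%N by lia.
have [|_ ->] := @dat_offs n i m q l (ltn_ord q); first by rewrite /l; lia.
rewrite /= leq_addl => <-; congr (A _ _); apply: val_inj.
  by rewrite hdpos_val /= Ep /= addnK.
by rewrite val_insubd addnK ltn_ord.
Qed.

(** The matrices [Emx] over [hompair] form a basis: their entries in the rows of heads are Kronecker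
    deltas, and by [endo_entry] those entries determine an endomorphism. *)
Lemma epsE_card : epsE m = #|hompair|.
Proof.
pose X := [tuple Emx (enum_val a) | a < #|hompair|].
have EmxE (x y : 'I_N * 'I_N) : hompair x -> (dat y.1).2 = 0%N -> Emx x y.1 y.2 = (y == x)%:R.
  move=> hx y0; rewrite mxE y0 !addn0; case: x y {hx} y0 => [x1 x2] [y1 y2] /= y0.
  have -> : hdpos y1 = y1 by apply: val_inj; rewrite hdpos_val y0 subn0.
  rewrite xpair_eqE; congr (_%:R); congr nat_of_bool; congr andb.
  by apply/andP/eqP => [[/eqP E _]|->]; [apply: val_inj|].
have hdJ a : (dat (enum_val (A := hompair) a).1).2 = 0%N.
  by have /and3P[/eqP] := enum_valP a.
have XE (a : 'I_#|hompair|) : X`_a = Emx (enum_val a).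
  by rewrite -(tnth_nth 0 X) tnth_mktuple.
have hJ (a : 'I_#|hompair|) : hompair (enum_val a) := enum_valP a.
have freeX : free X.
  apply/freeP => k E a.
  move/matrixP/(_ (enum_val a).1 (enum_val a).2): E.
  rewrite summxE [in RHS]mxE => <-; rewrite (bigD1 a) //= big1 => [|b ba].
    by rewrite XE mxE (EmxE _ _ (hJ a) (hdJ a)) eqxx mulr1 addr0.
  rewrite XE mxE (EmxE _ _ (hJ b) (hdJ a)).
  by rewrite (inj_eq enum_val_inj) eq_sym (negbTE ba) mulr0.
have -> : epsE m = \dim <<X>>.
  rewrite /epsE; congr (\dim _); apply/vspaceP=> A; rewrite endo_eqsP.
  apply/idP/idP => [/andP[gA tA]|].
    have -> : A = \sum_(a < #|hompair|) A (enum_val a).1 (enum_val a).2 *: X`_a.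
      apply/matrixP=> p q; rewrite summxE.
      under eq_bigr => a _ do rewrite XE mxE mxE.
      have hp0 : (dat (hdpos p)).2 = 0%N by rewrite dat_hdpos.
      pose q1 : 'I_N := insubd q (q - (dat p).2)%N.
      have vq1 : val q1 = (q - (dat p).2)%N.
        by rewrite val_insubd ifT //; apply: leq_ltn_trans (ltn_ord q); apply: leq_subr.
      have [le1 Eh1] := dat_head i (ltn_ord q).
      have q1E : ((dat p).2 <= (dat q).2)%N -> dat q1 = ((dat q).1, (dat q).2 - (dat p).2)%N.
        move=> le; rewrite -[nat_of_ord q1]/(val q1) vq1.
        have lt1 : (q - (dat q).2 < N)%N by apply: leq_ltn_trans (ltn_ord q); apply: leq_subr.
        have := @dat_offs n i m _ ((dat q).2 - (dat p).2)%N lt1; rewrite Eh1 /= add0n.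
        have := dat_le i (ltn_ord q) => leq2 [|_]; first lia.
        by have -> : (q - (dat q).2 + ((dat q).2 - (dat p).2) = q - (dat p).2)%N by lia.
      rewrite endo_entry //; case: ifP => [le|nle]; last first.
        rewrite big1 // => a _; case: and3P => [[_ _ /eqP E]|]; rewrite ?mulr0 //.
        by move: nle; rewrite E leq_addl.
      rewrite -/q1; have [E0|nz] := eqVneq (A (hdpos p) q1) 0.
        rewrite E0 big1 // => a _; case: and3P => [[/eqP E1 /eqP E2 _]|]; rewrite ?mulr0 //.
        rewrite -E1 (_ : (enum_val a).2 = q1) ?E0 ?mul0r //.
        by apply: val_inj; rewrite vq1 -[nat_of_ord q]/(val q) E2 addnK.
      have hJ' : (hdpos p, q1) \in hompair := endo_hompair gA tA hp0 nz.
      rewrite (sum_pickr (a := enum_rank_in hJ' (hdpos p, q1))) ?enum_rankK_in //.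
      move=> a; apply/and3P/eqP => [[/eqP E1 /eqP E2 /eqP E3]|->].
        apply: enum_val_inj; rewrite enum_rankK_in //; apply: injective_projections => /=; first by [].
        by apply: val_inj; rewrite vq1 -[nat_of_ord q]/(val q) E2 addnK.
      rewrite enum_rankK_in // q1E //=; split=> //; first by rewrite -[nat_of_ord q1]/(val q1) vq1; lia.
      by rewrite subnK.
    by apply: memv_suml => a _; apply/memvZ/memv_span/mem_nth; rewrite size_tuple.
  move=> /coord_span ->; rewrite -endo_eqsP; apply: memv_suml => a _; apply: memvZ.
  rewrite XE endo_eqsP.
  by rewrite Emx_graded ?Emx_intertw ?hJ.
by have /eqP-> := freeX; rewrite size_tuple.
Qed.

Lemma epsE_homdim : epsE m = (\sum_(s <- enum_mset m) \sum_(s' <- enum_mset m) homdim s s')%N.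
Proof.
pose x0 : seg n * nat := ((0%N, i), 0%N); pose D := sdat (enum_mset m).
pose g (x y : seg n * nat) : nat :=
  [&& x.2 == 0%N, dvert x == dvert y & (y.1.1 <= x.1.1 + y.2)%N].
have -> : epsE m = (\sum_(x <- D) \sum_(y <- D) g x y)%N.
  rewrite epsE_card -sum1_card big_mkcond /= -(pair_bigA _ (fun p q => if (p, q) \in hompair then 1%N else 0%N)) /=.
  rewrite (big_nth x0) -totdimE big_mkord; apply: eq_bigr => p _.
  rewrite (big_nth x0) -totdimE big_mkord; apply: eq_bigr => q _.
  by rewrite unfold_in /hompair /g /bdat; case: and3P.
rewrite big_sdat; apply: eq_bigr => s _.
rewrite /= big_cons [X in (_ + X)%N]big1_seq ?addn0; last first.
  move=> t; rewrite mem_iota => /andP[_ /andP[t0 _]]; rewrite big1 // => y _.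
  by rewrite /g /=; case: t t0.
rewrite big_sdat; apply: eq_bigr => s' _; rewrite /homdim -sum1_count [RHS]big_mkcond.
apply: eq_bigr => t _; rewrite /g eqxx [dvert (s, _)]/= eq_sym /=.
by case: andP.
Qed.

End Eps.

(** * The exponent of v in the action of f_i *)

Section Exponent.
Local Open Scope nat_scope.
Variables (n : nat) (i : 'I_n).
Hypothesis n_gt1 : 1 < n.

Lemma ord_pred_neq (j : 'I_n) : (ord_pred j == j) = false.
Proof.
apply/negP => /eqP /(congr1 val) /=; have := ltn_ord j.
case: (nat_of_ord j) => [|j']; first by rewrite add0n modn_small; lia.
by rewrite addSn /= modnDr => lt; rewrite modn_small; lia.
Qed.

Lemma iota0S l : iota 0 l.+1 = 0 :: [seq t.+1 | t <- iota 0 l].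
Proof. by rewrite /= -[1]addn0 iotaDl. Qed.

Lemma count_cons T (a : pred T) x s : count a (x :: s) = a x + count a s.
Proof. by []. Qed.

Definition dseg (s : seg n) (j : nat) := count (fun t => dvert (s, t) == j) (iota 0 s.1.+1).

Lemma dimvE (m : mseg n) j : Defs.dimv m j = \sum_(s <- enum_mset m) dseg s (val j).
Proof.
rewrite ffunE bvertE; elim: (enum_mset m) => [|s L IH]; first by rewrite sdat_nil big_nil.
by rewrite sdat_cons map_cat count_cat IH big_cons /dseg -map_comp count_map.
Qed.

(** What remains of (k+1; i] once the head is removed, as a list so that sums treat [k = 0]
    uniformly. *)
Definition mtail k : seq (seg n) := if k is k'.+1 then [:: (k', ord_pred i)] else [::].

Lemma sum_mminus (c : mseg n) k (phi : seg n -> nat) : 0 < c (k, i) ->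
  \sum_(s <- enum_mset c) phi s + \sum_(s <- mtail k) phi s =
  \sum_(s <- enum_mset (mminus i c k)) phi s + phi (k, i).
Proof.
move=> ck; rewrite -big_cat -(big_seq1 addn (k, i) phi) -big_cat; apply: perm_big.
apply/allP => x _ /=; rewrite !count_cat !count_mem_mset mminusE /= addn0.
have -> : count_mem x (mtail k) =
    if k is k'.+1 then nat_of_bool (x == (k', ord_pred i)) else nat_of_bool false.
  by case: (k) => //= k'; rewrite addn0 eq_sym.
rewrite [(k, i) == x]eq_sym subnK //; have [->|//] := eqVneq x (k, i).
exact: leq_trans ck (leq_addr _ _).
Qed.

Lemma sum_mtail0 k phi : (forall s, s \in mtail k -> phi s = 0) -> \sum_(s <- mtail k) phi s = 0.
Proof. by move=> H; rewrite big_seq big1. Qed.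

Lemma dseg_tail k j : dseg (k, i) j = (val i == j) + \sum_(s <- mtail k) dseg s j.
Proof.
rewrite /dseg /mtail; case: k => [|k]; first by rewrite big_nil.
rewrite big_seq1 [in LHS]iota0S count_cons count_map; congr addn.
apply: eq_count => t; rewrite -[LHS]/(val (iter t.+1 (@ord_pred n) i) == j) iterSr.
by [].
Qed.

(** A basis homomorphism hitting the head of (k+1; i] needs a source with head [i] of at least that
    length; the others land in the radical, which is the tail. *)
Lemma homdim_head s k :
  homdim s (k, i) = ((s.2 == i) && (k <= s.1)) + \sum_(s' <- mtail k) homdim s s'.
Proof.
rewrite /homdim /mtail; case: k => [|k]; first by rewrite big_nil /= !addn0 /dvert /= val_eqE eq_sym.
rewrite big_seq1 [in LHS]iota0S count_cons count_map; congr addn.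
  by rewrite /dvert /= val_eqE eq_sym addn0.
apply: eq_count => t.
rewrite -[LHS]/((val (iter t.+1 (@ord_pred n) i) == val s.2) && (k < s.1 + t.+1)) iterSr.
by rewrite addnS ltnS.
Qed.

(** A homomorphism to k[s'] from (k+1; i] is a vector at [i] killed by k+1 arrows, one from the tail
    a vector at [ord_pred i] killed by k arrows. The complementary counts are ranks, compared by
    [vcount_ord_pred]. *)
Lemma homdim_socle k s' :
  homdim (k, i) s' + dseg s' (ord_pred i) =
  \sum_(s <- mtail k) homdim s s' + dseg s' i + ((s'.2 == ord_pred i) && (k <= s'.1)).
Proof.
have := vcount_ord_pred [:: s'] i k.
rewrite /vcount sdat_cons sdat_nil cats0 !count_map count_cons [count _ [::]]/= addn0.
set I := iota 0 s'.1.+1; set h := nat_of_bool (_ && _) => H.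
have -> : \sum_(s <- mtail k) homdim s s' =
    count (fun t => (dvert (s', t) == val (ord_pred i)) && (s'.1 < k + t)) I.
  rewrite /mtail; case: (k) => [|k']; last first.
    by rewrite big_seq1 /homdim; apply: eq_count => t; rewrite /= addSn ltnS.
  rewrite big_nil; symmetry; apply/eqP; rewrite -leqn0 leqNgt -has_count.
  by apply/hasP => -[t]; rewrite mem_iota add0n => /andP[_]; rewrite ltnS leqNgt => /negbTE-> /andP[].
have split (P Q : pred nat) r : count P r = count (fun t => P t && Q t) r + count (fun t => P t && ~~ Q t) r.
  by elim: r => //= t r ->; case: (P t); case: (Q t) => /=; lia.
rewrite /dseg (split (fun t => dvert (s', t) == val (ord_pred i)) (fun t => s'.1 < k + t)).
rewrite (split (fun t => dvert (s', t) == i) (fun t => s'.1 <= k + t)) /homdim.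
have E1 : count (fun t => (dvert (s', t) == val (ord_pred i)) && ~~ (s'.1 < k + t)) I =
    count (fun t => (dvert (s', t) == i) && ~~ (s'.1 <= k + t)) I + h.
  move: H; set A := count _ I; set B := count _ I => H.
  transitivity A; first by apply: eq_count => t; rewrite /= -leqNgt (addnC k).
  rewrite H; congr addn; apply: eq_count => t; by rewrite /= -ltnNge (addnC k) addnS.
rewrite E1 -/I; set x1 := count (fun t => (dvert (s', t) == i) && (s'.1 <= k + t)) I.
rewrite -[X in X + _ = _]/x1; lia.
Qed.

Lemma dimv_mminus (c : mseg n) k (j : 'I_n) : 0 < c (k, i) ->
  Defs.dimv c j = Defs.dimv (mminus i c k) j + (i == j).
Proof.
move=> ck; rewrite !dimvE; have := sum_mminus (fun s => dseg s j) ck.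
by rewrite dseg_tail val_eqE addnA => /addIn.
Qed.

Definition heads_at j k (m : mseg n) := count (fun s : seg n => (s.2 == j) && (k <= s.1)) (enum_mset m).

Lemma heads_atE j k m : heads_at j k m = \sum_(s <- enum_mset m) ((s.2 == j) && (k <= s.1)).
Proof. by rewrite /heads_at -sum1_count big_mkcond; apply: eq_bigr => s _; case: (_ && _). Qed.

(** The double sum of [homdim] is expanded one argument at a time: [homdim_socle] in the first,
    [homdim_head] in the second. *)
Lemma epsE_mminus (c : mseg n) k : 0 < c (k, i) ->
  let b := mminus i c k in
  epsE c + Defs.dimv b (ord_pred i) =
  epsE b + Defs.dimv b i + 1 + heads_at (ord_pred i) k b + heads_at i k b.
Proof.
move=> ck b; rewrite !epsE_homdim //.
pose B (x y : seq (seg n)) := \sum_(s <- x) \sum_(s' <- y) homdim s s'.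
rewrite -![\sum_(s <- _) \sum_(s' <- _) _]/(B _ _).
have BL : B (enum_mset c) (enum_mset c) + B (mtail k) (enum_mset c) =
    B (enum_mset b) (enum_mset c) + \sum_(s' <- enum_mset c) homdim (k, i) s'.
  exact: sum_mminus.
have BR : B (enum_mset b) (enum_mset c) =
    B (enum_mset b) (enum_mset b) + heads_at i k b.
  have : B (enum_mset b) (enum_mset c) + B (enum_mset b) (mtail k) =
     B (enum_mset b) (enum_mset b) + \sum_(s <- enum_mset b) homdim s (k, i).
    by rewrite /B -!big_split; apply: eq_bigr => s _; apply: sum_mminus.
  under [X in _ = _ + X]eq_bigr => s _ do rewrite homdim_head.
  by rewrite big_split /= -heads_atE -/(B _ _); lia.
have BS : \sum_(s' <- enum_mset c) homdim (k, i) s' + Defs.dimv c (ord_pred i) =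
    B (mtail k) (enum_mset c) + Defs.dimv c i + heads_at (ord_pred i) k c.
  rewrite !dimvE heads_atE /B exchange_big -!big_split; apply: eq_bigr => s _.
  exact: homdim_socle.
(* The added segment (k; i-1] is one too short to be counted, and the removed one has its head at
   [i]. *)
have Hc : heads_at (ord_pred i) k c = heads_at (ord_pred i) k b.
  rewrite !heads_atE.
  have := sum_mminus (fun s => nat_of_bool ((s.2 == ord_pred i) && (k <= s.1))) ck.
  rewrite /= [i == _]eq_sym ord_pred_neq addn0 sum_mtail0 ?addn0 //.
  rewrite /mtail; case: (k) => // k' s; rewrite inE => /eqP-> /=.
  by rewrite ltnn andbF.
move: BS; rewrite !(dimv_mminus _ ck) -/b Hc eqxx [i == _]eq_sym ord_pred_neq; lia.
Qed.

Lemma heads_atS j k (m : mseg n) : heads_at j k m = heads_at j k.+1 m + m (k, j).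
Proof. exact: nheadsS. Qed.

Lemma SsumE (m : mseg n) k :
  Ssum m k.+1 i = ((heads_at (ord_pred i) k m)%:Z - (heads_at i k m)%:Z)%R.
Proof.
rewrite /Ssum !heads_atE big_mkcond -!natz !natr_sum -sumrB.
apply: eq_bigr => s _; rewrite ltnS; case: (k <= s.1); first by rewrite !andbT !natz.
by rewrite !andbF subrr.
Qed.

Lemma dimv_mseg1 j : Defs.dimv (mseg1 1 i) j = (i == j).
Proof. by rewrite dimvE enum_mseg1 big_seq1 dseg_tail big_nil addn0 val_eqE. Qed.

Lemma mform_mseg1 d : mform (Defs.dimv (mseg1 1 i)) d = d (ord_pred i) + d i.
Proof.
rewrite /mform; congr addn.
  rewrite (bigD1 i) //= dimv_mseg1 eqxx mul1n big1 ?addn0 // => j ji.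
  by rewrite dimv_mseg1 eq_sym (negbTE ji).
rewrite (bigD1 i) //= dimv_mseg1 eqxx mul1n big1 ?addn0 // => j ji.
by rewrite dimv_mseg1 eq_sym (negbTE ji).
Qed.

Lemma mminus_self (c : mseg n) k : mminus i c k (k, i) = c (k, i) - 1.
Proof.
rewrite mminusE eqxx; case: (k) => [|k']; rewrite ?addn0 //.
by rewrite xpair_eqE [i == _]eq_sym ord_pred_neq andbF addn0.
Qed.

Lemma nheads_mminus (c : mseg n) k : 0 < c (k, i) ->
  nheads i c k.+1 = heads_at i k.+1 (mminus i c k).
Proof.
move=> ck; rewrite -[nheads _ _ _]/(heads_at i k.+1 c) !heads_atE.
have := sum_mminus (fun s => nat_of_bool ((s.2 == i) && (k < s.1))) ck.
rewrite ltnn andbF addn0 sum_mtail0 ?addn0 //.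
by rewrite /mtail; case: (k) => // k' s; rewrite inE => /eqP-> /=; rewrite ord_pred_neq.
Qed.

(** The normalizations of <b> and <c>, the twist of the product, and the top degree of the Hall
    polynomial at q = v^-2 add up to S. *)
Lemma pbw_exp_mminus (c : mseg n) k : 0 < c (k, i) ->
  let b := mminus i c k in
  (pbw_exp b - pbw_exp c + (mform (Defs.dimv (mseg1 1 i)) (Defs.dimv b))%:Z
   - 2 * (nheads i c k.+1 + (c (k, i) - 1))%:Z = Ssum b k.+1 i)%R.
Proof.
move=> ck b; rewrite mform_mseg1 SsumE nheads_mminus // -/b -mminus_self -/b.
rewrite -heads_atS /pbw_exp.
have Esq : \sum_j Defs.dimv c j ^ 2 = \sum_j Defs.dimv b j ^ 2 + 2 * Defs.dimv b i + 1.
  rewrite [LHS](bigD1 i) // [X in X + _ + _](bigD1 i) //=.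
  rewrite (eq_bigr (fun j => Defs.dimv b j ^ 2)) => [|j ji]; last first.
    by rewrite (dimv_mminus _ ck) eq_sym (negbTE ji) addn0.
  rewrite (dimv_mminus _ ck) eqxx -/b -!mulnn.
  set S := \sum_(_ | _) _; nia.
have := epsE_mminus ck; rewrite -/b /= Esq.
move: (\sum_j _) (Defs.dimv b i) (Defs.dimv b (ord_pred i)) (heads_at _ _ _) => S d1 d2 h1.
move: (heads_at _ _ _) (epsE c) (epsE b) => h2 e1 e2; lia.
Qed.

Lemma pbw_exp_mseg1 : pbw_exp (mseg1 1 i) = 0%R.
Proof.
rewrite /pbw_exp (epsE_homdim i) enum_mseg1 !big_seq1 homdim_head big_nil /= eqxx.
rewrite (bigD1 i) //= big1 => [|j ji]; last by rewrite dimv_mseg1 eq_sym (negbTE ji).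
by rewrite dimv_mseg1 eqxx.
Qed.

End Exponent.

(* The constructions of the statement over an arbitrary field and index type; [transfer] identifies
   the two versions by conversion. *)
Section GenericDefs.
Variables (K : fieldType) (v : K) (T : choiceType) (pe : T -> int).
Local Notation H := {malg K[T]}.
Definition gintpoly (p : {poly int}) (x : K) : K := (map_poly (fun z : int => z%:~R) p).[x].
Definition gqint (a : nat) : K := (v ^+ a - v ^- a) / (v - v^-1).
Definition gqfact (a : nat) : K := \prod_(1 <= j < a.+1) gqint j.
Definition ghmul (um : T -> T -> H) (x y : H) : H :=
  \sum_(a <- msupp x) \sum_(b <- msupp y) (x@_a * y@_b) *: um a b.
Definition gpbw (m : T) : H := (v ^ pe m) *: << m >>.
Definition gpbwc (x : H) (m : T) : K := x@_m * v ^ (- pe m).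
Definition gform (nm : T -> K) (x y : H) : K :=
  \sum_(m <- msupp x) gpbwc x m * gpbwc y m * nm m.
Definition gfdiv (qf : nat -> K) (fo : H -> H) (k : nat) (x : H) : H := (qf k)^-1 *: iter k fo x.
Definition geprime (fo : H -> H) (fm : H -> H -> K) (y : H) : H :=
  epsilon (inhabits 0) (fun z : H => forall x : H, fm (fo x) y = fm x z).
Definition gkdecomp (fd : nat -> H -> H) (ep : H -> H) (x : H) (xs : seq H) : Prop :=
  x = \sum_(k < size xs) fd k (nth 0 xs k) /\ forall k, ep (nth 0 xs k) = 0.
Definition gftilde (fd : nat -> H -> H) (ep : H -> H) (x : H) : H :=
  let xs := epsilon (inhabits [::]) (gkdecomp fd ep x) in
  \sum_(k < size xs) fd k.+1 (nth 0 xs k).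
Definition gin_vL (x : H) : Prop :=
  exists (s : seq T) (c : T -> {poly int}),
    x = \sum_(m <- s) (v * gintpoly (c m) v) *: gpbw m.
End GenericDefs.

Definition gpnorm (K : fieldType) (v : K) n (m : mseg n) : K :=
  \prod_(s <- finsupp m)
     (v ^- 'C(m s, 2) * (1 - v ^+ 2) ^+ (s.1 * m s) / gqfact v (m s)).
Definition gumul (K : fieldType) (v : K) n (a b : mseg n) : {malg K[mseg n]} :=
  v ^+ (mform (Defs.dimv a) (Defs.dimv b)) *:
  \sum_(c <- ms_of_dim [ffun j => (Defs.dimv a j + Defs.dimv b j)%N])
     gintpoly (hall_poly a b c) (v ^- 2) *: << c >>.

(** * The operators f_i on the PBW basis *)

Section Moves.
Local Open Scope nat_scope.
Variables (n : nat) (i : 'I_n).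

Implicit Types b c : mseg n.

Definition mp (b : mseg n) k := mplus b k.+1 i.
Definition valid (b : mseg n) k := if k is k'.+1 then 0 < b (k', ord_pred i) else true.
Definition lbound (b : mseg n) := (\max_(s <- enum_mset b) s.1.+1).+1.

Lemma mpE b k x : mp b k x =
  b x + (x == (k, i)) - (if k is k'.+1 then nat_of_bool (x == (k', ord_pred i)) else 0).
Proof.
by rewrite /mp /mplus /mseg1; case: k => [|k] /=; rewrite !msetE2 !msetnE ?subn0; do 2?case: eqP.
Qed.

Lemma mminus_mp b k : valid b k -> mminus i (mp b k) k = b.
Proof.
move=> vb; apply/msetP=> x; rewrite mminusE mpE; case: k vb => [|k] /=.
  by rewrite subn0 addn0 addnK.
move=> bk; rewrite subnK ?addnK //; have [->|] := eqVneq x (k, ord_pred i) => //.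
exact: leq_trans bk (leq_addr _ _).
Qed.

Lemma valid_mminus c k : 0 < c (k, i) -> 1 < n -> valid (mminus i c k) k.
Proof.
case: k => //= k ck n1; rewrite mminusE eqxx xpair_eqE [ord_pred i == _]ord_pred_neq //.
by rewrite andbF subn0 addn1.
Qed.

Lemma mp_mminus c k : 0 < c (k, i) -> mp (mminus i c k) k = c.
Proof.
move=> ck; apply/msetP=> x; rewrite mpE mminusE.
have le : (x == (k, i)) <= c x by case: eqP => // ->.
case: k ck le => [|k] ck le; first by rewrite addn0 subn0 subnK.
by rewrite subnK ?addnK // (leq_trans le) ?leq_addr.
Qed.

Lemma mp_self b k : 1 < n -> mp b k (k, i) = (b (k, i)).+1.
Proof.
move=> n1; rewrite mpE eqxx addn1; case: (k) => [|k']; rewrite ?subn0 //.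
by rewrite xpair_eqE [i == _]eq_sym ord_pred_neq // andbF subn0.
Qed.

Lemma valid_lbound b k : valid b k -> k < lbound b.
Proof.
case: k => //= k; rewrite -count_mem_mset -has_count has_pred1 ltnS => kb.
by rewrite (big_rem _ kb) /= leq_maxl.
Qed.

End Moves.

(** * Evaluating integer polynomials *)

Section IntPoly.
Variables (K : fieldType) (x : K).
Implicit Types p q : {poly int}.

Lemma gintpolyE p : gintpoly p x = (map_poly (intr : int -> K) p).[x].
Proof. by []. Qed.

Lemma gintpolyD p q : gintpoly (p + q) x = gintpoly p x + gintpoly q x.
Proof. by rewrite !gintpolyE rmorphD hornerD. Qed.

Lemma gintpolyN p : gintpoly (- p) x = - gintpoly p x.
Proof. by rewrite !gintpolyE rmorphN hornerN. Qed.

Lemma gintpolyM p q : gintpoly (p * q) x = gintpoly p x * gintpoly q x.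
Proof. by rewrite !gintpolyE rmorphM hornerM. Qed.

Lemma gintpolyC (a : int) : gintpoly a%:P x = a%:~R.
Proof. by rewrite gintpolyE map_polyC hornerC. Qed.

Lemma gintpolyXn m : gintpoly 'X^m x = x ^+ m.
Proof. by rewrite gintpolyE map_polyXn hornerXn. Qed.

Lemma gintpolyX : gintpoly 'X x = x.
Proof. by rewrite gintpolyE map_polyX hornerX. Qed.

Lemma gintpoly_sum (I : Type) (r : seq I) (P : pred I) (F : I -> {poly int}) :
  gintpoly (\sum_(j <- r | P j) F j) x = \sum_(j <- r | P j) gintpoly (F j) x.
Proof.
apply: (big_morph (fun p => gintpoly p x)) => [p q|]; first exact: gintpolyD.
by rewrite -[0]/(0%:P) gintpolyC.
Qed.

End IntPoly.

(** * Linear maps given on the PBW basis *)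

Section LinearExt.
Variables (K : fieldType) (v : K) (T : choiceType) (pe : T -> int).
Local Notation H := {malg K[T]}.
Local Notation pbw := (gpbw v pe).
Local Notation pbwc := (gpbwc v pe).
Hypothesis v_neq0 : v != 0.

Lemma gpbwU (m : T) : pbw m = << v ^ pe m *g m >>.
Proof. by apply/malgP => k; rewrite mcoeffZ !mcoeffU mulr_natr; case: eqP. Qed.

Lemma vexp_neq0 (z : int) : v ^ z != 0.
Proof. by rewrite expfz_neq0 ?v_neq0. Qed.

Lemma msupp_gpbw (m : T) : msupp (pbw m) = [fset m]%fset.
Proof. by rewrite gpbwU msuppU (negbTE (vexp_neq0 _)). Qed.

Lemma gpbwcE (x : H) m : pbwc x m = x@_m / v ^ pe m.
Proof. by rewrite /gpbwc invr_expz. Qed.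

Lemma gpbwc_pbw (m m' : T) : pbwc (pbw m) m' = (m == m')%:R.
Proof.
rewrite gpbwcE gpbwU mcoeffU; case: eqP => [->|_]; last by rewrite mul0r.
by rewrite divff ?vexp_neq0.
Qed.

Lemma gpbwcD (x y : H) m : pbwc (x + y) m = pbwc x m + pbwc y m.
Proof. by rewrite !gpbwcE mcoeffD mulrDl. Qed.

Lemma gpbwcZ a (x : H) m : pbwc (a *: x) m = a * pbwc x m.
Proof. by rewrite !gpbwcE mcoeffZ mulrA. Qed.

Lemma gpbwc0 m : pbwc (0 : H) m = 0.
Proof. by rewrite gpbwcE mcoeff0 mul0r. Qed.

Lemma gpbwc_sum (I : Type) (r : seq I) (P : pred I) (g : I -> H) m :
  pbwc (\sum_(j <- r | P j) g j) m = \sum_(j <- r | P j) pbwc (g j) m.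
Proof. by apply: (big_morph (fun x => pbwc x m)) => [x y|]; rewrite ?gpbwcD ?gpbwc0. Qed.

Lemma gpbwc_inj (x y : H) : (forall m, pbwc x m = pbwc y m) -> x = y.
Proof.
move=> E; apply/malgP => m; have := E m; rewrite !gpbwcE.
by move/(mulIf (invr_neq0 (vexp_neq0 _))).
Qed.

Lemma gpbwc_eq0 (x : H) m : m \notin msupp x -> pbwc x m = 0.
Proof. by move=> ms; rewrite gpbwcE mcoeff_outdom ?mul0r. Qed.

Lemma gpbw_expand (x : H) (d : {fset T}) : (msupp x `<=` d)%fset ->
  x = \sum_(m <- d) pbwc x m *: pbw m.
Proof.
move=> sd; apply: gpbwc_inj => m; rewrite gpbwc_sum.
under eq_bigr => j _ do rewrite gpbwcZ gpbwc_pbw.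
have [ms|ms] := boolP (m \in msupp x).
  rewrite (big_fsetD1 m) ?(fsubsetP sd) //= eqxx mulr1 big1_fset ?addr0 // => j.
  by rewrite !inE => /andP[/negbTE-> _] _; rewrite mulr0.
rewrite gpbwc_eq0 // big1_fset // => j _ _; have [->|] := eqVneq j m; last by rewrite mulr0.
by rewrite gpbwc_eq0 ?mul0r.
Qed.

Definition linext (g : T -> H) (x : H) : H := \sum_(m <- msupp x) pbwc x m *: g m.

Lemma linextE g (x : H) (d : {fset T}) : (msupp x `<=` d)%fset ->
  linext g x = \sum_(m <- d) pbwc x m *: g m.
Proof.
move=> sd; rewrite /linext (big_fset_incl _ sd) // => m _ ms.
by rewrite gpbwc_eq0 ?scale0r.
Qed.

Lemma linext_pbw g m : linext g (pbw m) = g m.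
Proof. by rewrite /linext msupp_gpbw big_seq_fset1 gpbwc_pbw eqxx scale1r. Qed.

Fact linext_is_linear g : linear (linext g).
Proof.
move=> a x y; pose d := (msupp x `|` msupp y)%fset.
have sx : (msupp x `<=` d)%fset by apply: fsubsetUl.
have sy : (msupp y `<=` d)%fset by apply: fsubsetUr.
have sxy : (msupp (a *: x + y) `<=` d)%fset.
  apply: fsubset_trans (msuppD_le _ _) _; apply: fsetSU; exact: msuppZ_le.
rewrite !(@linextE g _ d) // scaler_sumr -big_split; apply: eq_bigr => m _ /=.
by rewrite gpbwcD gpbwcZ scalerDl scalerA.
Qed.
HB.instance Definition _ g := GRing.isLinear.Build K H H _ (linext g) (linext_is_linear g).

Lemma mcoeff_sumU (s : seq T) (F : T -> K) c : uniq s ->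
  (\sum_(j <- s) F j *: << j >> : H)@_c = if c \in s then F c else 0.
Proof.
move=> us; rewrite raddf_sum /=; under eq_bigr => j _ do rewrite mcoeffZ mcoeffU mulr_natr.
case: ifP => [cd|cd].
  rewrite (bigD1_seq c) //= eqxx mulr1n big1 ?addr0 // => j /negbTE->.
  by rewrite mulr0n.
rewrite big1_seq // => j /andP[_ jd]; have [E|] := eqVneq j c; last by rewrite mulr0n.
by rewrite E cd in jd.
Qed.

Variable um : T -> T -> H.

Lemma hmul_pbw (a b : T) : ghmul um (pbw a) (pbw b) = v ^ (pe a + pe b) *: um a b.
Proof.
rewrite /ghmul !msupp_gpbw !big_seq_fset1 !gpbwU !mcoeffUU.
by rewrite expfzDr ?v_neq0.
Qed.

Lemma hmul_pbwE (a : T) (x : H) : ghmul um (pbw a) x = linext (fun b => ghmul um (pbw a) (pbw b)) x.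
Proof.
rewrite /linext {1}/ghmul msupp_gpbw big_seq_fset1; apply: eq_bigr => b _.
rewrite hmul_pbw scalerA; congr (_ *: _); rewrite gpbwU mcoeffUU gpbwcE expfzDr ?v_neq0 //.
by rewrite mulrCA divfK ?vexp_neq0 // mulrC.
Qed.

Lemma mcoeff_sum_pbw D (F : nat -> K) (g : nat -> T) c :
  (\sum_(k < D) F k *: pbw (g k))@_c = \sum_(k < D) F k * (v ^ pe c *+ (g k == c)).
Proof.
rewrite raddf_sum /=; apply: eq_bigr => k _.
by rewrite mcoeffZ gpbwU mcoeffU; case: eqP => [->|]; rewrite ?mulr0n.
Qed.

Lemma ghmul_pbw_coef a b c :
  (ghmul um (pbw a) (pbw b))@_c = v ^ (pe a + pe b) * (um a b)@_c.
Proof. by rewrite hmul_pbw mcoeffZ. Qed.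

End LinearExt.

(** * Coefficients of f_i on a PBW element *)

Section Hop.
Variables (K : fieldType) (v : K) (n : nat) (i : 'I_n) (pe : mseg n -> int).
Hypothesis n_gt1 : (1 < n)%N.
Hypothesis v_neq0 : v != 0.
Hypothesis pe_mseg1 : pe (mseg1 1 i) = 0.
Hypothesis pe_mminus : forall (c : mseg n) k, (0 < c (k, i))%N -> let b := mminus i c k in
  pe b - pe c + (mform (Defs.dimv (mseg1 1 i)) (Defs.dimv b))%:Z
   - 2 * (nheads i c k.+1 + (c (k, i) - 1))%:Z = Ssum b k.+1 i.
Local Notation pbw := (gpbw v pe).
Local Notation mp := (mp i).
Local Notation mminus := (mminus i).

Lemma mem_ms_of_dim (d : {ffun 'I_n -> nat}) c : (c \in ms_of_dim d) = (Defs.dimv c == d).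
Proof.
rewrite /ms_of_dim mem_filter; case: eqP => // dc; rewrite andTb mem_undup.
set D := (\sum_j d j)%N.
(* [D] is the total number of basis vectors, so it bounds both the number of segments and their
   lengths. *)
have szD : size (sdat (enum_mset c)) = D.
  rewrite /D -dc; under eq_bigr => j _ do rewrite ffunE bvertE count_map.
  rewrite -sum1_size; under [RHS]eq_bigr => j _ do rewrite -sum1_count big_mkcond.
  rewrite exchange_big; apply: eq_bigr => x _ /=.
  pose jx : 'I_n := iter x.2 (@ord_pred n) x.1.2.
  rewrite (bigD1 jx) //= big1 ?addn0 => [|j ne]; first by rewrite eqxx.
  by case: eqP => // E; case/eqP: ne; apply: val_inj; apply: esym E.
rewrite size_sdat in szD.
have lts s : s \in enum_mset c -> (s.1 < D)%N.
  by move=> sc; rewrite -szD (big_rem s) //= leq_addr.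
have szc : (size (enum_mset c) < D.+1)%N.
  by rewrite ltnS -szD -sum1_size; apply: leq_sum => s _.
apply/flattenP; set k := size (enum_mset c) in szc.
exists [seq seq_mset [seq (val p.1, p.2) | p <- tval t] | t <- enum {: k.-tuple ('I_D * 'I_n)}].
  by apply/mapP; exists k; rewrite ?mem_iota.
(* A default element of ['I_D] is available only for positive [D]. *)
have [|D0] := posnP D; last first.
  pose tt := [tuple (Ordinal (D0), (nth ((0%N, i)) (enum_mset c) j).2) | j < k].
  pose t := [tuple (insubd (Ordinal D0) (nth (0%N, i) (enum_mset c) j).1,
                    (nth (0%N, i) (enum_mset c) j).2) | j < k].
  apply/mapP; exists t; first by rewrite mem_enum.
  rewrite -[LHS]seq_mset_id; congr seq_mset.
  apply: (@eq_from_nth _ (0%N, i)); first by rewrite size_map size_tuple.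
  move=> j ltj; rewrite (nth_map (Ordinal D0, i)) ?size_tuple //.
  have -> : nth (Ordinal D0, i) t j = tnth t (Ordinal ltj) by rewrite (tnth_nth (Ordinal D0, i)).
  rewrite tnth_mktuple /= val_insubd lts ?mem_nth //.
  by case: (nth _ _ _).
move=> D0; have E0 : enum_mset c = [::].
  by case E: (enum_mset c) lts => [|s L] // /(_ s (mem_head _ _)); rewrite D0.
have k0 : k = 0%N by rewrite /k E0.
rewrite k0; apply/mapP; exists [tuple]; first by rewrite mem_enum.
by rewrite -[LHS]seq_mset_id E0.
Qed.

Lemma umul_coef (a b c : mseg n) : (gumul v a b)@_c =
  v ^+ (mform (Defs.dimv a) (Defs.dimv b)) *
  if Defs.dimv c == [ffun j => (Defs.dimv a j + Defs.dimv b j)%N]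
  then gintpoly (hall_poly a b c) (v ^- 2) else 0.
Proof.
rewrite /gumul mcoeffZ; congr (_ * _); rewrite mcoeff_sumU -?mem_ms_of_dim //.
by rewrite filter_uniq ?undup_uniq.
Qed.

(** This is v^(a-1) [a] for positive [a], see [gqintS]; unlike [a] it is regular at v = 0, with
    value 1. *)
Definition qn (a : nat) : K := \sum_(r < a) v ^+ (2 * r).
Definition fcoef (b : mseg n) k : K :=
  if valid i b k then v ^ (Ssum b k.+1 i) * qn (b (k, i)).+1 else 0.

(** Coefficients at [c] are compared: [b] and [c] determine the index of the move by [mminus_inj],
    so at most one summand contributes. *)
Lemma fop_pbw (b : mseg n) D : (lbound b <= D)%N ->
  ghmul (@gumul _ v n) (pbw (mseg1 1 i)) (pbw b) = \sum_(k < D) fcoef b k *: pbw (mp b k).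
Proof.
move=> leD; apply/malgP => c; rewrite ghmul_pbw_coef // umul_coef mcoeff_sum_pbw //.
have dimc k : (0 < c (k, i))%N -> b = mminus c k ->
    Defs.dimv c = [ffun j => (Defs.dimv (mseg1 1 i) j + Defs.dimv b j)%N].
  by move=> ck ->; apply/ffunP => j; rewrite [RHS]ffunE (dimv_mminus _ ck) dimv_mseg1 addnC.
case: (classic (exists k, (0 < c (k, i))%N /\ b = mminus c k)) => [[k [ck Eb]]|nex]; last first.
  rewrite hall_poly_mseg1_eq0 => [|k ck Eb]; last by apply: nex; exists k.
  rewrite /gintpoly map_poly0 horner0 if_same !mulr0 big1 // => k _.
  rewrite /fcoef; case: ifP => [vb|]; last by rewrite mul0r.
  case: eqP => [E|]; last by rewrite mulr0.
  by case: nex; exists (nat_of_ord k); rewrite -E mp_self // mminus_mp.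
have vb : valid i b k by rewrite Eb valid_mminus.
have ltkD : (k < D)%N := leq_trans (valid_lbound vb) leD.
rewrite (bigD1 (Ordinal ltkD)) //= big1 ?addr0; last first.
  move=> k' ne; rewrite /fcoef; case: ifP => [vb'|]; last by rewrite mul0r.
  case: eqP => [E|]; last by rewrite mulr0.
  case/eqP: ne; apply: val_inj => /=; apply: (@mminus_inj n i c); rewrite // -?Eb.
    by rewrite -E mp_self.
  by rewrite -{1}E mminus_mp.
have Emp : mp b k = c by rewrite Eb mp_mminus.
have Eh : hall_poly (mseg1 1 i) b c = \sum_(r < c (k, i)) 'X^(nheads i c k.+1 + r).
  by rewrite Eb hall_poly_mseg1.
have Ec : c (k, i) = (b (k, i)).+1 by rewrite Eb mminus_self // subn1 prednK.
rewrite (dimc k ck Eb) eqxx Emp eqxx mulr1n Eh /fcoef vb pe_mseg1 add0r.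
set A := nheads i c k.+1; set x := b (k, i).
(* Reversing the sum pulls out the lowest power of v and leaves [qn]. *)
have -> : gintpoly (\sum_(r < c (k, i)) 'X^(A + r)) (v ^- 2) = v ^ (- (2 * (A + x))%:Z) * qn x.+1.
  rewrite gintpoly_sum Ec (reindex_inj rev_ord_inj) mulr_sumr.
  apply: eq_bigr => r _; rewrite gintpolyXn /= exprVn -exprM exprnN exprnP -expfzDr //.
  by congr (_ ^ _); have := ltn_ord r; rewrite -/x; lia.
rewrite mulrA [RHS]mulrAC mulrA; congr (_ * _); rewrite exprnP -!expfzDr //; congr (_ ^ _).
by have := pe_mminus ck; rewrite -Eb /= -/A Ec -/x; lia.
Qed.

End Hop.

(** * Modules over the q-boson algebra *)

Section QNumbers.
Variables (K : fieldType) (v : K).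
Hypothesis v_trans : forall p : {poly int}, gintpoly p v = 0 -> p = 0.

Lemma vv_neq0 : v != 0.
Proof.
apply/eqP => v0; have /v_trans/eqP : gintpoly 'X v = 0 by rewrite gintpolyX.
by rewrite polyX_eq0.
Qed.
Local Notation v_neq0 := vv_neq0.

Lemma vXn_neq1 m : (0 < m)%N -> 1 - v ^+ m != 0.
Proof.
move=> m0; apply/eqP => E.
have /v_trans/(congr1 (fun p : {poly int} => p`_m)) : gintpoly (1%:P - 'X^m) v = 0.
  by rewrite gintpolyD gintpolyN gintpolyXn gintpolyC.
by rewrite coefB coefXn eqxx coefC coef0 gtn_eqF.
Qed.

Lemma qn0 : qn v 0 = 0.
Proof. exact: big_ord0. Qed.

Lemma qnS a : qn v a.+1 = qn v a + v ^+ (2 * a).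
Proof. by rewrite /qn big_ord_recr. Qed.

Lemma qn_mul a : qn v a * (1 - v ^+ 2) = 1 - v ^+ (2 * a).
Proof.
elim: a => [|a IH]; first by rewrite /qn big_ord0 muln0 expr0 subrr mul0r.
by rewrite qnS mulrDl IH mulnS exprD; ring.
Qed.

Lemma qn_neq0 a : (0 < a)%N -> qn v a != 0.
Proof.
move=> a0; have := vXn_neq1 (m := 2 * a); rewrite muln_gt0 /= => /(_ a0).
by rewrite -qn_mul mulf_eq0 negb_or => /andP[].
Qed.

Lemma qnD a b : qn v (a + b) = qn v a + v ^+ (2 * a) * qn v b.
Proof.
have nz : 1 - v ^+ 2 != 0 by apply: vXn_neq1.
by apply: (mulIf nz); rewrite mulrDl !qn_mul -mulrA qn_mul mulnDr exprD; ring.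
Qed.

Lemma gqintS a : gqint v a.+1 = v ^- a * qn v a.+1.
Proof.
have nz : 1 - v ^+ 2 != 0 by apply: vXn_neq1.
have vn := expf_neq0 a v_neq0.
have vn1 : v ^+ a.+1 != 0 by rewrite expf_neq0 // v_neq0.
have nz' : v - v^-1 != 0.
  have -> : v - v^-1 = - v^-1 * (1 - v ^+ 2) by field; exact: v_neq0.
  by rewrite mulf_neq0 ?oppr_eq0 ?invr_eq0 ?v_neq0.
apply: (mulIf nz); rewrite -[v ^- a * _ * _]mulrA qn_mul /gqint mulnC exprM.
apply: (mulIf nz'); rewrite mulrAC divfK // exprS.
by field; rewrite vn v_neq0.
Qed.

Lemma gqint_neq0 a : gqint v a.+1 != 0.
Proof. by rewrite gqintS mulf_neq0 ?qn_neq0 // invr_eq0 expf_neq0 // v_neq0. Qed.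

Lemma gqfactS a : gqfact v a.+1 = gqint v a.+1 * gqfact v a.
Proof. by rewrite /gqfact big_nat_recr //= mulrC. Qed.

Lemma gqfact0 : gqfact v 0 = 1.
Proof. by rewrite /gqfact big_geq. Qed.

Lemma gqfact_neq0 a : gqfact v a != 0.
Proof. by elim: a => [|a IH]; rewrite ?gqfact0 ?oner_neq0 // gqfactS mulf_neq0 ?gqint_neq0. Qed.

Lemma gqintD a b : gqint v (a + b) = gqint v a * v ^+ b + v ^- a * gqint v b.
Proof.
have vn := expf_neq0 a v_neq0; have vn' := expf_neq0 b v_neq0.
rewrite /gqint mulrAC mulrA -mulrDl; congr (_ / _); rewrite exprD.
by field; rewrite vn vn'.
Qed.

End QNumbers.

(** * Divided powers and components *)

Section QBosonModule.
Variables (K : fieldType) (v : K) (V : lmodType K).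
Hypothesis v_trans : forall p : {poly int}, gintpoly p v = 0 -> p = 0.
Variables f e : {linear V -> V}.
Hypothesis boson : forall x, e (f x) = v ^- 2 *: f (e x) + x.
Let v_neq0 : v != 0 := vv_neq0 v_trans.

Definition dpow k x : V := (gqfact v k)^-1 *: iter k f x.

Fact iter_is_linear (g : {linear V -> V}) k : linear (iter k g).
Proof. by elim: k => [//|k IH] a x y /=; rewrite IH linearP. Qed.

Lemma dpowP k a x y : dpow k (a *: x + y) = a *: dpow k x + dpow k y.
Proof. by rewrite /dpow iter_is_linear scalerDr !scalerA mulrC. Qed.

Lemma dpowD k x y : dpow k (x + y) = dpow k x + dpow k y.
Proof. by rewrite -[x]scale1r dpowP !scale1r. Qed.

Lemma dpow0r k : dpow k 0 = 0.
Proof. by have := dpowD k 0 0; rewrite addr0 -[LHS]addr0 => /addrI. Qed.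

Lemma dpowZ k a x : dpow k (a *: x) = a *: dpow k x.
Proof. by rewrite -[a *: x]addr0 dpowP dpow0r addr0. Qed.

Lemma dpowB k x y : dpow k (x - y) = dpow k x - dpow k y.
Proof. by rewrite -scaleN1r dpowD dpowZ scaleN1r. Qed.

Lemma dpow0 x : dpow 0 x = x.
Proof. by rewrite /dpow gqfact0 invr1 scale1r. Qed.

Lemma f_dpow k x : f (dpow k x) = gqint v k.+1 *: dpow k.+1 x.
Proof.
rewrite /dpow linearZ /= scalerA gqfactS invfM mulrA divff ?mul1r //.
exact: gqint_neq0.
Qed.

(** The induction step is v^-2 v^-k [k+1] + 1 = v^-(k+1) [k+2]. *)
Lemma e_iter_f k w : e w = 0 -> e (iter k.+1 f w) = (v ^- k * gqint v k.+1) *: iter k f w.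
Proof.
move=> ew; elim: k => [|k IH].
  by rewrite /= boson ew linear0 scaler0 add0r expr0 invr1 mul1r gqintS // expr0 invr1 mul1r
    /qn big_ord1 muln0 expr0 scale1r.
rewrite [iter k.+2 f w]/= boson -/(iter k.+1 f w) IH linearZ /= scalerA -{2}[f (iter k f w)]scale1r -scalerDl.
congr (_ *: _); rewrite !gqintS // [qn v k.+2]qnS mulnC exprM.
have v1 := expf_neq0 k v_neq0; rewrite !exprS; field.
by rewrite v1 v_neq0.
Qed.

Lemma e_dpow k w : e w = 0 -> e (dpow k.+1 w) = v ^- k *: dpow k w.
Proof.
move=> ew; rewrite /dpow linearZ /= -/(iter k.+1 f w) e_iter_f // !scalerA; congr (_ *: _).
rewrite gqfactS invfM; have := gqint_neq0 v_trans k; have := gqfact_neq0 v_trans k.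
move: (gqint _ _) (gqfact _ _) => a b b0 a0.
have v1 := expf_neq0 k v_neq0; field; by rewrite v1 a0 b0.
Qed.

(** The scalar v^(-k(k-1)/2) by which e^k f^(k) acts on the kernel of [e], see [iter_e_dpow]; it is
    a unit of Z[v, v^-1]. *)
Definition ccoef k : K := \prod_(j < k) v ^- j.
Lemma ccoef_neq0 k : ccoef k != 0.
Proof. by apply/prodf_neq0 => j _; rewrite invr_eq0 expf_neq0. Qed.

Lemma iterZ (g : {linear V -> V}) k a x : iter k g (a *: x) = a *: iter k g x.
Proof. by elim: k => //= k ->; rewrite linearZ. Qed.

Lemma iterD (g : {linear V -> V}) k x y : iter k g (x + y) = iter k g x + iter k g y.
Proof. by elim: k => //= k ->; rewrite linearD. Qed.

Lemma iter_sum (g : {linear V -> V}) k (I : Type) (r : seq I) (P : pred I) (h : I -> V) :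
  iter k g (\sum_(j <- r | P j) h j) = \sum_(j <- r | P j) iter k g (h j).
Proof. by elim: k => //= k ->; rewrite linear_sum. Qed.

Lemma iter_e_dpow k w : e w = 0 -> iter k e (dpow k w) = ccoef k *: w.
Proof.
move=> ew; elim: k => [|k IH]; first by rewrite /= dpow0 /ccoef big_ord0 scale1r.
by rewrite iterSr e_dpow // iterZ IH scalerA /ccoef big_ord_recr mulrC.
Qed.

Lemma iter_e_dpow0 k j w : e w = 0 -> (k < j)%N -> iter j e (dpow k w) = 0.
Proof.
move=> ew lt; rewrite -(subnK lt) ssrnat.iterD /= iter_e_dpow // linearZ /= ew scaler0.
by elim: (_ - _)%N => //= d ->; rewrite linear0.
Qed.

Definition lau (a : K) : Prop := exists N (p : {poly int}), v ^+ N * a = gintpoly p v.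

Lemma lau_poly p : lau (gintpoly p v).
Proof. by exists 0%N, p; rewrite mul1r. Qed.

Lemma lauD a b : lau a -> lau b -> lau (a + b).
Proof.
move=> [N [p Ep]] [M [q Eq]]; exists (N + M)%N, ('X^M * p + 'X^N * q).
by rewrite gintpolyD !gintpolyM !gintpolyXn -Ep -Eq exprD; ring.
Qed.

Lemma lauM a b : lau a -> lau b -> lau (a * b).
Proof.
move=> [N [p Ep]] [M [q Eq]]; exists (N + M)%N, (p * q).
by rewrite gintpolyM -Ep -Eq exprD; ring.
Qed.

Lemma lau_vz (z : int) : lau (v ^ z).
Proof.
case: z => N; first by exists 0%N, 'X^N; rewrite gintpolyXn mul1r.
by exists N.+1, 1%:P; rewrite gintpolyC NegzE -exprnN divff // expf_neq0.
Qed.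

Lemma lau0 : lau 0.
Proof. by exists 0%N, 0%:P; rewrite mulr0 gintpolyC. Qed.

Lemma lau1 : lau 1.
Proof. by exists 0%N, 1%:P; rewrite mulr1 gintpolyC. Qed.

(** The top component is a power of [e] applied to [x], up to the unit [ccoef]; subtracting its
    divided power lowers the nilpotency order. *)
Lemma dpow_decomp N x : iter N e x = 0 ->
  exists xs : seq V, [/\ size xs = N, x = \sum_(k < N) dpow k (nth 0 xs k) & forall k, e (nth 0 xs k) = 0].
Proof.
elim: N x => [|N IH] x /= ex.
  by exists [::]; rewrite big_ord0; split=> // k; rewrite nth_nil linear0.
pose w := (ccoef N)^-1 *: iter N e x.
have ew : e w = 0 by rewrite linearZ /= ex scaler0.
have [|xs [sz Ex exs]] := IH (x - dpow N w).
  rewrite -scaleN1r iterD iterZ iter_e_dpow // [ccoef N *: _]scalerA mulfV ?ccoef_neq0 // scale1r.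
  by rewrite scaleN1r subrr.
exists (rcons xs w); split; first by rewrite size_rcons sz.
  rewrite big_ord_recr /= nth_rcons sz ltnn eqxx.
  rewrite -[LHS](subrK (dpow N w)) {1}Ex; congr (_ + _); apply: eq_bigr => k _.
  by rewrite nth_rcons sz ltn_ord.
by move=> k; rewrite nth_rcons; case: ifP => // _; case: ifP => // _; rewrite linear0.
Qed.

Section Integral.
Variable Hz : V -> Prop.
Hypothesis HzP : forall a x y, lau a -> Hz x -> Hz y -> Hz (a *: x + y).
Hypothesis Hz_e : forall x, Hz x -> Hz (e x).
Hypothesis Hz_dpow : forall k x, Hz x -> Hz (dpow k x).
Hypothesis Hz0 : Hz 0.

(** The components are extracted from the top down by powers of [e] and division by the units
    [ccoef], which never leaves [Hz]. For the Z[v, v^-1]-form this is integrality, for the zero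
    space it is uniqueness. *)
Lemma dpow_decomp_integral N x (w : nat -> V) :
  Hz x -> x = \sum_(k < N) dpow k (w k) -> (forall k, e (w k) = 0) ->
  forall k, (k < N)%N -> Hz (w k).
Proof.
elim: N x => // N IH x Hx; rewrite big_ord_recr /= => Ex ew k; rewrite ltnS => lek.
have HwN : Hz (w N).
  have E : iter N e x = ccoef N *: w N.
    rewrite Ex iterD iter_sum big1 ?add0r ?iter_e_dpow // => j _.
    by rewrite iter_e_dpow0.
  have -> : w N = (ccoef N)^-1 *: iter N e x + 0.
    by rewrite addr0 E scalerA mulVf ?ccoef_neq0 // scale1r.
  apply: HzP => //; last by elim: (N) => //= d; apply: Hz_e.
  rewrite /ccoef -prodfV; elim/big_ind: _ => [||j _]; [exact: lau1|exact: lauM|].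
  by rewrite invrK exprnP; apply: lau_vz.
case: (ltngtP k N) lek => // [lt|->] _ //.
apply: (IH (x - dpow N (w N))) => //; last by rewrite Ex addrK.
rewrite -scaleN1r addrC; apply: HzP => //; last exact: Hz_dpow.
by exists 0%N, (-1)%:P; rewrite gintpolyC mul1r rmorphN1.
Qed.

End Integral.

Section Orthogonality.
Variable form : V -> V -> K.
Hypothesis formC : forall x y, form x y = form y x.
Hypothesis formP : forall x a y z, form x (a *: y + z) = a * form x y + form x z.
Hypothesis form_adj : forall x y, form (f x) y = form x (e y).

Lemma qform0r x : form x 0 = 0.
Proof. by have := formP x 1 0 0; rewrite scale1r addr0 mul1r -[LHS]addr0 => /addrI. Qed.

Lemma qformZr x a y : form x (a *: y) = a * form x y.
Proof. by rewrite -[a *: y]addr0 formP qform0r addr0. Qed.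

Lemma qformZl x a y : form (a *: x) y = a * form x y.
Proof. by rewrite !(formC _ y) qformZr. Qed.

Lemma qform_sumr (I : Type) (r : seq I) P (g : I -> V) x :
  form x (\sum_(j <- r | P j) g j) = \sum_(j <- r | P j) form x (g j).
Proof.
apply: (big_morph (form x)) => [y z|]; last exact: qform0r.
by rewrite -[y]scale1r formP mul1r scale1r.
Qed.

(** One [f] at a time is moved across the form as [e], until [e] meets the kernel vector. *)
Lemma form_dpow_neq j k x y : e x = 0 -> e y = 0 -> (j < k)%N -> form (dpow j x) (dpow k y) = 0.
Proof.
move=> ex ey; elim: j k => [|j IH] [|k] // lt.
  rewrite dpow0 formC.
  have -> : dpow k.+1 y = (gqint v k.+1)^-1 *: f (dpow k y).
    by rewrite f_dpow scalerA mulVf ?scale1r // gqint_neq0.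
  by rewrite qformZl form_adj ex qform0r mulr0.
rewrite formC.
have -> : dpow k.+1 y = (gqint v k.+1)^-1 *: f (dpow k y).
  by rewrite f_dpow scalerA mulVf ?scale1r // gqint_neq0.
by rewrite qformZl form_adj e_dpow // qformZr formC IH // !mulr0.
Qed.

(** The factor by which f^(k) changes the form on the kernel of [e]; the step from k to k+1
    contributes v^-k / [k+1] = 1 / (1 + v^2 + ... + v^(2k)). *)
Definition ucoef k : K := \prod_(j < k) (qn v j.+1)^-1.

Lemma form_dpow_eq k x y : e x = 0 -> e y = 0 -> form (dpow k x) (dpow k y) = ucoef k * form x y.
Proof.
move=> ex ey; elim: k => [|k IH]; first by rewrite !dpow0 /ucoef big_ord0 mul1r.
have -> : dpow k.+1 x = (gqint v k.+1)^-1 *: f (dpow k x).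
  by rewrite f_dpow scalerA mulVf ?scale1r // gqint_neq0.
rewrite qformZl form_adj e_dpow // qformZr IH /ucoef big_ord_recr /= gqintS //.
have v1 := expf_neq0 k v_neq0; have v2 := qn_neq0 v_trans (ltn0Sn k).
by move: (\prod_(_ < _) _) => u; field; rewrite v1 v2.
Qed.

Lemma form_decomp N (w : nat -> V) : (forall k, e (w k) = 0) ->
  form (\sum_(k < N) dpow k (w k)) (\sum_(k < N) dpow k (w k)) =
  \sum_(k < N) ucoef k * form (w k) (w k).
Proof.
move=> ew; rewrite qform_sumr; apply: eq_bigr => k _.
rewrite formC qform_sumr (bigD1 k) //= big1 ?addr0 ?form_dpow_eq // => j jk.
have := jk; rewrite -val_eqE /= neq_ltn => /orP[lt|lt]; last exact: form_dpow_neq.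
by rewrite formC form_dpow_neq.
Qed.

End Orthogonality.
End QBosonModule.

(** * The q-binomial theorem *)

Section QBinomial.
Variables (K : fieldType) (v : K) (V : lmodType K).
Hypothesis v_trans : forall p : {poly int}, gintpoly p v = 0 -> p = 0.
Let v_neq0 : v != 0 := vv_neq0 v_trans.

(** The Gaussian binomial coefficient of a + j over j in the variable v^2. *)
Definition gauss a j : K := \prod_(t < j) (qn v (a + t).+1 / qn v t.+1).

(** The q-Pascal rule, which makes these quotients integral in [lau_gauss]. *)
Lemma gaussS a j : gauss a.+1 j.+1 = gauss a j.+1 + v ^+ (2 * a.+1) * gauss a.+1 j.
Proof.
have E : gauss a j.+1 = gauss a.+1 j * (qn v a.+1 / qn v j.+1).
  rewrite /gauss !big_split /= big_ord_recl [X in _ * X]big_ord_recr /= addn0.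
  rewrite [X in _ = _ * X * _](eq_bigr (fun t : 'I_j => (qn v t.+1)^-1)) //.
  rewrite (eq_bigr (fun t : 'I_j => qn v (a.+1 + t).+1)) => [|t _]; last first.
    by rewrite /bump /= add1n addSnnS.
  by ring.
rewrite E {1}/gauss big_ord_recr /= -/(gauss a.+1 j).
have q0 := qn_neq0 v_trans (ltn0Sn j).
have -> : qn v (a.+1 + j).+1 = qn v a.+1 + v ^+ (2 * a.+1) * qn v j.+1.
  by rewrite -addnS (qnD v_trans).
by field.
Qed.

Lemma lau_gauss a j : lau v (gauss a j).
Proof.
elim: a j => [|a IHa] j; last first.
  elim: j => [|j IHj]; first by rewrite /gauss big_ord0; apply: lau1.
  rewrite gaussS; apply: lauD => //; apply: lauM => //; rewrite exprnP; exact: lau_vz.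
rewrite /gauss big1 => [|t _]; first exact: lau1.
by rewrite add0n divff // qn_neq0.
Qed.

Lemma gqfactE j : exists z : int, gqfact v j = v ^ z * \prod_(t < j) qn v t.+1.
Proof.
elim: j => [|j [z E]]; first by exists 0; rewrite gqfact0 big_ord0 mulr1.
exists (z - j%:Z); rewrite gqfactS gqintS // E big_ord_recr /= exprnN expfzDr //; ring.
Qed.

Variables A B C : {linear V -> V}.
Hypothesis CE : forall x, C x = A x + B x.
Hypothesis AB : forall x, A (B x) = v ^- 2 *: B (A x).

Lemma A_dpow j x : A (dpow v B j x) = v ^- (2 * j) *: dpow v B j (A x).
Proof.
rewrite /dpow linearZ /= !scalerA mulrC -scalerA; congr (_ *: _).
elim: j => [|j IH]; first by rewrite muln0 expr0 invr1 scale1r.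
by rewrite iterS AB IH linearZ /= scalerA -invfM -exprD mulnS.
Qed.

(* The q-binomial theorem for [v^-2]-commuting operators, in divided power form. *)
Lemma dpow_add n x :
  dpow v C n x = \sum_(j < n.+1) v ^- (j * (n - j)) *: dpow v B j (dpow v A (n - j) x).
Proof.
elim: n => [|n IH]; first by rewrite big_ord1 !dpow0 mul0n expr0 invr1 scale1r.
have q0 := gqint_neq0 v_trans n.
apply: (scalerI q0); rewrite -(f_dpow v_trans) IH linear_sum.
(* [al j] is what [B] contributes from the term of index j - 1, and [be j] what [A] contributes from
   the term of index j; they add up by [j + k] = [j] v^k + v^-j [k] with j + k = n + 1. *)
pose W j := dpow v B j (dpow v A (n.+1 - j) x).
pose al j := if j is j'.+1 then v ^- (j' * (n - j')) * gqint v j else 0.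
pose be j := v ^- (j * (n - j)) * v ^- (2 * j) * gqint v (n.+1 - j).
have qint0 : gqint v 0 = 0 by rewrite /gqint expr0 invr1 subrr mul0r.
transitivity (\sum_(j < n.+1) (al j.+1 *: W j.+1 + be j *: W j)).
  apply: eq_bigr => j _; rewrite linearZ /= CE A_dpow (f_dpow v_trans B) (f_dpow v_trans A).
  have le : (j <= n)%N by rewrite -ltnS.
  by rewrite dpowZ /W /al /be subSS (subSn le) addrC scalerDr !scalerA.
have S1 : \sum_(j < n.+2) al j *: W j = \sum_(j < n.+1) al j.+1 *: W j.+1.
  by rewrite big_ord_recl scale0r add0r; apply: eq_bigr => j _; rewrite lift0.
have S2 : \sum_(j < n.+2) be j *: W j = \sum_(j < n.+1) be j *: W j.
  rewrite big_ord_recr /=; have -> : be n.+1 = 0 by rewrite /be subnn qint0 mulr0.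
  by rewrite scale0r addr0.
rewrite big_split -S1 -S2 -big_split scaler_sumr.
apply: eq_bigr => -[j ltj] _ /=; rewrite -scalerDl [in RHS]scalerA; congr (_ *: _).
have [k En] : exists k, n.+1 = (j + k)%N by exists (n.+1 - j)%N; rewrite subnKC // -ltnS.
rewrite En addKn (gqintD v_trans) /be En addKn.
case: j ltj En => [|j] ltj En; rewrite /al.
  by rewrite !mul0n muln0 !expr0 !invr1 qint0 mul0r !add0r !mul1r mulr1.
have -> : (n - j = k)%N by lia.
have vn m := expf_neq0 m v_neq0.
case: k En => [|k] En; first by rewrite !muln0 !expr0 !invr1 !qint0 !mulr0 !addr0 ?mul1r ?mulr1.
have -> : (n - j.+1 = k)%N by lia.
have -> : (j * k.+1 = j * k + j)%N by lia.
have -> : (j.+1 * k = j * k + k)%N by lia.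
have -> : (j.+1 * k.+1 = j * k + j + k + 1)%N by lia.
have -> : (2 * j.+1 = j + j + 2)%N by lia.
move: (gqint _ _) (gqint _ _) => q1 q2.
rewrite ![v ^+ _.+1]exprS !exprD; field.
by rewrite !vn v_neq0.
Qed.

End QBinomial.

(** * Reduction at v = 0 *)

Section Evaluation.
Variables (K : fieldType) (v : K).
Hypothesis v_trans : forall p : {poly int}, gintpoly p v = 0 -> p = 0.
Let v_neq0 : v != 0 := vv_neq0 v_trans.

Definition polyv (a : K) := exists p, a = gintpoly p v.

(* The rational function [a] of [v] is regular at 0, with value [z]. *)
Definition ev (a : K) (z : int) :=
  exists p q : {poly int}, [/\ q.[0] = 1, a * gintpoly q v = gintpoly p v & p.[0] = z].

Lemma polyvD a b : polyv a -> polyv b -> polyv (a + b).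
Proof. by move=> [p ->] [q ->]; exists (p + q); rewrite gintpolyD. Qed.

Lemma polyvM a b : polyv a -> polyv b -> polyv (a * b).
Proof. by move=> [p ->] [q ->]; exists (p * q); rewrite gintpolyM. Qed.

Lemma polyv0 : polyv 0.
Proof. by exists 0%:P; rewrite gintpolyC. Qed.

Lemma polyv1 : polyv 1.
Proof. by exists 1%:P; rewrite gintpolyC. Qed.

Lemma polyv_Xn m : polyv (v ^+ m).
Proof. by exists 'X^m; rewrite gintpolyXn. Qed.

Lemma polyv_div p : p.[0] = 0 -> polyv (v^-1 * gintpoly p v).
Proof.
move=> p0; have /factor_theorem[q ->] : root p 0 by apply/rootP.
by exists q; rewrite subr0 gintpolyM gintpolyX mulrCA mulVf ?mulr1.
Qed.

Lemma gintpoly_inj p q : gintpoly p v = gintpoly q v -> p = q.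
Proof.
move=> E; apply/eqP; rewrite -subr_eq0; apply/eqP; apply: v_trans.
by rewrite gintpolyD gintpolyN E subrr.
Qed.

Lemma ev_inj a z z' : ev a z -> ev a z' -> z = z'.
Proof.
move=> [p [q [q0 E <-]]] [p' [q' [q0' E' <-]]].
have : p * q' = p' * q by apply: gintpoly_inj; rewrite !gintpolyM -E -E' mulrAC.
by move/(congr1 (fun r => r.[0])); rewrite !hornerM q0 q0' !mulr1.
Qed.

Lemma ev_poly p : ev (gintpoly p v) p.[0].
Proof. by exists p, 1%:P; rewrite hornerC gintpolyC mulr1. Qed.

Lemma evC (z : int) : ev z%:~R z.
Proof. by have := ev_poly z%:P; rewrite gintpolyC hornerC. Qed.

Lemma ev0 : ev 0 0. Proof. exact: (evC 0). Qed.
Lemma ev1 : ev 1 1. Proof. exact: (evC 1). Qed.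

Lemma ev_v : ev v 0.
Proof. by have := ev_poly 'X; rewrite gintpolyX hornerX. Qed.

Lemma evD a b z t : ev a z -> ev b t -> ev (a + b) (z + t).
Proof.
move=> [p [q [q0 E <-]]] [p' [q' [q0' E' <-]]]; exists (p * q' + p' * q), (q * q').
by rewrite hornerD !hornerM q0 q0' !mulr1 gintpolyD !gintpolyM -E -E'; split=> //; ring.
Qed.

Lemma evM a b z t : ev a z -> ev b t -> ev (a * b) (z * t).
Proof.
move=> [p [q [q0 E <-]]] [p' [q' [q0' E' <-]]]; exists (p * p'), (q * q').
by rewrite !hornerM q0 q0' mulr1 !gintpolyM -E -E'; split=> //; ring.
Qed.

Lemma evV a : a != 0 -> ev a 1 -> ev a^-1 1.
Proof.
by move=> a0 [p [q [q0 E p0]]]; exists q, p; split=> //; rewrite -E mulKf.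
Qed.

Lemma evB1 a : polyv a -> ev a 1 -> polyv (v^-1 * (a - 1)).
Proof.
move=> [p ->] /(ev_inj (ev_poly p)) p0.
have -> : gintpoly p v - 1 = gintpoly (p - 1%:P) v by rewrite gintpolyD gintpolyN gintpolyC.
by apply: polyv_div; rewrite hornerD hornerN hornerC p0 subrr.
Qed.

Lemma polyv_ev0 a : polyv a -> ev a 0 -> polyv (v^-1 * a).
Proof. by move=> [p ->] /(ev_inj (ev_poly p)) p0; apply: polyv_div. Qed.

Lemma polyv_ev a : polyv a -> exists z, ev a z.
Proof. by move=> [p ->]; exists p.[0]; apply: ev_poly. Qed.

Lemma polyv_qn a : polyv (qn v a).
Proof.
by exists (\sum_(r < a) 'X^(2 * r)); rewrite gintpoly_sum; apply: eq_bigr => r _; rewrite gintpolyXn.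
Qed.

Lemma ev_qn a : ev (qn v a.+1) 1.
Proof.
rewrite /qn big_ord_recl expr0 -[X in ev _ X]addr0; apply: evD; first exact: ev1.
elim/big_ind: _ => [|x y Hx Hy|r _]; [exact: ev0| |].
  by rewrite -[X in ev _ X]addr0; apply: evD.
have -> : v ^+ (2 * lift ord0 r) = v * v ^+ ((2 * r).+1) by rewrite -exprS lift0 mulnS.
rewrite -(mul0r (('X^((2 * r).+1) : {poly int}).[0])); apply: evM; first exact: ev_v.
by rewrite -(gintpolyXn v); apply: ev_poly.
Qed.

Lemma ev_1Xn a : (0 < a)%N -> ev (1 - v ^+ a) 1.
Proof.
case: a => // a _; have := ev_poly (1%:P - 'X^(a.+1)).
by rewrite gintpolyD gintpolyN gintpolyC gintpolyXn hornerD hornerN hornerC hornerXn expr0n subr0.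
Qed.

Lemma ev_ucoef k : ev (ucoef v k) 1.
Proof.
rewrite /ucoef; elim/big_ind: _ => [|x y Hx Hy|j _]; [exact: ev1| |].
  by rewrite -[X in ev _ X]mulr1; apply: evM.
by apply: evV; [apply: qn_neq0|apply: ev_qn].
Qed.

End Evaluation.

(** * The crystal of a q-boson module with combinatorial basis *)

(* In the application [X m k] is m_{(k+1;i]}, [Y m k] is m_{(k;i-1]}, [S m k] is S_{k+1,i},
   [mp m k] is m^+_{k+1,i}, [mm m k] undoes it, [bf] and [be] are f_i and e'_i, and [L m] exceeds
   the length of every segment of m. *)
Section Boson.
Variables (K : fieldType) (v : K) (T : choiceType) (H : lmodType K).
Variables (pbw : T -> H) (pbwc : H -> T -> K).
Hypothesis pbwc_linear : forall a x y m, pbwc (a *: x + y) m = a * pbwc x m + pbwc y m.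
Hypothesis pbwc_pbw : forall m m', pbwc (pbw m) m' = (m == m')%:R.
Hypothesis pbw_expand : forall x, exists2 s : seq T, uniq s & x = \sum_(m <- s) pbwc x m *: pbw m.
Hypothesis v_trans : forall p : {poly int}, gintpoly p v = 0 -> p = 0.
Variables (X Y : T -> nat -> nat) (S : T -> nat -> int) (mp mm : T -> nat -> T) (L : T -> nat).
Definition vd m k := (k == 0%N) || (0 < Y m k)%N.
Hypothesis vd_lt : forall m k, vd m k -> (k < L m)%N.
Hypothesis X_lt : forall m k, (0 < X m k)%N -> (k < L m)%N.
Hypothesis X_mp : forall m k j, vd m k -> X (mp m k) j = (X m j + (j == k))%N.
Hypothesis Y_mp : forall m k j, vd m k -> (0 < j)%N -> (Y (mp m k) j + (j == k) = Y m j)%N.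
Hypothesis S_mp : forall m k j, vd m k ->
  S (mp m k) j = S m j - (if (j < k)%N then 2 else if j == k then 1 else 0).
Hypothesis mpK : forall m k, vd m k -> mm (mp m k) k = m.
Hypothesis mmK : forall m k, (0 < X m k)%N -> mp (mm m k) k = m.
Hypothesis vd_mm : forall m k, (0 < X m k)%N -> vd (mm m k) k.
Hypothesis mp_mm : forall m k j, j != k -> vd m k -> (0 < X m j)%N ->
  mm (mp m k) j = mp (mm m j) k.
Hypothesis mp_mp : forall m k j, vd m k -> vd m j -> j != k -> mp (mp m k) j = mp (mp m j) k.
Hypothesis S_step : forall m k, S m k - S m k.+1 = (Y m k.+1)%:Z - (X m k)%:Z.
Hypothesis S_large : forall m k, (L m <= k)%N -> S m k = 0.

Let v_neq0 : v != 0 := vv_neq0 v_trans.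
Local Notation qn := (qn v).

Lemma pbwcD x y m : pbwc (x + y) m = pbwc x m + pbwc y m.
Proof. by rewrite -[x]scale1r pbwc_linear mul1r scale1r. Qed.

Lemma pbwc0 m : pbwc 0 m = 0.
Proof. by have := pbwcD 0 0 m; rewrite addr0 -[LHS]addr0 => /addrI. Qed.

Lemma pbwcZ a x m : pbwc (a *: x) m = a * pbwc x m.
Proof. by rewrite -[a *: x]addr0 pbwc_linear pbwc0 addr0. Qed.

Lemma pbwc_sum (I : Type) (r : seq I) (P : pred I) (g : I -> H) m :
  pbwc (\sum_(j <- r | P j) g j) m = \sum_(j <- r | P j) pbwc (g j) m.
Proof. by apply: (big_morph (fun x => pbwc x m)) => [x y|]; rewrite ?pbwcD ?pbwc0. Qed.

Lemma pbwc_eq x y : (forall m, pbwc x m = pbwc y m) -> x = y.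
Proof.
move=> E; apply/eqP; rewrite -subr_eq0; apply/eqP.
have [s _ ->] := pbw_expand (x - y); rewrite big1 // => m _.
by rewrite -scaleN1r pbwcD pbwcZ E mulN1r subrr scale0r.
Qed.

Lemma linear_pbw_ext (g h : {linear H -> H}) : (forall m, g (pbw m) = h (pbw m)) -> g =1 h.
Proof.
move=> E x; have [s _ ->] := pbw_expand x; rewrite !linear_sum.
by apply: eq_bigr => m _; rewrite !linearZ /= E.
Qed.

Definition bfcoef m k : K := if vd m k then v ^ (S m k) * qn (X m k).+1 else 0.
(** Forced by adjointness: the coefficient of [m] in [bf] of [mm m k], times the ratio of norms
    given by [nm_mp]. *)
Definition becoef m k : K := if (0 < X m k)%N then
  v ^ (S m k + 1) * (if k == 0%N then 1 else 1 - v ^+ (2 * (Y m k).+1)) else 0.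

Lemma X_mm m k j : (0 < X m k)%N -> (X (mm m k) j + (j == k) = X m j)%N.
Proof. by move=> Xk; rewrite -X_mp ?vd_mm // mmK. Qed.

Lemma Y_mm m k j : (0 < X m k)%N -> (0 < j)%N -> Y (mm m k) j = (Y m j + (j == k))%N.
Proof. by move=> Xk j0; rewrite -(Y_mp (vd_mm Xk) j0) mmK. Qed.

Lemma S_mm m k j : (0 < X m k)%N ->
  S (mm m k) j = S m j + (if (j < k)%N then 2 else if j == k then 1 else 0).
Proof. by move=> Xk; have := S_mp j (vd_mm Xk); rewrite mmK // => ->; rewrite subrK. Qed.

Lemma bfcoef_large m k : (L m <= k)%N -> bfcoef m k = 0.
Proof. by rewrite /bfcoef leqNgt; case: ifP => // /vd_lt->. Qed.

Lemma becoef_large m k : (L m <= k)%N -> becoef m k = 0.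
Proof. by rewrite /becoef leqNgt; case: ifP => // /X_lt->. Qed.

Variables bf be : {linear H -> H}.
Hypothesis bf_pbw : forall m D, (L m <= D)%N ->
  bf (pbw m) = \sum_(k < D) bfcoef m k *: pbw (mp m k).
Hypothesis be_pbw : forall m D, (L m <= D)%N ->
  be (pbw m) = \sum_(k < D) becoef m k *: pbw (mm m k).

(** Moves at different lengths commute; the factor v^-2 comes from S, which the longer of the two
    moves shifts by 2 at the shorter length, on one side only. *)
Lemma offdiag m k j : j != k ->
  (bfcoef m k * becoef (mp m k) j) *: pbw (mm (mp m k) j) =
  (v ^- 2 * (becoef m j * bfcoef (mm m j) k)) *: pbw (mp (mm m j) k).
Proof.
move=> jk; rewrite /bfcoef /becoef.
case vk: (vd m k); last first.
  rewrite mul0r scale0r; case: ifP => Xj; last by rewrite mul0r mulr0 !scale0r.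
  suff -> : vd (mm m j) k = false by rewrite !mulr0 !scale0r.
  move: vk; rewrite /vd; case: (posnP k) => // k0; rewrite Y_mm //.
  by rewrite [k == j]eq_sym (negbTE jk) addn0.
rewrite (X_mp _ vk) (negbTE jk) addn0; case: ifP => Xj; last by rewrite mulr0 mul0r mulr0 !scale0r.
have -> : vd (mm m j) k.
  move: vk; rewrite /vd; case: (posnP k) => // k0; rewrite Y_mm //.
  by rewrite [k == j]eq_sym (negbTE jk) addn0.
rewrite (mp_mm jk vk Xj); congr (_ *: _).
have -> : X (mm m j) k = X m k by have := X_mm k Xj; rewrite [k == j]eq_sym (negbTE jk) addn0.
rewrite (S_mp _ vk) (S_mm _ Xj) (negbTE jk) [k == j]eq_sym (negbTE jk).
have -> : (if j == 0%N then 1 else 1 - v ^+ (2 * (Y (mp m k) j).+1)) =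
          (if j == 0%N then 1 else 1 - v ^+ (2 * (Y m j).+1)) :> K.
  by case: (posnP j) => // j0; rewrite -(Y_mp vk j0) (negbTE jk) addn0.
set yy := (if j == 0%N then _ else _ : K).
have E : v ^ S m k * v ^ (S m j - (if (j < k)%N then 2 else 0) + 1) =
  v ^- 2 * (v ^ (S m j + 1) * v ^ (S m k + (if (k < j)%N then 2 else 0))).
  rewrite exprnN -!expfzDr //; congr (_ ^ _).
  by case: (ltngtP j k) jk => //; lia.
transitivity (v ^ S m k * v ^ (S m j - (if (j < k)%N then 2 else 0) + 1) * (qn (X m k).+1 * yy)); first by ring.
by rewrite E; ring.
Qed.

(** By [S_step] the exponent is also 2 (S m k.+1 + Y m k.+1), which makes consecutive diagonal terms
    telescope. *)
Definition tl m k : K := v ^ (2 * (S m k + (X m k)%:Z)).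

(** For positive [k], after factoring out v^(2 S m k), this is qn(X+1) (1 - v^(2Y)) - qn(X) (1 -
    v^(2Y+2)) = v^(2X) - v^(2Y), checked after multiplication by 1 - v^2. *)
Lemma diag m k : bfcoef m k * becoef (mp m k) k - v ^- 2 * (becoef m k * bfcoef (mm m k) k) =
  tl m k - (if k is k'.+1 then tl m k' else 0).
Proof.
have nz : 1 - v ^+ 2 != 0 by apply: vXn_neq1.
set yk : K := if k == 0%N then 1 else 1 - v ^+ (2 * Y m k).
set yk1 : K := if k == 0%N then 1 else 1 - v ^+ (2 * (Y m k).+1).
have E1 : bfcoef m k * becoef (mp m k) k = v ^ (2 * S m k) * (qn (X m k).+1 * yk).
  rewrite /bfcoef; case vk: (vd m k); last first.
    move: vk; rewrite /yk /vd; case: eqP => //= _ /negbT; rewrite -leqNgt leqn0 => /eqP->.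
    by rewrite muln0 expr0 subrr !mulr0 mul0r.
  rewrite /becoef X_mp // eqxx addn1 /= S_mp // ltnn eqxx subrK.
  have -> : (if k == 0%N then 1 else 1 - v ^+ (2 * (Y (mp m k) k).+1)) = yk.
    rewrite /yk; case: (posnP k) => // k0; have := Y_mp vk k0.
    by rewrite eqxx addn1 => ->.
  by rewrite mulr_natl mulr2n expfzDr //; ring.
have E2 : v ^- 2 * (becoef m k * bfcoef (mm m k) k) = v ^ (2 * S m k) * (qn (X m k) * yk1).
  rewrite /becoef; case: ifP => Xk; last first.
    move: Xk; case: (X m k) => // _; rewrite qn0 mul0r !mulr0 mul0r mulr0 //.
  rewrite /bfcoef vd_mm // S_mm // ltnn eqxx.
  have -> : (X (mm m k) k).+1 = X m k by have := X_mm k Xk; rewrite eqxx addn1.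
  rewrite -/yk1 exprnN.
  have -> : v ^ (2 * S m k) = v ^ (- 2%:Z) * v ^ (S m k + 1) * v ^ (S m k + 1).
    by rewrite -!expfzDr //; congr (_ ^ _); lia.
  by ring.
rewrite E1 E2 /tl.
have vX a (z : int) : v ^ (2 * (z + a%:Z)) = v ^ (2 * z) * v ^+ (2 * a).
  by rewrite exprnP -expfzDr //; congr (_ ^ _); lia.
rewrite vX; case: (k) (S_step m) @yk @yk1 {E1 E2} => [|k'] /= Sst.
  by rewrite !mulr1 qnS; ring.
have -> : S m k' + X m k' = S m k'.+1 + Y m k'.+1 by have := Sst k'; lia.
rewrite vX -!mulrBr; congr (_ * _); apply: (mulIf nz).
have := qn_mul v (X m k'.+1).+1; have := qn_mul v (X m k'.+1).
move: (qn (X m k'.+1)) (qn (X m k'.+1).+1) => a b Ea Eb.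
transitivity (b * (1 - v ^+ 2) * (1 - v ^+ (2 * Y m k'.+1)) -
   a * (1 - v ^+ 2) * (1 - v ^+ (2 * (Y m k'.+1).+1))); first by ring.
by rewrite Ea Eb !mulnS !exprD; ring.
Qed.

(* The diagonal terms telescope, see [diag]. *)
Lemma boson_rel x : be (bf x) = v ^- 2 *: bf (be x) + x.
Proof.
pose g : H -> H := (v ^- 2 \*: (bf \o be)) \+ idfun.
suff E : be \o bf =1 g by exact: E.
apply: linear_pbw_ext => m.
(* One bound for all expansions, so that the two double sums run over the same range. *)
have [D [LD LfD LeD]] : exists D, [/\ (L m <= D)%N, forall k, (k < L m)%N -> (L (mp m k) <= D)%N &
    forall k, (k < L m)%N -> (L (mm m k) <= D)%N].
  exists (L m + \sum_(k < L m) (L (mp m k) + L (mm m k)))%N; split=> [|k lk|k lk]; first exact: leq_addr.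
  - by rewrite (bigD1 (Ordinal lk)) //=; lia.
  - by rewrite (bigD1 (Ordinal lk)) //=; lia.
pose D1 := D.+1.
rewrite /g /= (bf_pbw (D := D1)) ?leqW // (be_pbw (D := D1)) ?leqW //.
rewrite !linear_sum /=.
have E1 (k : 'I_D1) : be (bfcoef m k *: pbw (mp m k)) =
    \sum_(j < D1) (bfcoef m k * becoef (mp m k) j) *: pbw (mm (mp m k) j).
  have [lk|lk] := ltnP k (L m); last first.
    rewrite (bfcoef_large lk) scale0r linear0; apply: esym; apply: big1 => j _.
    by rewrite mul0r scale0r.
  rewrite linearZ /= (be_pbw (D := D1)) ?leqW ?LfD // scaler_sumr; apply: eq_bigr => j _.
  by rewrite scalerA.
have E2 (j : 'I_D1) : bf (becoef m j *: pbw (mm m j)) =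
    \sum_(k < D1) (becoef m j * bfcoef (mm m j) k) *: pbw (mp (mm m j) k).
  have [lj|lj] := ltnP j (L m); last first.
    rewrite (becoef_large lj) scale0r linear0; apply: esym; apply: big1 => k _.
    by rewrite mul0r scale0r.
  rewrite linearZ /= (bf_pbw (D := D1)) ?leqW ?LeD // scaler_sumr; apply: eq_bigr => k _.
  by rewrite scalerA.
under eq_bigr => k _ do rewrite E1.
under [X in _ = X + _]eq_bigr => j _ do rewrite E2 scaler_sumr.
rewrite [X in _ = X + _]exchange_big /=.
apply/eqP; rewrite addrC -subr_eq -sumrB; apply/eqP.
transitivity (\sum_(k < D1) (tl m k - (if val k is k'.+1 then tl m k' else 0)) *: pbw m).
  apply: eq_bigr => k _; rewrite -sumrB (bigD1 k) //= big1 => [|j jk]; last first.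
    by rewrite (offdiag _ jk) -[X in X - _]scalerA subrr.
  rewrite addr0; have := diag m k; rewrite -[nat_of_ord k]/(val k) => <-.
  apply: etrans (esym (scalerBl _ _ _)); congr (_ - _).
    have [vk|vk] := boolP (vd m k); first by rewrite mpK.
    by rewrite /bfcoef (negbTE vk) mul0r !scale0r.
  rewrite -[in RHS]scalerA; congr (_ *: _).
  have [Xk|Xk] := boolP (0 < X m k)%N; first by rewrite mmK.
  by rewrite /becoef (negbTE Xk) mul0r !scale0r.
rewrite -scaler_suml.
have -> : \sum_(k < D1) (tl m k - (if val k is k'.+1 then tl m k' else 0)) = tl m D.
  rewrite /D1; elim: D {LD LfD LeD D1 E1 E2} => [|d IH]; first by rewrite big_ord1 subr0.
  by rewrite big_ord_recr /= IH addrC subrK.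
(* Beyond [L m] both S and X vanish; the term v^0 left over gives the last summand of the
   relation. *)
rewrite /tl S_large // add0r.
have -> : X m D = 0%N.
  by apply/eqP; rewrite -leqn0 leqNgt; apply/negP => /X_lt; rewrite ltnNge LD.
by rewrite mulr0 scale1r.
Qed.

(** * Divided powers preserve the Z[v, v^-1]-form *)

Section Integrality.
Variable fk : nat -> {linear H -> H}.
Hypothesis fk_pbw : forall k m, fk k (pbw m) = bfcoef m k *: pbw (mp m k).

Definition inZ (x : H) : Prop := forall m, lau v (pbwc x m).

Lemma inZP a x y : lau v a -> inZ x -> inZ y -> inZ (a *: x + y).
Proof. by move=> la Hx Hy m; rewrite pbwc_linear; apply: lauD => //; apply: lauM. Qed.

Lemma inZ0 : inZ 0.
Proof. by move=> m; rewrite pbwc0; apply: lau0. Qed.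

Lemma inZ_pbw m : inZ (pbw m).
Proof. by move=> m'; rewrite pbwc_pbw; case: eqP => _; [apply: lau1|apply: lau0]. Qed.

Lemma inZD x y : inZ x -> inZ y -> inZ (x + y).
Proof. by move=> Hx Hy; rewrite -[x]scale1r; apply: inZP => //; apply: lau1. Qed.

Lemma inZZ a x : lau v a -> inZ x -> inZ (a *: x).
Proof. by move=> la Hx; rewrite -[_ *: _]addr0; apply: inZP => //; apply: inZ0. Qed.

Lemma inZ_sum (I : Type) (r : seq I) (P : pred I) (h : I -> H) :
  (forall j, P j -> inZ (h j)) -> inZ (\sum_(j <- r | P j) h j).
Proof. move=> E; elim/big_ind: _ => //; [exact: inZ0|exact: inZD]. Qed.

Lemma inZ_ext (g : H -> H) : (forall a x y, g (a *: x + y) = a *: g x + g y) ->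
  (forall m, inZ (g (pbw m))) -> forall x, inZ x -> inZ (g x).
Proof.
move=> gP gZ x Hx; have [s _ Ex] := pbw_expand x.
have gs : g x = \sum_(m <- s) pbwc x m *: g (pbw m).
  have g0 : g 0 = 0 by have := gP 1 0 0; rewrite scaler0 addr0 scale1r -[LHS]addr0 => /addrI.
  rewrite {1}Ex; elim: (s) => [|m r IH]; first by rewrite !big_nil.
  by rewrite !big_cons gP IH.
by rewrite gs; apply: inZ_sum => m _; apply: inZZ.
Qed.

Lemma lau_becoef m k : lau v (becoef m k).
Proof.
rewrite /becoef; case: ifP => _; last exact: lau0.
apply: lauM; first exact: lau_vz.
case: ifP => _; first exact: lau1.
by exists 0%N, (1%:P - 'X^(2 * (Y m k).+1)); rewrite gintpolyD gintpolyN gintpolyXn gintpolyC mul1r.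
Qed.

Lemma inZ_be x : inZ x -> inZ (be x).
Proof.
apply: inZ_ext => [a y z|m]; first by rewrite linearP.
rewrite (be_pbw (leqnn _)); apply: inZ_sum => k _.
by apply: inZZ; [apply: lau_becoef|apply: inZ_pbw].
Qed.

(** The iterates of [fk r] on a PBW element stay multiples of PBW elements, with products of
    consecutive [qn] as coefficients up to powers of v; division by the factorial gives a Gaussian
    binomial. *)
Lemma inZ_dpow_fk r j x : inZ x -> inZ (dpow v (fk r) j x).
Proof.
apply: inZ_ext => [a y z|m]; first exact: dpowP.
have [E|[z [E Xj]]] : iter j (fk r) (pbw m) = 0 \/ exists z : int,
    iter j (fk r) (pbw m) = (v ^ z * \prod_(t < j) qn (X m r + t).+1) *: pbw (iter j (mp^~ r) m)
    /\ X (iter j (mp^~ r) m) r = (X m r + j)%N.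
- elim: j => [|j [E|[z [E Xj]]]].
  + by right; exists 0; rewrite big_ord0 mulr1 scale1r addn0.
  + by left; rewrite iterS E linear0.
  rewrite iterS E linearZ /= fk_pbw /bfcoef.
  case vj: (vd _ _); last by left; rewrite scale0r scaler0.
  right; exists (z + S (iter j (mp^~ r) m) r); split; last by rewrite X_mp // eqxx Xj addnS addn1.
  rewrite scalerA big_ord_recr /= Xj expfzDr //; congr (_ *: _); ring.
- by rewrite /dpow E scaler0; apply: inZ0.
rewrite /dpow E scalerA; apply: inZZ; last exact: inZ_pbw.
have [z' ->] := gqfactE v_trans j.
have -> : (v ^ z' * \prod_(t < j) qn t.+1)^-1 * (v ^ z * \prod_(t < j) qn (X m r + t).+1) =
    v ^ (z - z') * gauss v (X m r) j.
  rewrite /gauss prodf_div expfzDr // -invr_expz invfM; ring.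
by apply: lauM; [apply: lau_vz|apply: lau_gauss].
Qed.

(** [mp] at [r] lowers S at [k] by 2 because k < r, whereas [mp] at [k] leaves S at [r]
    unchanged. *)
Lemma fk_comm k r x : (k < r)%N -> fk k (fk r x) = v ^- 2 *: fk r (fk k x).
Proof.
move=> kr; have nkr : k != r by rewrite ltn_eqF.
pose g : H -> H := v ^- 2 \*: (fk r \o fk k).
suff E : fk k \o fk r =1 g by exact: E.
apply: linear_pbw_ext => m; rewrite /g /= !fk_pbw !linearZ /= !fk_pbw !scalerA.
rewrite /bfcoef; case vr: (vd m r); last first.
  rewrite ?(mulr0, mul0r) scale0r; case vk: (vd m k); last by rewrite ?(mulr0, mul0r) scale0r.
  suff -> : vd (mp m k) r = false by rewrite ?(mulr0, mul0r) scale0r.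
  move: vr; rewrite /vd; case: (posnP r) => // r0; rewrite -(Y_mp vk r0) eq_sym (negbTE nkr).
  by rewrite addn0.
have Xk : X (mp m r) k = X m k by rewrite X_mp // (negbTE nkr) addn0.
have vE : vd (mp m r) k = vd m k.
  rewrite /vd; case: (posnP k) => // k0; rewrite -(Y_mp vr k0) (negbTE nkr) addn0 //.
rewrite vE; case vk: (vd m k); last by rewrite ?(mulr0, mul0r) !scale0r.
have -> : vd (mp m k) r.
  move: vr; rewrite /vd; case: (posnP r) => // r0; rewrite -(Y_mp vk r0) eq_sym (negbTE nkr).
  by rewrite addn0.
rewrite (mp_mp vr vk nkr); congr (_ *: _).
rewrite Xk X_mp // [r == k]eq_sym (negbTE nkr) addn0 !S_mp // kr ltnNge (ltnW kr) /=.
rewrite [r == k]eq_sym (negbTE nkr) subr0.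
have -> : v ^ (S m k - 2) = v ^- 2 * v ^ (S m k) by rewrite exprnN -expfzDr // addrC.
ring.
Qed.

(** Induction on [r] by [dpow_add]: the sum of the first [r] operators commutes with [fk r] up to
    v^-2. *)
Lemma inZ_dpow_sum r : exists A : {linear H -> H},
  (forall x, A x = \sum_(k < r) fk k x) /\ forall n x, inZ x -> inZ (dpow v A n x).
Proof.
elim: r => [|r [A [AE AZ]]].
  exists (\0 : {linear H -> H}); split=> [x|[|n] x Hx]; first by rewrite big_ord0.
    by rewrite dpow0.
  by rewrite /dpow /= scaler0; apply: inZ0.
pose C : {linear H -> H} := A \+ fk r; exists C.
have CE x : C x = A x + fk r x by [].
split=> [x|n x Hx]; first by rewrite CE AE big_ord_recr.
rewrite (dpow_add v_trans CE); last first.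
  by move=> y; rewrite !AE linear_sum scaler_sumr; apply: eq_bigr => k _; rewrite fk_comm.
apply: inZ_sum => j _; apply: inZZ; last by apply: inZ_dpow_fk; apply: AZ.
by rewrite exprnN; apply: lau_vz.
Qed.

(** [bf] has infinitely many summands [fk k], but on the PBW elements met by the first [n] iterates
    those with [k] at least [D] vanish. *)
Lemma inZ_dpow n x : inZ x -> inZ (dpow v bf n x).
Proof.
apply: inZ_ext => [a y z|m]; first exact: dpowP.
have [D LD] : exists D, forall j y, (j < n)%N -> y = iter j bf (pbw m) ->
    exists2 s : seq T, y = \sum_(c <- s) pbwc y c *: pbw c & forall c, c \in s -> (L c <= D)%N.
  have bnd (s : seq T) : exists D, forall c, c \in s -> (L c <= D)%N.
    exists (\sum_(c <- s) L c)%N => c cs; rewrite (big_rem c) //=; exact: leq_addr.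
  elim: n => [|n [D HD]]; first by exists 0%N.
  have [s _ Es] := pbw_expand (iter n bf (pbw m)); have [D' HD'] := bnd s.
  exists (D + D')%N => j y; rewrite ltnS leq_eqVlt => /predU1P[-> ->|lt Ey].
    by exists s => // c /HD' le; rewrite (leq_trans le) ?leq_addl.
  have [s' Es' H'] := HD j y lt Ey; exists s' => // c /H' le; rewrite (leq_trans le) ?leq_addr //.
have [A [AE AZ]] := inZ_dpow_sum D.
suff -> : dpow v bf n (pbw m) = dpow v A n (pbw m) by apply: AZ; apply: inZ_pbw.
rewrite /dpow; congr (_ *: _); elim: n LD => [//|n IH] LD.
rewrite !iterS -IH => [|j y lt]; last by apply: LD; apply: ltnW.
have [s -> Hs] := LD n _ (ltnSn n) erefl.
rewrite linear_sum [in RHS]linear_sum; apply: eq_big_seq => c cs.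
rewrite linearZ [in RHS]linearZ /= AE (bf_pbw (Hs _ cs)); congr (_ *: _).
by apply: eq_bigr => k _; rewrite fk_pbw.
Qed.
End Integrality.

(** * The lattice L and positivity at v = 0 *)

Section Form.
Variable nm : T -> K.
Hypothesis nm_mp : forall m k, vd m k ->
  nm (mp m k) * qn (X m k).+1 = nm m * (if k == 0%N then 1 else 1 - v ^+ (2 * Y m k)).
Variable form : H -> H -> K.
Hypothesis formC : forall x y, form x y = form y x.
Hypothesis form_linearr : forall x a y z, form x (a *: y + z) = a * form x y + form x z.
Hypothesis form_pbw : forall x m, form (pbw m) x = pbwc x m * nm m.

Lemma formDr x y z : form x (y + z) = form x y + form x z.
Proof. by rewrite -[y]scale1r form_linearr mul1r scale1r. Qed.

Lemma form0r x : form x 0 = 0.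
Proof. by have := formDr x 0 0; rewrite addr0 -[LHS]addr0 => /addrI. Qed.

Lemma formZr x a y : form x (a *: y) = a * form x y.
Proof. by rewrite -[a *: y]addr0 form_linearr form0r addr0. Qed.

Lemma formDl x y z : form (x + y) z = form x z + form y z.
Proof. by rewrite !(formC _ z) formDr. Qed.

Lemma formZl x a y : form (a *: x) y = a * form x y.
Proof. by rewrite !(formC _ y) formZr. Qed.

Lemma form_sumr (I : Type) (r : seq I) P (g : I -> H) x :
  form x (\sum_(j <- r | P j) g j) = \sum_(j <- r | P j) form x (g j).
Proof. by apply: (big_morph (form x)) => [y z|]; rewrite ?formDr ?form0r. Qed.

Lemma form_suml (I : Type) (r : seq I) P (g : I -> H) x :
  form (\sum_(j <- r | P j) g j) x = \sum_(j <- r | P j) form (g j) x.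
Proof. by rewrite formC form_sumr; apply: eq_bigr => j _; rewrite formC. Qed.

Lemma adjoint x y : form (bf x) y = form x (be y).
Proof.
have [sx _ ->] := pbw_expand x; have [sy _ ->] := pbw_expand y.
rewrite linear_sum !form_suml; apply: eq_bigr => m _.
rewrite linearZ /= !formZl; congr (_ * _).
rewrite linear_sum !form_sumr; apply: eq_bigr => c _.
rewrite linearZ /= !formZr; congr (_ * _).
pose D := (L m + L c)%N.
rewrite (bf_pbw (D := D)) ?leq_addr // (be_pbw (D := D)) ?leq_addl // form_suml form_sumr.
apply: eq_bigr => k _; rewrite formZl formZr !form_pbw !pbwc_pbw //.
have [[vk Em]|nE] := classic (vd m k /\ mp m k = c).
  have Xc : (0 < X (mp m k) k)%N by rewrite X_mp // eqxx addn1.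
  rewrite -Em mpK // !eqxx !mul1r /bfcoef vk /becoef Xc S_mp // ltnn eqxx subrK.
  rewrite -mulrA -mulrA; congr (_ * _); rewrite mulrC nm_mp // mulrC; congr (_ * _).
  by case: (posnP k) => // k0; have := Y_mp vk k0; rewrite eqxx addn1 => ->.
rewrite /bfcoef /becoef; case: ifP => vk; last first.
  rewrite mul0r; case: ifP => Xk; last by rewrite ?mul0r.
  case: (mm c k =P m) => [E|]; last by rewrite mul0r mulr0.
  by move: (vd_mm Xk); rewrite E vk.
case: (c =P mp m k) => [E|_]; first by case: nE; split.
rewrite mul0r mulr0; case: ifP => Xk; last by rewrite mul0r.
case: (mm c k =P m) => [E|]; last by rewrite mul0r mulr0.
by case: nE; split=> //; rewrite -E mmK.
Qed.

Hypothesis nm_neq0 : forall m, nm m != 0.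

(** The norms are nonzero, so the form is nondegenerate and [bf] has only one adjoint. *)
Lemma eprimeE y (z : H) : (forall x, form (bf x) y = form x z) -> z = be y.
Proof.
move=> HP; apply: pbwc_eq => m; have := HP (pbw m); rewrite adjoint !form_pbw.
by move/(mulIf (nm_neq0 m)).
Qed.

Hypothesis boson_dpow_inZ : forall n x, inZ x -> inZ (dpow v bf n x).
Variable sz : T -> nat.
Hypothesis sz_mp : forall m k, vd m k -> sz (mp m k) = (sz m).+1.
Hypothesis nm_ev : forall m, ev v (nm m) 1.

Local Notation dp := (dpow v bf).

Definition inL (x : H) := forall m, polyv v (pbwc x m).
(** Membership in vL. *)
Definition invL (x : H) := inL (v^-1 *: x).

Lemma inLP a x y : polyv v a -> inL x -> inL y -> inL (a *: x + y).
Proof. by move=> pa Hx Hy m; rewrite pbwc_linear; apply: polyvD => //; apply: polyvM. Qed.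

Lemma inL0 : inL 0.
Proof. by move=> m; rewrite pbwc0; apply: polyv0. Qed.

Lemma inLD x y : inL x -> inL y -> inL (x + y).
Proof. by move=> Hx Hy; rewrite -[x]scale1r; apply: inLP => //; apply: polyv1. Qed.

Lemma inLZ a x : polyv v a -> inL x -> inL (a *: x).
Proof. by move=> pa Hx; rewrite -[_ *: _]addr0; apply: inLP => //; apply: inL0. Qed.

Lemma inL_pbw m : inL (pbw m).
Proof. by move=> m'; rewrite pbwc_pbw; case: eqP => _; [apply: polyv1|apply: polyv0]. Qed.

Lemma inL_inZ x : inL x -> inZ x.
Proof. by move=> Hx m; have [p ->] := Hx m; apply: lau_poly. Qed.

Lemma invL0 : invL 0.
Proof. by rewrite /invL scaler0; apply: inL0. Qed.

Lemma invLD x y : invL x -> invL y -> invL (x + y).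
Proof. by move=> Hx Hy; rewrite /invL scalerDr; apply: inLD. Qed.

Lemma invLN x : invL x -> invL (- x).
Proof.
move=> Hx; rewrite /invL scalerN -scaleN1r; apply: inLZ => //.
by exists (-1)%:P; rewrite gintpolyC rmorphN1.
Qed.

Lemma invLB x y : invL x -> invL y -> invL (x - y).
Proof. by move=> Hx Hy; apply: invLD => //; apply: invLN. Qed.

Lemma invL_sum (I : Type) (r : seq I) (P : pred I) (h : I -> H) :
  (forall j, P j -> invL (h j)) -> invL (\sum_(j <- r | P j) h j).
Proof. move=> E; elim/big_ind: _ => //; [exact: invL0|exact: invLD]. Qed.

Lemma invLZ a x : polyv v a -> invL x -> invL (a *: x).
Proof. by move=> pa Hx; rewrite /invL scalerA mulrC -scalerA; apply: inLZ. Qed.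

Lemma invLZv a x : polyv v (v^-1 * a) -> inL x -> invL (a *: x).
Proof. by move=> pa Hx; rewrite /invL scalerA; apply: inLZ. Qed.

Lemma inZ_inL x : inZ x -> exists N, inL (v ^+ N *: x).
Proof.
move=> Hx; have [s _ Es] := pbw_expand x; rewrite Es; elim: s {Es} => [|m s [N HN]].
  by exists 0%N; rewrite big_nil scaler0; apply: inL0.
have [M [p Ep]] := Hx m; exists (N + M)%N; rewrite big_cons scalerDr; apply: inLD.
  rewrite scalerA exprD -mulrA Ep; apply: inLZ; last exact: inL_pbw.
  by apply: polyvM; [exists 'X^N; rewrite gintpolyXn|exists p].
by rewrite exprD mulrC -scalerA; apply: inLZ => //; exists 'X^M; rewrite gintpolyXn.
Qed.

Lemma form_diag y : exists2 s : seq T, (forall m, m \notin s -> pbwc y m = 0) &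
  form y y = \sum_(m <- s) pbwc y m ^+ 2 * nm m.
Proof.
have [s us Es] := pbw_expand y; exists s => [m ms|].
  rewrite Es pbwc_sum big1_seq // => j /andP[_ js]; rewrite pbwcZ pbwc_pbw.
  by case: eqP => [E|]; [rewrite -E js in ms|rewrite mulr0].
rewrite {1}Es form_suml; apply: eq_bigr => m _.
by rewrite formZl form_pbw expr2 mulrA.
Qed.

(** The norms of PBW elements have value 1 at v = 0, so the form of [y] with itself takes as value
    the sum of the squares of the values of its coordinates. A coordinate of value 0 is divisible by
    v. *)
Lemma inL_pos y : inL y -> exists z : int, [/\ ev v (form y y) z, 0 <= z & z = 0 -> invL y].
Proof.
move=> Hy; have [s sE ->] := form_diag y.
have [z [Ez z0 Hz]] : exists z : int, [/\ ev v (\sum_(m <- s) pbwc y m ^+ 2 * nm m) z, 0 <= z &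
    z = 0 -> forall m, m \in s -> polyv v (v^-1 * pbwc y m)].
  elim: s {sE} => [|m s [z [Ez z0 Hz]]].
    by exists 0; split=> //; rewrite big_nil; apply: ev0.
  have [p Ep] := Hy m; exists (p.[0] ^+ 2 + z); split.
  - rewrite big_cons; apply: evD => //; rewrite -[p.[0] ^+ 2]mulr1; apply: evM => //.
    by rewrite Ep !expr2; apply: evM; apply: ev_poly.
  - by rewrite addr_ge0 ?sqr_ge0.
  move/eqP; rewrite paddr_eq0 ?sqr_ge0 // sqrf_eq0 => /andP[/eqP p0 /eqP zz] m'.
  rewrite inE => /predU1P[->|]; last exact: Hz.
  by rewrite Ep; apply: polyv_div.
exists z; split=> // /Hz H' m; rewrite pbwcZ; have [/H' //|/sE ->] := boolP (m \in s).
by rewrite mulr0; apply: polyv0.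
Qed.

Lemma inL_pos_sum N (u : nat -> K) (y : nat -> H) :
  (forall k, ev v (u k) 1) -> (forall k, (k < N)%N -> inL (y k)) ->
  exists z : int, [/\ ev v (\sum_(k < N) u k * form (y k) (y k)) z, 0 <= z &
    z = 0 -> forall k, (k < N)%N -> invL (y k)].
Proof.
move=> Hu; elim: N => [|N IH] Hy.
  by exists 0; split=> //; rewrite big_ord0; apply: ev0.
have [k lk|z [Ez z0 Hz]] := IH; first by apply: Hy; apply: ltnW.
have [z' [Ez' z0' Hz']] := inL_pos (Hy N (ltnSn N)).
exists (z + z'); split.
- rewrite big_ord_recr /=; apply: evD => //; rewrite -[z']mul1r; exact: evM.
- exact: addr_ge0.
move/eqP; rewrite paddr_eq0 // => /andP[/eqP zz /eqP zz'] k.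
rewrite ltnS leq_eqVlt => /predU1P[->|]; [exact: Hz'|exact: Hz].
Qed.

(** If v^(M+1) clears the denominators, the weighted sum of norms is multiplied by a positive power
    of v and vanishes at 0. By positivity the cleared vectors lie in vL, so v^M clears the
    denominators as well. *)
Lemma inL_descent N (u : nat -> K) (y : nat -> H) z :
  (forall k, ev v (u k) 1) -> (forall k, (k < N)%N -> inZ (y k)) ->
  ev v (\sum_(k < N) u k * form (y k) (y k)) z -> forall k, (k < N)%N -> inL (y k).
Proof.
move=> Hu Hy Ez.
have [M HM] : exists M, forall k, (k < N)%N -> inL (v ^+ M *: y k).
  elim: N Hy {Ez} => [|N IH] Hy; first by exists 0%N.
  have [k lk|M HM] := IH; first by apply: Hy; apply: ltnW.
  have [M' HM'] := inZ_inL (Hy N (ltnSn N)).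
  exists (M + M')%N => k; rewrite ltnS leq_eqVlt => /predU1P[->|lt].
    by rewrite exprD -scalerA; apply: inLZ => //; exists 'X^M; rewrite gintpolyXn.
  rewrite exprD mulrC -scalerA; apply: inLZ; last exact: HM.
  by exists 'X^M'; rewrite gintpolyXn.
elim: M HM => [|M IH] HM; first by move=> k lk; rewrite -[y k]scale1r; apply: HM.
apply: IH => k lk.
have [z' [Ez' _ Hz']] := inL_pos_sum Hu HM.
have E0 : ev v (\sum_(k < N) u k * form (v ^+ M.+1 *: y k) (v ^+ M.+1 *: y k)) 0.
  have -> : \sum_(k < N) u k * form (v ^+ M.+1 *: y k) (v ^+ M.+1 *: y k) =
     v * (v ^+ M * v ^+ M.+1 * \sum_(k < N) u k * form (y k) (y k)).
    rewrite !mulr_sumr; apply: eq_bigr => j _; rewrite formZl formZr exprS; ring.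
  have Ezz : ev v (v ^+ M * v ^+ M.+1) ('X^(M + M.+1) : {poly int}).[0].
    by rewrite -exprD -(gintpolyXn v); apply: ev_poly.
  by have := evM (ev_v v) (evM Ezz Ez); rewrite mul0r.
have /Hz'/(_ k lk) : z' = 0 by apply: (ev_inj v_trans Ez' E0).
by rewrite /invL scalerA exprS mulKf.
Qed.

(** Integrality bounds the denominators of the components, and orthogonality expresses the form of
    [x] with itself, regular at 0, by their norms; the descent applies. *)
Lemma comps_inL N x (w : nat -> H) : (forall k, be (w k) = 0) ->
  x = \sum_(k < N) dp k (w k) -> inL x -> forall k, (k < N)%N -> inL (w k).
Proof.
move=> ew Ex Lx.
have Zw := dpow_decomp_integral v_trans boson_rel inZP inZ_be boson_dpow_inZ inZ0 (inL_inZ Lx) Ex ew.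
have [z [Ez _ _]] := inL_pos Lx.
apply: (inL_descent (ev_ucoef v_trans) Zw (z := z)).
by rewrite -(form_decomp v_trans boson_rel formC form_linearr adjoint N ew) -Ex.
Qed.

Lemma be_scale0 a w : be w = 0 -> be (a *: w) = 0.
Proof. by move=> ew; rewrite linearZ /= ew scaler0. Qed.

(** Uniqueness of the components: [dpow_decomp_integral] with the zero space in place of the
    integral form. *)
Lemma comps_eq0 N (w : nat -> H) : (forall k, be (w k) = 0) ->
  0 = \sum_(k < N) dp k (w k) -> forall k, (k < N)%N -> w k = 0.
Proof.
move=> ew E0.
apply: (dpow_decomp_integral v_trans boson_rel (Hz := fun x => x = 0) _ _ _ _ _ E0 ew) => //.
- by move=> a x y _ -> ->; rewrite scaler0 addr0.
- by move=> x ->; rewrite linear0.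
- by move=> k x ->; rewrite dpow0r.
Qed.

(** The norm of [dp k w] is [ucoef v k] times that of [w], hence regular at 0, and the descent
    applies to this single vector. *)
Lemma dp_inL k w : be w = 0 -> inL w -> inL (dp k w).
Proof.
move=> ew Lw; have [z [Ez _ _]] := inL_pos Lw.
apply: (@inL_descent 1 (fun _ => 1) (fun _ => dp k w) (1 * z) _ _ _ 0%N) => //.
- by move=> j; apply: ev1.
- by move=> j _; apply/boson_dpow_inZ/inL_inZ.
rewrite big_ord1 mul1r (form_dpow_eq v_trans boson_rel formC form_linearr adjoint k ew ew).
by apply: evM => //; apply: ev_ucoef.
Qed.

Lemma dp_invL k w : be w = 0 -> invL w -> invL (dp k w).
Proof. by move=> ew Lw; rewrite /invL -dpowZ; apply: dp_inL => //; apply: be_scale0. Qed.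

Lemma be_nilp x : exists N, iter N be x = 0.
Proof.
have [s _ Ex] := pbw_expand x.
have iter0 k : iter k be 0 = 0 by elim: k => //= k ->; rewrite linear0.
have nil d : forall m, (sz m < d)%N -> iter d be (pbw m) = 0.
  elim: d => // d IH m lt; rewrite iterSr (be_pbw (leqnn _)) iter_sum big1 // => k _.
  rewrite iterZ /becoef; case: ifP => Xk; last by rewrite scale0r.
  rewrite IH ?scaler0 //; have := sz_mp (vd_mm Xk); rewrite mmK // => E; lia.
exists (\sum_(m <- s) (sz m).+1)%N; rewrite Ex iter_sum big1_seq // => m /andP[_ ms].
by rewrite iterZ nil ?scaler0 // (big_rem m) //= leq_addr.
Qed.

(** * Components of the PBW elements *)

Definition isdecomp x (xs : seq H) :=
  x = \sum_(k < size xs) dp k (nth 0 xs k) /\ forall k, be (nth 0 xs k) = 0.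

Lemma decomp_ex x : exists xs, isdecomp x xs.
Proof.
have [N EN] := be_nilp x; have [xs [<- E exs]] := dpow_decomp v_trans boson_rel EN.
by exists xs.
Qed.

Variable xs : T -> seq H.
Hypothesis xsP : forall m, isdecomp (pbw m) (xs m).
(** The decompositions [xs] are arbitrary, so that the choice made in [ftilde] is covered; beyond
    the end of the list the default 0 is the true component. *)
Definition comp m k := nth 0 (xs m) k.

Lemma comp_e m k : be (comp m k) = 0.
Proof. by case: (xsP m) => _; apply. Qed.

Lemma comp_large m k : (size (xs m) <= k)%N -> comp m k = 0.
Proof. exact: nth_default. Qed.

Lemma sum_widen (g : nat -> H) D D' : (D <= D')%N -> (forall k, (D <= k)%N -> g k = 0) ->
  \sum_(k < D) g k = \sum_(k < D') g k.
Proof.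
move=> le g0; rewrite (big_ord_widen _ g le) big_mkcond; apply: eq_bigr => k _.
by case: ltnP => // /g0.
Qed.

Lemma comp_sum m N : (size (xs m) <= N)%N -> pbw m = \sum_(k < N) dp k (comp m k).
Proof.
move=> le; case: (xsP m) => {1}-> _; apply: (sum_widen le (g := fun k => dp k (comp m k))).
by move=> k lk; rewrite comp_large // dpow0r.
Qed.

Lemma comp_inL m k : inL (comp m k).
Proof.
have [lt|le] := ltnP k (size (xs m)); last by rewrite comp_large //; apply: inL0.
exact: (comps_inL (comp_e m) (comp_sum (leqnn _)) (inL_pbw m) lt).
Qed.

Definition xbound m := (\sum_(j < L m) (size (xs (mp m j)) + size (xs (mm m j))) + size (xs m))%N.

Lemma xbound_mp m j : (j < L m)%N -> (size (xs (mp m j)) <= xbound m)%N.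
Proof. by move=> lj; rewrite /xbound (bigD1 (Ordinal lj)) //=; lia. Qed.

Lemma xbound_mm m j : (j < L m)%N -> (size (xs (mm m j)) <= xbound m)%N.
Proof. by move=> lj; rewrite /xbound (bigD1 (Ordinal lj)) //=; lia. Qed.

(** Uniqueness of the components of [be (pbw m)]: [be] sends f^(k+1) of a component to v^-k times
    f^(k) of it. *)
Lemma comp_be m k : v ^- k *: comp m k.+1 = \sum_(j < L m) becoef m j *: comp (mm m j) k.
Proof.
pose N := maxn k.+1 (xbound m).+1.
have leN : (xbound m < N)%N by rewrite /N leq_maxr.
have lek : (k < N)%N by rewrite /N leq_maxl.
apply/eqP; rewrite -subr_eq0; apply/eqP.
pose w k := v ^- k *: comp m k.+1 - \sum_(j < L m) becoef m j *: comp (mm m j) k.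
apply: (@comps_eq0 N w) lek => [j|].
  rewrite /w linearB linearZ /= comp_e scaler0 sub0r linear_sum big1 ?oppr0 // => l _.
  by rewrite linearZ /= comp_e scaler0.
apply/esym; rewrite /w; under eq_bigr => j _ do rewrite dpowB dpowZ.
rewrite sumrB; apply/eqP; rewrite subr_eq0; apply/eqP.
transitivity (be (pbw m)).
  rewrite (comp_sum (N := N.+1)); last by rewrite /xbound in leN *; lia.
  rewrite big_ord_recl linearD dpow0 comp_e add0r linear_sum; apply: eq_bigr => j _.
  by rewrite lift0 (e_dpow v_trans boson_rel) ?comp_e.
rewrite (be_pbw (leqnn _)).
under [RHS]eq_bigr => j _ do rewrite (big_morph (dp j) (dpowD v bf j) (dpow0r v bf j)).
rewrite exchange_big; apply: eq_bigr => j _ /=.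
rewrite (comp_sum (N := N)); last by apply: leq_trans (ltnW leN); apply: xbound_mm.
by rewrite scaler_sumr; apply: eq_bigr => l _; rewrite dpowZ.
Qed.

(** As for [comp_be], with [bf] sending f^(k) of a component to [k+1] times f^(k+1) of it. *)
Lemma comp_bf m k : gqint v k.+1 *: comp m k = \sum_(j < L m) bfcoef m j *: comp (mp m j) k.+1.
Proof.
pose N := maxn k.+2 (xbound m).+2.
have leN : ((xbound m).+1 < N)%N by rewrite /N leq_maxr.
have lek : (k.+1 < N)%N by rewrite /N leq_maxl.
(* [bf] raises indices by one, so [bf (pbw m)] has component 0 in index 0. *)
pose c0 k := if k is k'.+1 then gqint v k *: comp m k' else 0.
pose w k := c0 k - \sum_(j < L m) bfcoef m j *: comp (mp m j) k.
apply/eqP; rewrite -subr_eq0; apply/eqP.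
apply: (@comps_eq0 N w) lek => [j|].
  rewrite /w linearB linear_sum big1 ?subr0 => [|l _]; last by rewrite linearZ /= comp_e scaler0.
  by rewrite /c0; case: j => [|j]; rewrite ?linear0 // linearZ /= comp_e scaler0.
apply/esym; rewrite /w; under eq_bigr => j _ do rewrite dpowB.
rewrite sumrB; apply/eqP; rewrite subr_eq0; apply/eqP.
transitivity (bf (pbw m)).
  rewrite (comp_sum (N := N.-1)); last by rewrite /xbound in leN *; lia.
  rewrite linear_sum; case: (N) leN => // N' _; rewrite big_ord_recl /c0 dpow0 add0r.
  by apply: eq_bigr => j _; rewrite lift0 dpowZ (f_dpow v_trans).
rewrite (bf_pbw (leqnn _)).
under [RHS]eq_bigr => j _ do rewrite (big_morph (dp j) (dpowD v bf j) (dpow0r v bf j)).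
rewrite exchange_big; apply: eq_bigr => j _ /=.
rewrite (comp_sum (N := N)); last by apply: leq_trans (ltnW (ltnW leN)); apply: xbound_mp.
by rewrite scaler_sumr; apply: eq_bigr => l _; rewrite dpowZ.
Qed.

(** The minimum of S is at most 0, its value for large [k]; thus [d] can be a natural number. *)
Definition hasmin m (d : nat) := (forall k, - d%:Z <= S m k) /\ exists k, S m k = - d%:Z.

(** S increases strictly just after its last minimum, and by [S_step] this forces X to be positive
    there. *)
Lemma hasmin_last m d : hasmin m d -> (0 < d)%N ->
  exists k, [/\ S m k = - d%:Z, (0 < X m k)%N & forall j, (k < j)%N -> - d%:Z < S m j].
Proof.
move=> [mn [k0 Ek0]] d0.
have bnd k : S m k == - d%:Z -> (k <= L m)%N.
  by move/eqP=> E; rewrite leqNgt; apply/negP => /ltnW/S_large E0; rewrite E0 in E; lia.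
have ex : exists k, S m k == - d%:Z by exists k0; apply/eqP.
case: (ex_maxnP ex bnd) => k /eqP Ek kmax; exists k.
have gt j : (k < j)%N -> - d%:Z < S m j.
  move=> lt; rewrite lt_neqAle mn andbT eq_sym; apply/negP => /kmax; lia.
split=> //; have := gt k.+1 (ltnSn k); have := S_step m k; rewrite Ek; lia.
Qed.

(** Undoing the move adds 2 before [j] and 1 at [j]; after [j] S already exceeds the minimum. *)
Lemma hasmin_mm m d j : hasmin m d -> (0 < d)%N -> (0 < X m j)%N -> S m j = - d%:Z ->
  (forall l, (j < l)%N -> - d%:Z < S m l) -> hasmin (mm m j) d.-1.
Proof.
move=> [mn _] d0 Xj Sj gt; split; last by exists j; rewrite S_mm // ltnn eqxx Sj; lia.
move=> k; rewrite S_mm //; case: (ltngtP k j) => [lt|lt|->].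
- have := mn k; lia.
- have := gt k lt; lia.
- rewrite Sj; lia.
Qed.

(** The later minimum at [l] is out of reach of the move at [j]. *)
Lemma hasmin_mm_neq m d j l : hasmin m d -> (0 < X m j)%N -> (j < l)%N -> S m l = - d%:Z ->
  S m j = - d%:Z -> hasmin (mm m j) d.
Proof.
move=> [mn _] Xj jl Sl Sj; split; last first.
  by exists l; rewrite S_mm // ltnNge (ltnW jl) /= gtn_eqF // addr0.
by move=> k; rewrite S_mm //; have := mn k; case: (ltngtP k j); lia.
Qed.

Lemma ev_vz (z : int) : 0 <= z -> polyv v (v ^ z) /\ ev v (v ^ z) (z == 0)%:Z.
Proof.
case: z => // -[|k] _; first by split; [exact: polyv1|exact: ev1].
rewrite -exprnP; split; first exact: polyv_Xn.
by have := evM (ev_v v) (ev_poly v 'X^k); rewrite mul0r gintpolyXn -exprS.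
Qed.

(** The total power of v is d + S m j, which is nonnegative and vanishes exactly at the minima. *)
Lemma becoef_ev m d j : hasmin m d -> (0 < X m j)%N ->
  let a := v ^ (d%:Z - 1) * becoef m j in polyv v a /\ ev v a (S m j == - d%:Z)%:Z.
Proof.
move=> [mn _] Xj /=; rewrite /becoef Xj mulrA -expfzDr //.
have -> : d%:Z - 1 + (S m j + 1) = d%:Z + S m j by lia.
have [|P E] := @ev_vz (d%:Z + S m j); first by have := mn j; lia.
have [P1 E1] : polyv v (if j == 0%N then 1 else 1 - v ^+ (2 * (Y m j).+1)) /\
    ev v (if j == 0%N then 1 else 1 - v ^+ (2 * (Y m j).+1)) 1.
  case: ifP => _; first by split; [apply: polyv1|apply: ev1].
  split; last exact: ev_1Xn.
  by exists (1%:P - 'X^(2 * (Y m j).+1)); rewrite gintpolyD gintpolyN gintpolyC gintpolyXn.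
split; first exact: polyvM.
have -> : (S m j == - d%:Z) = (d%:Z + S m j == 0) by lia.
by rewrite -[X in ev v _ X]mulr1; apply: evM.
Qed.

Lemma bfcoef_ev m d j : hasmin m d -> vd m j ->
  let a := v ^+ d * bfcoef m j in polyv v a /\ ev v a (S m j == - d%:Z)%:Z.
Proof.
move=> [mn _] vj /=; rewrite /bfcoef vj mulrA exprnP -expfzDr //.
have [|P E] := @ev_vz (d%:Z + S m j); first by have := mn j; lia.
split; first by apply: polyvM => //; apply: polyv_qn.
have -> : (S m j == - d%:Z) = (d%:Z + S m j == 0) by lia.
by rewrite -[X in ev v _ X]mulr1; apply: evM => //; apply: ev_qn.
Qed.

(* <m> is congruent mod vL to its single component of index d = - min S. *)
Definition concentrated m := forall d, hasmin m d -> forall k, k != d -> invL (comp m k).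

Lemma form_invL x y : invL x -> inL y -> ev v (form x y) 0.
Proof.
move=> Lx Ly; have -> : x = v *: (v^-1 *: x) by rewrite scalerA divff // scale1r.
rewrite formZl.
have [z Ez] : exists z, ev v (form (v^-1 *: x) y) z.
  have [s _ Es] := pbw_expand y; rewrite Es; elim: (s) => [|m r [z Ez]].
    by exists 0; rewrite big_nil form0r; apply: ev0.
  have [z1 E1] := polyv_ev (Ly m); have [z2 E2] := polyv_ev (Lx m).
  exists (z1 * (z2 * 1) + z); rewrite big_cons formDr; apply: evD => //.
  rewrite formZr; apply: evM => //; rewrite formC form_pbw; apply: evM => //.
by have := evM (ev_v v) Ez; rewrite mul0r.
Qed.

Lemma norm_congr x y z : inL x -> inL y -> invL (x - y) -> ev v (form y y) z -> ev v (form x x) z.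
Proof.
move=> Lx Ly Lxy Ey.
have -> : form x x = form (x - y) x + (form (x - y) y + form y y).
  by rewrite -formDl subrK (formC x y) -formDl subrK.
rewrite -[z]add0r; apply: evD; first exact: form_invL.
by rewrite -[z]add0r; apply: evD => //; apply: form_invL.
Qed.

Lemma norm_sum m N : (size (xs m) <= N)%N ->
  ev v (\sum_(k < N) ucoef v k * form (comp m k) (comp m k)) 1.
Proof.
move=> le; rewrite -(form_decomp v_trans boson_rel formC form_linearr adjoint N (comp_e m)).
by rewrite -comp_sum // form_pbw pbwc_pbw eqxx mul1r.
Qed.

(** All other components have form value 0 at v = 0, so this one carries the whole norm 1 of the PBW
    element. *)
Lemma concentrated_norm m d : concentrated m -> hasmin m d -> ev v (form (comp m d) (comp m d)) 1.
Proof.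
move=> cl hm; pose N := (d.+1 + size (xs m))%N.
have := @norm_sum m N; rewrite leq_addl => /(_ isT).
have ltd : (d < N)%N by rewrite /N leq_addr.
have [z Ez] : exists z, ev v (form (comp m d) (comp m d)) z.
  by have [z []] := inL_pos (comp_inL m d); exists z.
suff E : ev v (\sum_(k < N) ucoef v k * form (comp m k) (comp m k)) z.
  by move/(ev_inj v_trans E) => <-.
rewrite (bigD1 (Ordinal ltd)) //= -[z]addr0; apply: evD.
  by rewrite -[z]mul1r; apply: evM => //; apply: ev_ucoef.
elim/big_ind: _ => [|a b Ea Eb|k kd]; [exact: ev0|by rewrite -[0]addr0; apply: evD|].
rewrite -[0](mulr0 1); apply: evM; first exact: ev_ucoef.
by apply: form_invL; [apply: (cl d hm)|apply: comp_inL].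
Qed.

(** The form values of all components at v = 0 add up to 1, which component [d] already accounts
    for; by positivity the others lie in vL. *)
Lemma concentrated_of_norm m d : (forall k, (d < k)%N -> invL (comp m k)) ->
  ev v (form (comp m d) (comp m d)) 1 -> forall k, k != d -> invL (comp m k).
Proof.
move=> big nd k kd; pose N := (d.+1 + k.+1 + size (xs m))%N.
have := @norm_sum m N; rewrite leq_addl => /(_ isT) EN.
have ltd : (d < N)%N by rewrite /N; lia.
have ltk : (k < N)%N by rewrite /N; lia.
pose y j := if j == d then 0 else comp m j.
have Ly j : (j < N)%N -> inL (y j).
  by move=> _; rewrite /y; case: ifP => _; [apply: inL0|apply: comp_inL].
have [z [Ez _ /(_ _ k ltk)]] := inL_pos_sum (ev_ucoef v_trans) Ly.
rewrite /y (negbTE kd); apply.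
have E2 : \sum_(j < N) ucoef v j * form (comp m j) (comp m j) =
    ucoef v d * form (comp m d) (comp m d) + \sum_(j < N) ucoef v j * form (y j) (y j).
  rewrite (bigD1 (Ordinal ltd)) //=; congr (_ + _).
  rewrite [RHS](bigD1 (Ordinal ltd)) //= (_ : y d = 0) ?form0r ?mulr0 ?add0r; last by rewrite /y eqxx.
  by apply: eq_bigr => j jd; rewrite /y -[nat_of_ord j == d]/(j == Ordinal ltd) (negbTE jd).
rewrite E2 in EN.
have := ev_inj v_trans EN (evD (evM (ev_ucoef v_trans d) nd) Ez); lia.
Qed.

(** Induction on [sz] through [cE]. For positive [d], component [d] reduces modulo v to component d
    - 1 of [mm m j1], where [j1] is the last minimum, and so has norm 1 at v = 0. The components
    below [d] are out of reach of [cE]; the norm excludes them. *)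
Lemma concentratedP m : concentrated m.
Proof.
have [b] := ubnP (sz m); elim: b m => // b IH m ltb d hm.
have IHm j : (0 < X m j)%N -> concentrated (mm m j).
  move=> Xj; apply: IH; have := sz_mp (vd_mm Xj); rewrite mmK // => E; lia.
have cE k : comp m k.+1 = \sum_(j < L m) (v ^+ k * becoef m j) *: comp (mm m j) k.
  have := congr1 (fun x => v ^+ k *: x) (comp_be m k).
  rewrite scalerA divff ?expf_neq0 // scale1r scaler_sumr => ->.
  by apply: eq_bigr => j _; rewrite scalerA.
(* For [d = 0] the coefficients [becoef m j] are already divisible by v in Z[v], so all components
   of positive index lie in vL. *)
have [d0|d0] := posnP d.
  move=> k; rewrite d0; case: k => // k _; rewrite cE; apply: invL_sum => j _.
  have [Xj|] := boolP (0 < X m j)%N; last first.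
    by move/negbTE=> Xj; rewrite /becoef Xj mulr0 scale0r; apply: invL0.
  apply: invLZv; last exact: comp_inL.
  have [pa _] := becoef_ev hm Xj.
  rewrite mulrCA; apply: polyvM; first exact: polyv_Xn.
  by rewrite d0 sub0r exprN1 in pa.
have pos k j : (d <= k.+1)%N -> (0 < X m j)%N ->
    v ^+ k * becoef m j = v ^+ (k.+1 - d) * (v ^ (d%:Z - 1) * becoef m j).
  move=> le Xj; rewrite mulrA; congr (_ * _); rewrite !exprnP -expfzDr //; congr (_ ^ _).
  by rewrite -subzn //; lia.
have big k : (d < k)%N -> invL (comp m k).
  case: k => // k lt; rewrite cE; apply: invL_sum => j _.
  have [Xj|] := boolP (0 < X m j)%N; last first.
    by move/negbTE=> Xj; rewrite /becoef Xj mulr0 scale0r; apply: invL0.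
  apply: invLZv; last exact: comp_inL; rewrite pos ?(ltnW lt) // mulrA; apply: polyvM.
    by rewrite subSn // exprS mulKf //; apply: polyv_Xn.
  by case: (becoef_ev hm Xj).
have [j1 [Sj1 Xj1 gt1]] := hasmin_last hm d0.
have hm1 := hasmin_mm hm d0 Xj1 Sj1 gt1.
apply: concentrated_of_norm => //.
apply: (norm_congr (y := comp (mm m j1) d.-1)); [exact: comp_inL|exact: comp_inL| |]; last first.
  exact: (concentrated_norm (IHm j1 Xj1) hm1).
have lt1 := X_lt Xj1.
rewrite -{1}(prednK d0) cE (bigD1 (Ordinal lt1)) //= addrAC -{2}[comp (mm m j1) d.-1]scale1r -scalerBl.
have aE j : (0 < X m j)%N -> v ^+ d.-1 * becoef m j = v ^ (d%:Z - 1) * becoef m j.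
  by move=> Xj; rewrite (pos d.-1 j) ?prednK // subnn expr0 mul1r.
apply: invLD.
  apply: invLZv; last exact: comp_inL; rewrite aE //; have [pa ea] := becoef_ev hm Xj1.
  by apply: evB1 => //; rewrite Sj1 eqxx in ea.
apply: invL_sum => j jj1; have [Xj|] := boolP (0 < X m j)%N; last first.
  by move/negbTE=> Xj; rewrite /becoef Xj mulr0 scale0r; apply: invL0.
rewrite aE //; have [pa ea] := becoef_ev hm Xj.
(* At a minimum [j] other than the last, [mm m j] still has minimum -d, so its component of index d
   - 1 lies in vL by induction. *)
have [Sj|Sj] := eqVneq (S m j) (- d%:Z); last first.
  by apply: invLZv; [apply: polyv_ev0 => //; rewrite (negbTE Sj) in ea|apply: comp_inL].
apply: invLZ => //; apply: (IHm j Xj d); last by rewrite neq_ltn prednK // leqnn.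
apply: (hasmin_mm_neq hm Xj _ Sj1 Sj); have := jj1; rewrite -val_eqE /= neq_ltn => /orP[//|lt].
by have := gt1 _ lt; rewrite Sj ltxx.
Qed.

(** In [comp_bf] times v^d the left factor is [qn d.+1], of value 1 at 0, and on the right only the
    minima of S survive modulo v. For a minimum [j] after [k0] the move lowers S at [k0] by 2, so
    [mp m j] is concentrated in index d + 2. *)
Lemma crystal_congr m k0 : (forall k, S m k0 <= S m k) -> (forall k, (k < k0)%N -> S m k0 < S m k) ->
  invL (\sum_(k < size (xs m)) dp k.+1 (comp m k) - pbw (mp m k0)).
Proof.
move=> mn0 lt0.
have [d Sd] : exists d : nat, S m k0 = - d%:Z.
  by exists `|S m k0|%N; have := mn0 (L m); rewrite (S_large (leqnn (L m))) => /lez0_abs->; rewrite opprK.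
have hm : hasmin m d by split; [move=> k; rewrite -Sd|exists k0].
(* If [k0] is positive, S drops strictly just before it, so by [S_step] there is a segment to
   extend. *)
have vk0 : vd m k0.
  rewrite /vd; case: k0 {mn0 Sd} lt0 => // k /(_ k (ltnSn k)); have := S_step m k; lia.
have hm0 : hasmin (mp m k0) d.+1.
  split; last by exists k0; rewrite S_mp // ltnn eqxx Sd; lia.
  move=> k; rewrite S_mp //; case: (ltngtP k k0) => [lt|lt|->].
  - have := lt0 k lt; lia.
  - have := mn0 k; lia.
  - rewrite Sd; lia.
have main : invL (comp m d - comp (mp m k0) d.+1).
  have E := congr1 (fun x => v ^+ d *: x) (comp_bf m d).
  rewrite scalerA gqintS // mulrA divff ?expf_neq0 // mul1r scaler_sumr in E.
  have lk0 := vd_lt vk0.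
  have -> : comp m d - comp (mp m k0) d.+1 =
      (1 - qn d.+1) *: comp m d + (qn d.+1 *: comp m d - comp (mp m k0) d.+1).
    by rewrite scalerBl scale1r addrA subrK.
  apply: invLD.
    apply: invLZv; last exact: comp_inL; rewrite -opprB mulrN -mulN1r; apply: polyvM.
      by exists (-1)%:P; rewrite gintpolyC rmorphN1.
    by apply: evB1 => //; [apply: polyv_qn|apply: ev_qn].
  rewrite E (bigD1 (Ordinal lk0)) //= addrAC scalerA -{2}[comp (mp m k0) _]scale1r -scalerBl.
  apply: invLD.
    apply: invLZv; last exact: comp_inL; have [pa ea] := bfcoef_ev hm vk0.
    by apply: evB1 => //; rewrite Sd eqxx in ea.
  apply: invL_sum => j jk0; rewrite scalerA; have [vj|] := boolP (vd m j); last first.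
    by move/negbTE=> vj; rewrite /bfcoef vj mulr0 scale0r; apply: invL0.
  have [pa ea] := bfcoef_ev hm vj.
  have [Sj|Sj] := eqVneq (S m j) (- d%:Z); last first.
    by apply: invLZv; [apply: polyv_ev0 => //; rewrite (negbTE Sj) in ea|apply: comp_inL].
  apply: invLZ => //; apply: (@concentratedP _ d.+2); last by rewrite ltn_eqF.
  have lt : (k0 < j)%N.
    have := jk0; rewrite -val_eqE /= neq_ltn => /orP[/lt0|//]; by rewrite Sd Sj ltxx.
  split; last by exists k0; rewrite S_mp // lt Sd; lia.
  move=> k; rewrite S_mp //; have := mn0 k; rewrite Sd; case: (ltngtP k j); lia.
pose N := (d.+2 + size (xs m) + size (xs (mp m k0)))%N.
have -> : \sum_(k < size (xs m)) dp k.+1 (comp m k) = \sum_(k < N) dp k.+1 (comp m k).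
  apply: (sum_widen (g := fun k => dp k.+1 (comp m k))) => [|k lk]; first by rewrite /N; lia.
  by rewrite comp_large // dpow0r.
rewrite (comp_sum (N := N.+1)); last by rewrite /N; lia.
(* Index 0 of [mp m k0] has no counterpart in the other sum; it lies in vL because it differs from d
   + 1. *)
rewrite [X in _ - X]big_ord_recl opprD addrCA; apply: invLD.
  apply: invLN; apply: dp_invL; [exact: comp_e|exact: (concentratedP hm0)].
rewrite -sumrB; apply: invL_sum => k _; rewrite lift0 -dpowB; apply: dp_invL.
  by rewrite linearB /= !comp_e subr0.
have [->|kd] := eqVneq (k : nat) d; first exact: main.
by apply: invLB; [apply: (concentratedP hm)|apply: (concentratedP hm0); rewrite eqSS].
Qed.

End Form.
End Boson.

(** * Identification with the constructions of the statement *)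

Section Transfer.
Variables (R : realType) (n : nat).
Local Notation v := (vv R).

Lemma qfactE : @qfact R = gqfact v. Proof. reflexivity. Qed.
Lemma umulE : @umul R n = @gumul _ v n. Proof. reflexivity. Qed.
Lemma fopE i : @fop R n i = ghmul (@umul R n) (pbw R (mseg1 1 i)). Proof. reflexivity. Qed.
Lemma pnormE : @pbw_norm R n = @gpnorm _ v n. Proof. reflexivity. Qed.
Lemma hformE : @hform R n = gform v (@pbw_exp n) (@pbw_norm R n). Proof. reflexivity. Qed.
Lemma pbwE : @pbw R n = gpbw v (@pbw_exp n). Proof. reflexivity. Qed.
Lemma fdivE i : @fdiv R n i = gfdiv (@qfact R) (fop i). Proof. reflexivity. Qed.
Lemma hall_eprimeE i : @eprime R n i = geprime (fop i) (@hform R n). Proof. reflexivity. Qed.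
Lemma ftildeE i : @ftilde R n i = gftilde (@fdiv R n i) (eprime i). Proof. reflexivity. Qed.
Lemma in_vLE : @in_vL R n = gin_vL v (@pbw_exp n). Proof. reflexivity. Qed.

Lemma transfer (m : mseg n) i k0 :
  let fo := ghmul (@gumul _ v n) (gpbw v (@pbw_exp n) (mseg1 1 i)) in
  gin_vL v (@pbw_exp n) (gftilde (gfdiv (gqfact v) fo) (geprime fo (gform v (@pbw_exp n) (@gpnorm _ v n)))
     (gpbw v (@pbw_exp n) m) - gpbw v (@pbw_exp n) (mplus m k0 i))%R ->
  in_vL (ftilde i (pbw R m) - pbw R (mplus m k0 i))%R.
Proof. rewrite ftildeE fdivE hall_eprimeE qfactE fopE umulE hformE pbwE pnormE in_vLE; exact. Qed.

End Transfer.

Section FormTheory.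
Variables (K : fieldType) (v : K) (T : choiceType) (pe : T -> int) (nm : T -> K).
Local Notation H := {malg K[T]}.
Local Notation pbw := (gpbw v pe).
Local Notation pbwc := (gpbwc v pe).
Local Notation form := (gform v pe nm).
Hypothesis v_neq0 : v != 0.

Lemma gformE (x y : H) (d : {fset T}) : (msupp x `<=` d)%fset ->
  form x y = \sum_(m <- d) pbwc x m * pbwc y m * nm m.
Proof.
move=> sd; rewrite /gform (big_fset_incl _ sd) // => m _ ms.
by rewrite gpbwc_eq0 // !mul0r.
Qed.

Lemma gformC (x y : H) : form x y = form y x.
Proof.
rewrite (gformE y (fsubsetUl _ (msupp y))) (gformE x (fsubsetUr (msupp x) _)).
by apply: eq_bigr => m _; congr (_ * _); rewrite mulrC.
Qed.

Lemma gform_linearr (x : H) a (y z : H) : form x (a *: y + z) = a * form x y + form x z.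
Proof.
rewrite /gform mulr_sumr -big_split; apply: eq_bigr => m _ /=.
rewrite gpbwcD gpbwcZ; ring.
Qed.

Lemma gform_pbw (x : H) m : form (pbw m) x = pbwc x m * nm m.
Proof. by rewrite /gform msupp_gpbw // big_seq_fset1 gpbwc_pbw // eqxx mul1r. Qed.

Lemma gpbwc_linear a (x y : H) m : pbwc (a *: x + y) m = a * pbwc x m + pbwc y m.
Proof. by rewrite gpbwcD gpbwcZ. Qed.

Lemma gpbw_expand_uniq (x : H) :
  exists2 s : seq T, uniq s & x = \sum_(m <- s) pbwc x m *: pbw m.
Proof.
exists (msupp x); first exact: fset_uniq.
exact: (gpbw_expand pe v_neq0 (fsubset_refl (msupp x))).
Qed.

Lemma gin_vLP (x : H) : (forall m, polyv v (pbwc (v^-1 *: x) m)) -> gin_vL v pe x.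
Proof.
move=> Px; have [s _ E] := gpbw_expand_uniq x.
pose c m := proj1_sig (constructive_indefinite_description _ (Px m)).
have cP m : pbwc x m = v * gintpoly (c m) v.
  rewrite -(proj2_sig (constructive_indefinite_description _ (Px m))) gpbwcZ.
  by rewrite mulrA divff ?mul1r.
exists s, c; rewrite {1}E; apply: eq_bigr => m _; by rewrite cP.
Qed.

End FormTheory.

(** * The crystal congruence in a free module *)

Section AbstractCrystal.
Variables (K : fieldType) (v : K) (T : choiceType) (pe : T -> int) (nm : T -> K).
Local Notation H := {malg K[T]}.
Local Notation pbw := (gpbw v pe).
Local Notation pbwc := (gpbwc v pe).
Local Notation form := (gform v pe nm).
Hypothesis v_trans : forall p : {poly int}, gintpoly p v = 0 -> p = 0.
Variables (X Y : T -> nat -> nat) (S : T -> nat -> int) (mp mm : T -> nat -> T) (L : T -> nat).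
Local Notation vd := (vd Y).
Hypothesis vd_lt : forall m k, vd m k -> (k < L m)%N.
Hypothesis X_lt : forall m k, (0 < X m k)%N -> (k < L m)%N.
Hypothesis X_mp : forall m k j, vd m k -> X (mp m k) j = (X m j + (j == k))%N.
Hypothesis Y_mp : forall m k j, vd m k -> (0 < j)%N -> (Y (mp m k) j + (j == k) = Y m j)%N.
Hypothesis S_mp : forall m k j, vd m k ->
  S (mp m k) j = S m j - (if (j < k)%N then 2 else if j == k then 1 else 0).
Hypothesis mpK : forall m k, vd m k -> mm (mp m k) k = m.
Hypothesis mmK : forall m k, (0 < X m k)%N -> mp (mm m k) k = m.
Hypothesis vd_mm : forall m k, (0 < X m k)%N -> vd (mm m k) k.
Hypothesis mp_mm : forall m k j, j != k -> vd m k -> (0 < X m j)%N ->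
  mm (mp m k) j = mp (mm m j) k.
Hypothesis mp_mp : forall m k j, vd m k -> vd m j -> j != k -> mp (mp m k) j = mp (mp m j) k.
Hypothesis S_step : forall m k, S m k - S m k.+1 = (Y m k.+1)%:Z - (X m k)%:Z.
Hypothesis S_large : forall m k, (L m <= k)%N -> S m k = 0.
Hypothesis nm_mp : forall m k, vd m k ->
  nm (mp m k) * qn v (X m k).+1 = nm m * (if k == 0%N then 1 else 1 - v ^+ (2 * Y m k)).
Hypothesis nm_neq0 : forall m, nm m != 0.
Hypothesis nm_ev : forall m, ev v (nm m) 1.
Variable sz : T -> nat.
Hypothesis sz_mp : forall m k, vd m k -> sz (mp m k) = (sz m).+1.
Variables (um : T -> T -> H) (a0 : T).
Local Notation fo := (ghmul um (pbw a0)).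
Hypothesis fo_pbw : forall m D, (L m <= D)%N ->
  fo (pbw m) = \sum_(k < D) bfcoef v X Y S m k *: pbw (mp m k).

Let v_neq0 : v != 0 := vv_neq0 v_trans.

Let bf : {linear H -> H} := linext v pe (fun b => fo (pbw b)).
Let be : {linear H -> H} :=
  linext v pe (fun c => \sum_(k < L c) becoef v X Y S c k *: pbw (mm c k)).
Let fk k : {linear H -> H} :=
  linext v pe (fun m => bfcoef v X Y S m k *: pbw (mp m k)).

Let foE : fo = bf :> (H -> H).
Proof. by apply: functional_extensionality => x; apply: (hmul_pbwE pe v_neq0). Qed.

Let bf_pbw m D : (L m <= D)%N -> bf (pbw m) = \sum_(k < D) bfcoef v X Y S m k *: pbw (mp m k).
Proof. by move=> le; rewrite -foE; apply: fo_pbw. Qed.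

Let be_pbw m D : (L m <= D)%N -> be (pbw m) = \sum_(k < D) becoef v X Y S m k *: pbw (mm m k).
Proof.
move=> le; apply: etrans (linext_pbw pe v_neq0 _ m) _.
apply: (sum_widen (g := fun k => becoef v X Y S m k *: pbw (mm m k)) le) => k lk.
by rewrite (becoef_large v Y S X_lt lk) scale0r.
Qed.

Let fk_pbw k m : fk k (pbw m) = bfcoef v X Y S m k *: pbw (mp m k).
Proof. exact: (linext_pbw pe v_neq0 _ m). Qed.

Let pl := @gpbwc_linear K v T pe.
Let pp := @gpbwc_pbw K v T pe v_neq0.
Let px := @gpbw_expand_uniq K v T pe v_neq0.
Let fC := @gformC K v T pe nm.
Let fl := @gform_linearr K v T pe nm.
Let fp := @gform_pbw K v T pe nm v_neq0.

Let adj (x y : H) : form (bf x) y = form x (be y) :=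
 adjoint pp px X_mp Y_mp S_mp mpK mmK vd_mm bf_pbw be_pbw nm_mp fC fl fp x y.

Let geprimeE (y : H) : geprime fo form y = be y.
Proof.
apply: (eprimeE pl pp px X_mp Y_mp S_mp mpK mmK vd_mm bf_pbw be_pbw nm_mp fC fl fp nm_neq0).
move: (epsilon_spec (inhabits 0) (fun z : H => forall x : H, form (fo x) y = form x z)).
rewrite foE; apply; exists (be y) => x; exact: adj.
Qed.

Lemma crystal_gftilde m k0 : (forall k, S m k0 <= S m k) -> (forall k, (k < k0)%N -> S m k0 < S m k) ->
  gin_vL v pe (gftilde (gfdiv (gqfact v) fo) (geprime fo form) (pbw m) - pbw (mp m k0)).
Proof.
move=> mins strict.
have ee : geprime fo form = be :> (H -> H).
  by apply: functional_extensionality => y; apply: geprimeE.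
rewrite ee foE /gftilde.
(* The list picked by [ftilde]; it is a decomposition because one exists. *)
pose xs m := epsilon (inhabits [::]) (gkdecomp (gfdiv (gqfact v) bf) be (pbw m)).
have xsP m' : isdecomp v bf be (pbw m') (xs m').
  apply: (epsilon_spec (inhabits [::]) (gkdecomp (gfdiv (gqfact v) bf) be (pbw m'))).
  exact: (decomp_ex px v_trans vd_lt X_lt X_mp Y_mp S_mp mpK mmK vd_mm mp_mm S_step S_large
    bf_pbw be_pbw sz_mp).
apply: gin_vLP => //.
exact: (crystal_congr pl pp px v_trans vd_lt X_lt X_mp Y_mp S_mp mpK mmK vd_mm mp_mm S_step S_large
  bf_pbw be_pbw nm_mp fC fl fp
  (inZ_dpow pl pp px v_trans X_mp Y_mp S_mp mp_mp bf_pbw fk_pbw)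
  sz_mp nm_ev xsP mins strict).
Qed.

End AbstractCrystal.

(** * The Hall algebra as a q-boson module *)

Section Norm.
Variables (K : fieldType) (v : K) (n : nat) (i : 'I_n).
Hypothesis n_gt1 : (1 < n)%N.
Hypothesis v_trans : forall p : {poly int}, gintpoly p v = 0 -> p = 0.
Let v_neq0 : v != 0 := vv_neq0 v_trans.
Implicit Types (m : mseg n) (s : seg n).

Definition qprod a : K := \prod_(j < a) qn v j.+1.
(** The factor of the norm at a segment of length l + 1: the powers of v cancel by [gqfact_qprod],
    which makes the value 1 at v = 0 visible. *)
Definition nfac l a : K := (1 - v ^+ 2) ^+ (l * a) / qprod a.

Lemma qprod_neq0 a : qprod a != 0.
Proof. by apply/prodf_neq0 => j _; apply: qn_neq0. Qed.

Lemma qprodS a : qprod a.+1 = qprod a * qn v a.+1.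
Proof. exact: big_ord_recr. Qed.

Lemma gqfact_qprod a : v ^+ 'C(a, 2) * gqfact v a = qprod a.
Proof.
elim: a => [|a IH]; first by rewrite gqfact0 /qprod big_ord0 mulr1.
rewrite qprodS -IH gqfactS gqintS // binS bin1 exprD.
by have va := expf_neq0 a v_neq0; field.
Qed.

Lemma nfac0 l : nfac l 0 = 1.
Proof. by rewrite /nfac /qprod muln0 big_ord0 divr1. Qed.

Lemma nfacS l a : nfac l a.+1 * qn v a.+1 = nfac l a * (1 - v ^+ 2) ^+ l.
Proof.
rewrite /nfac qprodS mulnS exprD.
by have q1 := qn_neq0 v_trans (ltn0Sn a); have q2 := qprod_neq0 a; field; rewrite q1 q2.
Qed.

Lemma gpnormE m (d : {fset seg n}) : (finsupp m `<=` d)%fset ->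
  gpnorm v m = \prod_(s <- d) nfac s.1 (m s).
Proof.
move=> sd; rewrite /gpnorm -(big_fset_incl _ sd) => [|s _ ms]; last first.
  by rewrite (fsfun_dflt ms) nfac0.
apply: eq_bigr => s _; rewrite /nfac -gqfact_qprod invfM.
by rewrite mulrCA mulrA.
Qed.

Lemma nfac_neq0 l a : nfac l a != 0.
Proof. by rewrite mulf_neq0 ?invr_eq0 ?qprod_neq0 // expf_neq0 // vXn_neq1. Qed.

Lemma gpnorm_neq0 m : gpnorm v m != 0.
Proof.
by rewrite (gpnormE (fsubset_refl _)) prodf_seq_neq0; apply/allP => s _; apply: nfac_neq0.
Qed.

Lemma ev_exp a x : ev v x 1 -> ev v (x ^+ a) 1.
Proof.
move=> ex; elim: a => [|a IH]; first exact: ev1.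
by rewrite exprS -[X in ev _ _ X]mulr1; apply: evM.
Qed.

Lemma gpnorm_ev m : ev v (gpnorm v m) 1.
Proof.
rewrite (gpnormE (fsubset_refl _)); elim/big_ind: _ => [|x y Hx Hy|s _]; first exact: ev1.
  by rewrite -[X in ev _ _ X]mulr1; apply: evM.
rewrite -[X in ev _ _ X]mulr1; apply: evM; first by apply: ev_exp; apply: ev_1Xn.
apply: evV; first exact: qprod_neq0.
rewrite /qprod; elim/big_ind: _ => [|x y Hx Hy|j _]; [exact: ev1| |exact: ev_qn].
by rewrite -[X in ev _ _ X]mulr1; apply: evM.
Qed.

Lemma prod_fset_pick (d : {fset seg n}) s0 (a : K) : s0 \in d ->
  \prod_(s <- d) (if s == s0 then a else 1) = a.
Proof.
move=> s0d; rewrite (bigD1_seq s0) ?fset_uniq //= eqxx big1 ?mulr1 // => s.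
by move/negbTE->.
Qed.

(** Only the new and the extended segment change their factors. The powers of 1 - v^2 they carry
    differ by one, which turns [qn] of the multiplicity a of the extended segment into 1 -
    v^(2a). *)
Lemma gpnorm_mp m k : valid i m k ->
  gpnorm v (mp i m k) * qn v (m (k, i)).+1 =
  gpnorm v m * (if k is k'.+1 then 1 - v ^+ (2 * m (k', ord_pred i)) else 1).
Proof.
move=> vk; pose d := (finsupp m `|` finsupp (mp i m k))%fset.
rewrite (gpnormE (fsubsetUl _ _ : finsupp m `<=` d)%fset).
rewrite (gpnormE (fsubsetUr _ _ : finsupp (mp i m k) `<=` d)%fset).
have kd : (k, i) \in d by rewrite inE orbC mem_finsupp mp_self.
rewrite -(prod_fset_pick (qn v (m (k, i)).+1) kd) -big_split /=.
(* By [nfacS], [b] is the ratio of the factors after and before one copy of the extended segment is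
   taken away. *)
pose b s : K := if k is k'.+1 then
  (if s == (k', ord_pred i) then qn v (m s) / (1 - v ^+ 2) ^+ k' else 1) else 1.
have nz : 1 - v ^+ 2 != 0 by apply: vXn_neq1.
transitivity (\prod_(s <- d) (nfac s.1 (m s) *
    ((if s == (k, i) then (1 - v ^+ 2) ^+ k else 1) * b s))); last first.
  rewrite !big_split /= (prod_fset_pick _ kd); congr (_ * _); rewrite /b.
  case: k vk @d kd {b} => [|k] vk d kd; first by rewrite big1_eq mulr1.
  set s0 := (k, ord_pred i).
  have s0d : s0 \in d by rewrite inE mem_finsupp -lt0n [(0 < _)%N]vk.
  rewrite (eq_bigr (fun s => if s == s0 then qn v (m s0) / (1 - v ^+ 2) ^+ k else 1)) => [|s _].
    rewrite (prod_fset_pick _ s0d) -qn_mul // exprS.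
    by have nk := expf_neq0 k nz; field.
  by case: eqP => // ->.
apply: eq_bigr => s _; have [->|sk] := eqVneq s (k, i).
  have -> : b (k, i) = 1.
    rewrite /b; case: (k) => // k'; rewrite xpair_eqE [i == _]eq_sym ord_pred_neq //.
    by rewrite andbF.
  by rewrite mp_self // nfacS mulr1.
rewrite mul1r mulr1 mpE (negbTE sk) addn0 /b; case: k vk {d kd b sk} => [|k] vk; first by rewrite subn0 mulr1.
have [->|_] := eqVneq s (k, ord_pred i); last by rewrite subn0 mulr1.
have [a Ea] : exists a, m (k, ord_pred i) = a.+1 by exists (m (k, ord_pred i)).-1; rewrite prednK.
have nk := expf_neq0 k nz.
by rewrite Ea subn1 /= mulrA nfacS mulfK.
Qed.

End Norm.

(** * Combinatorics of the moves *)

Section MoveCombinatorics.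
Variables (n : nat) (i : 'I_n).
Implicit Types (m : mseg n) (s : seg n) (k j : nat).

Definition nhead m k := m (k, i).
(** At [k = 0] no segment is extended; the value 0 is a default, and [vd] admits [k = 0]
    separately. *)
Definition nprev m k := if k is k'.+1 then m (k', ord_pred i) else 0%N.
Definition tailsum m k := Ssum m k.+1 i.
Definition msize m := (\sum_(s <- enum_mset m) s.1.+1)%N.

Local Notation vd := (vd nprev).
Local Notation mp := (mp i).
Local Notation mm := (mminus i).

Lemma vdE m k : vd m k = valid i m k.
Proof. by case: k. Qed.

Lemma nhead_lt m k : (0 < nhead m k)%N -> (k < lbound m)%N.
Proof.
rewrite /nhead -count_mem_mset -has_count has_pred1 ltnS => kb.
by rewrite (big_rem _ kb) /= (leq_trans _ (leq_maxl _ _)).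
Qed.

Lemma vd_lbound m k : vd m k -> (k < lbound m)%N.
Proof. by rewrite vdE; apply: valid_lbound. Qed.

Lemma tailsum_step m k : tailsum m k - tailsum m k.+1 = (nprev m k.+1)%:Z - (nhead m k)%:Z.
Proof.
by rewrite /tailsum !SsumE // (heads_atS i k) (heads_atS (ord_pred i) k) /nhead /nprev /=; lia.
Qed.

Lemma tailsum_large m k : (lbound m <= k)%N -> tailsum m k = 0.
Proof.
move=> lk; rewrite /tailsum /Ssum big1_seq // => s /andP[ks sm].
suff : (s.1 < lbound m)%N by lia.
by rewrite ltnS (big_rem _ sm) /= (leq_trans _ (leq_maxl _ _)).
Qed.

Hypothesis n_gt1 : (1 < n)%N.

Lemma nhead_mp m k j : vd m k -> nhead (mp m k) j = (nhead m j + (j == k))%N.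
Proof.
move=> _; rewrite /nhead mpE xpair_eqE eqxx andbT; case: k => [|k]; first by rewrite subn0.
by rewrite xpair_eqE [i == _]eq_sym ord_pred_neq // andbF subn0.
Qed.

Lemma nprev_mp m k j : vd m k -> (0 < j)%N -> (nprev (mp m k) j + (j == k) = nprev m j)%N.
Proof.
case: j => // j; rewrite vdE /nprev mpE xpair_eqE ord_pred_neq // andbF addn0.
case: k => [|k] /=; first by rewrite subn0 addn0.
by rewrite xpair_eqE eqxx andbT eqSS; case: eqP => [->|_ _] /= mk; rewrite ?subn0 ?addn0 // subnK.
Qed.

Lemma tail_weight m k (phi : seg n -> nat) : valid i m k ->
  (\sum_(s <- enum_mset (mp m k)) phi s + \sum_(s <- mtail i k) phi s =
   \sum_(s <- enum_mset m) phi s + phi (k, i))%N.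
Proof. by move=> vk; rewrite sum_mminus ?mminus_mp // mp_self. Qed.

Lemma tailsum_mp m k j : vd m k ->
  tailsum (mp m k) j = tailsum m j - (if (j < k)%N then 2 else if j == k then 1 else 0).
Proof.
rewrite vdE /tailsum !SsumE // !heads_atE => vk.
have := tail_weight (fun s => nat_of_bool ((s.2 == i) && (j <= s.1)%N)) vk.
have := tail_weight (fun s => nat_of_bool ((s.2 == ord_pred i) && (j <= s.1)%N)) vk.
set A := (\sum_(_ <- _) _)%N; set B := (\sum_(_ <- _) _)%N; set C := (\sum_(_ <- _) _)%N.
set A' := (\sum_(_ <- _) _)%N; set B' := (\sum_(_ <- _) _)%N; set C' := (\sum_(_ <- _) _)%N.
have -> : B = (j < k)%N.
  rewrite /B; case: (k) => [|k']; first by rewrite big_nil ltn0.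
  by rewrite big_seq1 eqxx.
have -> : B' = 0%N.
  rewrite /B'; case: (k) => [|k']; first by rewrite big_nil.
  by rewrite big_seq1 ord_pred_neq.
rewrite /= eqxx [i == _]eq_sym ord_pred_neq //=.
by case: (ltngtP j k) => _ /=; lia.
Qed.

Lemma msize_mp m k : vd m k -> msize (mp m k) = (msize m).+1.
Proof.
rewrite vdE => /(tail_weight (fun s => s.1.+1)); rewrite -/(msize _) -/(msize _) /=.
by case: k => [|k]; rewrite ?big_nil ?big_seq1 /=; lia.
Qed.

Lemma mp_mminus_comm m k j : j != k -> vd m k -> (0 < nhead m j)%N ->
  mm (mp m k) j = mp (mm m j) k.
Proof.
rewrite vdE /nhead => jk vk mj; apply/msetP => x; rewrite !(mpE, mminusE).
set xk := (if k is _.+1 then _ else _); set xj := (if j is _.+1 then _ else _).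
(* The three bounds control truncation in the subtractions of natural numbers. *)
have Hj : ((x == (j, i)) <= m x)%N by case: eqP => // ->.
have Hk : (xk <= m x)%N.
  by rewrite /xk; case: (k) vk => // k' /= mk; case: eqP => // ->.
have Hkj : (xk + (x == (j, i)) <= 1)%N.
  rewrite /xk; case: (k) => [|k']; first by case: eqP.
  case: (x =P (j, i)) => [->|_]; last by case: eqP.
  by rewrite xpair_eqE [i == _]eq_sym ord_pred_neq // andbF.
by lia.
Qed.

Lemma mp_mp_comm m k j : vd m k -> vd m j -> j != k -> mp (mp m k) j = mp (mp m j) k.
Proof.
rewrite !vdE => vk vj jk; apply/msetP => x; rewrite !mpE.
set xk := (if k is _.+1 then _ else _); set xj := (if j is _.+1 then _ else _).
have Hk : (xk <= m x)%N.
  by rewrite /xk; case: (k) vk => // k' /= mk; case: eqP => // ->.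
have Hj : (xj <= m x)%N.
  by rewrite /xj; case: (j) vj => // k' /= mk; case: eqP => // ->.
have Hkj : (xk + xj <= 1)%N.
  rewrite /xk /xj; case: k j jk {vk vj xk xj Hk Hj} => [|k] [|j] // jk; do 1?[by case: eqP].
  case: (x =P (k, ord_pred i)) => [->|_]; last by case: eqP.
  by rewrite xpair_eqE [k == j]eq_sym (negbTE (jk : j != k)).
by lia.
Qed.

End MoveCombinatorics.

(** * Transcendence of v and the theorem for the Hall algebra *)

Lemma gintpoly_vv (R : realType) (p : {poly int}) :
  gintpoly p (vv R) = tofrac (map_poly intr p : {poly R[i]}).
Proof.
elim/poly_ind: p => [|p c IH]; first by rewrite -[0]/(0%:P) gintpolyC map_polyC /= !rmorph0.
rewrite gintpolyD gintpolyM gintpolyX gintpolyC IH !rmorphD !rmorphM /= map_polyX map_polyC.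
have -> : (c%:~R)%:P = c%:~R :> {poly R[i]} by exact: (rmorph_int (@polyC R[i])).
by rewrite rmorph_int.
Qed.

(** Integer polynomials embed into C[v] because C has characteristic 0. *)
Lemma vv_trans (R : realType) (p : {poly int}) : gintpoly p (vv R) = 0 -> p = 0.
Proof.
rewrite gintpoly_vv => /eqP; rewrite tofrac_eq0 => /eqP E.
apply: (@map_inj_poly _ _ (intr : int -> R[i])); first exact: intr_inj.
  by rewrite rmorph0.
by rewrite E map_poly0.
Qed.

Theorem theorem1 (R : realType) (n : nat) (m : mseg n) (i : 'I_n) (k0 : nat) :
  (1 < n)%N ->
  (0 < k0)%N ->
  (forall k : nat, (0 < k)%N -> (Ssum m k0 i <= Ssum m k i)%R) ->
  (forall k : nat, (0 < k < k0)%N -> (Ssum m k0 i < Ssum m k i)%R) ->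
  in_vL (ftilde i (pbw R m) - pbw R (mplus m k0 i))%R.
Proof.
(* Lengths start at 1; the abstract index is the length minus one. *)
case: k0 => // k0 n_gt1 _ mins strict; apply: transfer.
have vt := @vv_trans R; have v0 := vv_neq0 vt.
have mpK b k : vd (nprev i) b k -> mminus i (mp i b k) k = b by rewrite vdE; apply: mminus_mp.
have mmK b k : (0 < nhead i b k)%N -> mp i (mminus i b k) k = b by apply: mp_mminus.
have vd_mm b k : (0 < nhead i b k)%N -> vd (nprev i) (mminus i b k) k.
  by move=> bk; rewrite vdE; apply: valid_mminus.
have nm_mp b k : vd (nprev i) b k -> gpnorm (vv R) (mp i b k) * qn (vv R) (nhead i b k).+1 =
    gpnorm (vv R) b * (if k == 0%N then 1 else 1 - vv R ^+ (2 * nprev i b k)).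
  by rewrite vdE => vk; rewrite (gpnorm_mp n_gt1 vt vk); case: (k).
have fo_pbw b D : (lbound b <= D)%N ->
    ghmul (@gumul _ (vv R) n) (gpbw (vv R) (@pbw_exp n) (mseg1 1 i)) (gpbw (vv R) (@pbw_exp n) b) =
    \sum_(k < D) bfcoef (vv R) (nhead i) (nprev i) (tailsum i) b k
                    *: gpbw (vv R) (@pbw_exp n) (mp i b k).
  move=> le; rewrite (fop_pbw n_gt1 v0 (pbw_exp_mseg1 i) (pbw_exp_mminus n_gt1) le).
  by apply: eq_bigr => k _; rewrite /fcoef /bfcoef vdE.
have main := crystal_gftilde vt (@vd_lbound n i) (@nhead_lt n i) (nhead_mp n_gt1)
  (nprev_mp n_gt1) (tailsum_mp n_gt1) mpK mmK vd_mm (mp_mminus_comm n_gt1) (mp_mp_comm n_gt1)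
  (@tailsum_step n i) (@tailsum_large n i) nm_mp (gpnorm_neq0 vt) (gpnorm_ev vt) (msize_mp n_gt1)
  fo_pbw.
apply: main.
- by move=> k; apply: mins.
- by move=> k lt; apply: strict.
Qed.
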